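(* Let $\mathbb T^2=\mathbb R^2/\mathbb Z^2$; for a positive integer $m$ let $\lambda^2=4\pi^2m$, $\mathcal E_\lambda=\{\mu\in\mathbb Z^2:\|\mu\|^2=m\}$, $N=|\mathcal E_\lambda|$, and $\kappa=N^{-3}$. Let $\gamma:[0,1]\to\mathbb T^2$ be an arc-length parametrized unit length curve with non-vanishing curvature, extending analytically to $[0,1]+B(0,\epsilon)\subset\mathbb C$ for some constant $\epsilon>0$. Then for almost all $\lambda$ there exist a collection of at most $N^2$ intervals $S_\alpha\subset[0,1]$, each of length $O(\kappa)$, such that for every eigenfunction $\Phi(x)=\sum_{\mu\in\mathcal E_\lambda}a_\mu e^{2\pi i\langle\mu,x\rangle}$ with $\sum_\mu|a_\mu|^2=1$: (1) $|N_\Phi\cap\bigcup_\alpha\gamma(S_\alpha)|\ll\lambda N^{-1}$, where $N_\Phi=\{x:\Phi(x)=0\}$; (2) for any $a\in[0,1]\setminus\bigcup_\alpha S_\alpha$, $\#\{z\in B(a,N^7/\lambda):\Phi(\gamma(z))=0\}\ll N^7$.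
   Context: ''Almost all $\lambda$'' means: for all $m$ that are sums of two squares outside a set of relative density zero among such integers. $B(a,r)$ is the complex disc, and $\Phi(\gamma(z))$ for complex $z$ uses the analytic continuation of $\gamma$. Implicit constants do not depend on $\lambda$, $N$ or $\Phi$. *)

(* Defs.v *)
From Stdlib Require Import Reals List ZArith.
From Coquelicot Require Import Coquelicot.
Import ListNotations.
Open Scope R_scope.

Definition cexp (z : C) : C :=
  (exp (Re z) * cos (Im z), exp (Re z) * sin (Im z)).

Definition zrange (k : nat) : list Z :=
  map (fun j => (Z.of_nat j - Z.of_nat k)%Z) (seq 0 (2 * k + 1)).

(* E_lambda = { mu in Z^2 : |mu|^2 = m }, enumerated without repetition. *)
Definition lattice_pts (m : nat) : list (Z * Z) :=
  filter (fun mu => Z.eqb (fst mu * fst mu + snd mu * snd mu)%Z (Z.of_nat m))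
         (list_prod (zrange m) (zrange m)).

Definition Npts (m : nat) : nat := length (lattice_pts m).

Definition lam (m : nat) : R := 2 * PI * sqrt (INR m).

Definition kappa (m : nat) : R := / (INR (Npts m) ^ 3).

(* Phi(w) = sum_{mu in E} a_mu exp(2 pi i <mu, w>), w in C^2
   (for real w this is the eigenfunction; for complex w its entire extension). *)
Definition Phi (m : nat) (a : Z * Z -> C) (w1 w2 : C) : C :=
  fold_right Cplus (RtoC 0)
    (map (fun mu => Cmult (a mu)
            (cexp (Cmult (Cmult (RtoC (2 * PI)) Ci)
                   (Cplus (Cmult (RtoC (IZR (fst mu))) w1)
                          (Cmult (RtoC (IZR (snd mu))) w2)))))
         (lattice_pts m)).

Definition coef_norm2 (m : nat) (a : Z * Z -> C) : R :=
  fold_right Rplus 0 (map (fun mu => Cmod (a mu) ^ 2) (lattice_pts m)).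

Definition sum2sq (m : nat) : bool :=
  existsb (fun p => existsb (fun q => Nat.eqb (p * p + q * q) m) (seq 0 (S m)))
          (seq 0 (S m)).

Definition count_upto (P : nat -> bool) (X : nat) : nat :=
  length (filter P (seq 1 X)).

Definition rel_density_zero (E : nat -> bool) : Prop :=
  forall delta : R, 0 < delta ->
  exists X0 : nat, forall X : nat, (X0 <= X)%nat ->
    INR (count_upto (fun m => andb (E m) (sum2sq m)) X)
      <= delta * INR (count_upto sum2sq X).

Definition nbhd01 (eps : R) (z : C) : Prop :=
  exists t : R, 0 <= t <= 1 /\ Cmod (Cminus z (RtoC t)) < eps.

(* Real trace of a (lifted) curve component given by its complex extension *)
Definition rtrace (G : C -> C) (t : R) : R := Re (G (RtoC t)).

(* Main.v *)
(* The theorem holds with an empty collection of exceptional intervals: the bound (2) is proved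
   for every a in [0,1].  Put r = N^7/lambda and f(s) = Phi(gamma(a + r s)).  On |s| <= 20 the
   function f is a sum of N chirps b e^{i(w s + O(r^2 lambda))} with real frequencies |w| <= N^7,
   and by Jensen's principle it suffices to bound sup_{|s|<=20} |f| / sup_{|s|<=2} |f| by e^{C N^7}.

   For an exact exponential polynomial with n frequencies such a doubling inequality follows from
   the linear recurrence of its values along an arithmetic progression, whatever the coefficients
   and the gaps are.  Passing to f requires that no cancellation makes f smaller than the
   perturbation.  For almost all m any two points of the circle are at distance at least
   sqrt m (log m)^{-5/2}, so that at most two points have nearly the same projection on gamma'(a).
   A close pair b1 e^{i phi1} + b2 e^{i phi2} is replaced by e^{i w s} times a quadratic polynomial;
   since the curvature does not vanish, phi2 - phi1 is dominated by its Taylor terms of order one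
   and two, hence the error is small relative to the coefficients of this polynomial.  Coefficients are
   recovered from the size of the sum on [0,2] by difference operators which eliminate the other
   frequencies one at a time: those at distance >= n are eliminated at bounded total cost, and if
   the gaps are smaller then N is at most (log m)^{5/6} up to a constant, and the loss is m^{o(1)}.

   The arithmetic input is elementary: pairs of points mu, mu' on a common circle are counted
   through mu' - mu = g u, mu + mu' = k u^perp with u primitive. *)

Require Import Defs.
From Stdlib Require Import Reals List ZArith Lra Lia ClassicalEpsilon Permutation.
From Stdlib Require FinFun.
From Coquelicot Require Import Coquelicot.
Import ListNotations.
Open Scope R_scope.

(** * Complex derivatives *)

(** The exponents are tied together. The second moment of N yields only a constant times X/log X
    sums of two squares up to X, so the exceptional set must be o(X/log X). Excluding points closer
    than sqrt X (log X)^{-A} discards O(X (log X)^{1-A}) integers, which requires A > 2. After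
    rescaling by r, well separated projections differ in frequency by a constant times N^7 (log
    m)^{-2A}; comparing this with the 3N eliminations, the expensive case has N = O((log m)^{A/3}),
    and its cost is m^{o(1)} only if A < 3. The choice A = 5/2 is the midpoint.

    The other obstacle is that the approximation error must be controlled by the coefficients, which
    are themselves bounded only through the approximating sum. An unpaired term has error e =
    O(N^14/lambda), small enough to pay for eliminating one frequency as close as [th]. A merged
    pair has the larger error [th] + e, but its only close neighbour has been merged into it, so it
    never has to pay. With [th] a small negative power of m both balances hold, each term
    contributes at most 1/(2N) of the total, and the error is absorbed by the bound for the
    function. *)

(** A first-order expansion without division, with the point itself allowed, so that the product and
    chain rules reduce to triangle inequalities. *)
Definition cderiv (f : C -> C) (z d : C) : Prop :=
  forall e, 0 < e -> exists del, 0 < del /\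
    forall w, Cmod (w - z) < del -> Cmod (f w - f z - d * (w - z)) <= e * Cmod (w - z).

Definition ccont (f : C -> C) (z : C) : Prop :=
  forall e, 0 < e -> exists del, 0 < del /\
    forall w, Cmod (w - z) < del -> Cmod (f w - f z) <= e.

Lemma Cmod_minus_sym (z w : C) : Cmod (z - w) = Cmod (w - z).
Proof. rewrite <- Cmod_opp. f_equal. ring. Qed.

Lemma Cmod_triangle_minus (z w : C) : Cmod (z - w) <= Cmod z + Cmod w.
Proof. unfold Cminus. rewrite <- (Cmod_opp w). apply Cmod_triangle. Qed.

Lemma Cmod_triangle_inv (z w : C) : Cmod z - Cmod w <= Cmod (z - w).
Proof.
  assert (H := Cmod_triangle (z - w) w).
  replace (z - w + w)%C with z in H by ring. lra.
Qed.

Lemma Cmod_le_Re_Im (z : C) : Cmod z <= Rabs (Re z) + Rabs (Im z).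
Proof.
  assert (H := Cmod2_alt z).
  assert (H0 := Cmod_ge_0 z).
  assert (H1 := Rabs_pos (Re z)). assert (H2 := Rabs_pos (Im z)).
  rewrite <- (pow2_abs (Re z)), <- (pow2_abs (Im z)) in H. nra.
Qed.

Lemma im_le_Cmod (z : C) : Rabs (Im z) <= Cmod z.
Proof. eapply Rle_trans; [apply Rmax_r|apply Rmax_Cmod]. Qed.

Lemma Cmod_eq_0_minus (z w : C) : Cmod (z - w) = 0 -> z = w.
Proof. intros H. apply Cmod_eq_0 in H. replace z with (z - w + w)%C by ring. rewrite H. ring. Qed.

Lemma ex_derive_cderiv (f : C -> C) (z : C) :
  @ex_derive C_AbsRing C_NormedModule f z -> exists d, cderiv f z d.
Proof.
  intros [d [_ H]]. exists d. intros e He.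
  assert (Hl : is_filter_lim (@locally (AbsRing_UniformSpace C_AbsRing) z) z) by (intros P HP; exact HP).
  destruct (H z Hl (mkposreal e He)) as [del Hdel].
  exists del. split; [apply cond_pos|]. intros w Hw.
  specialize (Hdel w Hw). simpl in Hdel.
  replace (f w - f z - d * (w - z))%C with (f w - f z - (w - z) * d)%C by ring.
  exact Hdel.
Qed.

Lemma Rlt_Rmin (x a b : R) : x < Rmin a b -> x < a /\ x < b.
Proof. intros H. assert (H1 := Rmin_l a b). assert (H2 := Rmin_r a b). lra. Qed.

Lemma small_factor (eps k : R) : 0 < eps -> 0 < k -> exists e, 0 < e /\ e <= 1 /\ e * k <= eps.
Proof.
  intros He Hk. exists (Rmin 1 (eps / k)).
  assert (M1 := Rmin_l 1 (eps / k)). assert (M2 := Rmin_r 1 (eps / k)).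
  split; [apply Rmin_glb_lt; [lra|apply Rdiv_lt_0_compat; assumption]|]. split; [exact M1|].
  apply (Rmult_le_compat_r k) in M2; [|lra]. replace (eps / k * k) with eps in M2 by (field; lra). exact M2.
Qed.

Lemma cderiv_ccont (f : C -> C) (z d : C) : cderiv f z d -> ccont f z.
Proof.
  intros H e He. destruct (H 1 Rlt_0_1) as [del [Hd Hdel]].
  assert (Hm := Cmod_ge_0 d).
  set (k := Cmod d + 1).
  assert (Hk : 0 < e / k) by (apply Rdiv_lt_0_compat; unfold k; lra).
  exists (Rmin del (e / k)). split; [apply Rmin_glb_lt; assumption|].
  intros w Hw.
  destruct (Rlt_Rmin _ _ _ Hw) as [H1 H2].
  specialize (Hdel w H1).
  replace (f w - f z)%C with ((f w - f z - d * (w - z)) + d * (w - z))%C by ring.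
  eapply Rle_trans; [apply Cmod_triangle|]. rewrite Cmod_mult.
  apply (Rmult_lt_compat_r k) in H2; [|unfold k; lra].
  replace (e / k * k) with e in H2 by (field; unfold k; lra).
  unfold k in H2. assert (H4 := Cmod_ge_0 (w - z)). nra.
Qed.

Lemma cderiv_const (c z : C) : cderiv (fun _ => c) z 0.
Proof.
  intros e He. exists 1. split; [lra|]. intros w _.
  replace (c - c - 0 * (w - z))%C with (RtoC 0) by ring. rewrite Cmod_0.
  assert (H := Cmod_ge_0 (w - z)). nra.
Qed.

Lemma cderiv_id (z : C) : cderiv (fun w => w) z 1.
Proof.
  intros e He. exists 1. split; [lra|]. intros w _.
  replace (w - z - 1 * (w - z))%C with (RtoC 0) by ring. rewrite Cmod_0.
  assert (H := Cmod_ge_0 (w - z)). nra.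
Qed.

Lemma cderiv_plus (f g : C -> C) (z d e : C) :
  cderiv f z d -> cderiv g z e -> cderiv (fun w => (f w + g w)%C) z (d + e).
Proof.
  intros Hf Hg eps He.
  destruct (Hf (eps / 2) ltac:(lra)) as [d1 [Hd1 H1]].
  destruct (Hg (eps / 2) ltac:(lra)) as [d2 [Hd2 H2]].
  exists (Rmin d1 d2). split; [apply Rmin_glb_lt; assumption|].
  intros w Hw.
  destruct (Rlt_Rmin _ _ _ Hw) as [W1 W2].
  specialize (H1 w W1). specialize (H2 w W2).
  replace (f w + g w - (f z + g z) - (d + e) * (w - z))%C
    with ((f w - f z - d * (w - z)) + (g w - g z - e * (w - z)))%C by ring.
  eapply Rle_trans; [apply Cmod_triangle|]. lra.
Qed.

Lemma cderiv_mult (f g : C -> C) (z d e : C) :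
  cderiv f z d -> cderiv g z e -> cderiv (fun w => (f w * g w)%C) z (d * g z + f z * e).
Proof.
  intros Hf Hg eps He.
  assert (P1 := Cmod_ge_0 (f z)). assert (P2 := Cmod_ge_0 (g z)). assert (P3 := Cmod_ge_0 d).
  set (k := Cmod (f z) + Cmod (g z) + Cmod d + 2).
  destruct (small_factor eps k He ltac:(unfold k; lra)) as (e' & He' & E1 & E2).
  destruct (Hf e' He') as [d1 [Hd1 H1]].
  destruct (Hg e' He') as [d2 [Hd2 H2]].
  destruct (cderiv_ccont g z e Hg e' He') as [d3 [Hd3 H3]].
  exists (Rmin d1 (Rmin d2 d3)).
  split; [repeat apply Rmin_glb_lt; assumption|].
  intros w Hw. destruct (Rlt_Rmin _ _ _ Hw) as [W1 W']. destruct (Rlt_Rmin _ _ _ W') as [W2 W3].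
  specialize (H1 w W1). specialize (H2 w W2). specialize (H3 w W3).
  replace (f w * g w - f z * g z - (d * g z + f z * e) * (w - z))%C
    with ((f w - f z - d * (w - z)) * g w + d * (w - z) * (g w - g z)
          + f z * (g w - g z - e * (w - z)))%C by ring.
  eapply Rle_trans; [apply Cmod_triangle|].
  eapply Rle_trans; [apply Rplus_le_compat_r, Cmod_triangle|].
  rewrite !Cmod_mult.
  assert (G : Cmod (g w) <= Cmod (g z) + 1).
  { assert (HH := Cmod_triangle_inv (g w) (g z)). lra. }
  set (t := Cmod (w - z)) in *.
  assert (Ht : 0 <= t) by apply Cmod_ge_0.
  assert (A1 : Cmod (f w - f z - d * (w - z)) * Cmod (g w) <= (e' * t) * (Cmod (g z) + 1)).
  { apply Rmult_le_compat; try apply Cmod_ge_0; assumption. }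
  assert (A2 : Cmod d * t * Cmod (g w - g z) <= Cmod d * t * e').
  { apply Rmult_le_compat_l; [nra|assumption]. }
  assert (A3 : Cmod (f z) * Cmod (g w - g z - e * (w - z)) <= Cmod (f z) * (e' * t)).
  { apply Rmult_le_compat_l; assumption. }
  apply Rle_trans with (e' * k * t).
  - unfold k. nra.
  - apply Rmult_le_compat_r; assumption.
Qed.

Lemma cderiv_comp (f g : C -> C) (z d e : C) :
  cderiv g z e -> cderiv f (g z) d -> cderiv (fun w => f (g w)) z (d * e).
Proof.
  intros Hg Hf eps He.
  assert (P1 := Cmod_ge_0 d). assert (P2 := Cmod_ge_0 e).
  set (k := Cmod d + Cmod e + 2).
  destruct (small_factor eps k He ltac:(unfold k; lra)) as (e' & He' & E1 & E2).
  destruct (Hf e' He') as [d1 [Hd1 H1]].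
  destruct (Hg e' He') as [d2 [Hd2 H2]].
  destruct (cderiv_ccont g z e Hg (d1 / 2) ltac:(lra)) as [d3 [Hd3 H3]].
  exists (Rmin d2 d3). split; [apply Rmin_glb_lt; assumption|].
  intros w Hw.
  destruct (Rlt_Rmin _ _ _ Hw) as [W2 W3].
  specialize (H2 w W2). specialize (H3 w W3).
  assert (W1 : Cmod (g w - g z) < d1) by lra.
  specialize (H1 _ W1).
  replace (f (g w) - f (g z) - d * e * (w - z))%C
    with ((f (g w) - f (g z) - d * (g w - g z)) + d * (g w - g z - e * (w - z)))%C by ring.
  eapply Rle_trans; [apply Cmod_triangle|]. rewrite Cmod_mult.
  assert (G : Cmod (g w - g z) <= (Cmod e + e') * Cmod (w - z)).
  { replace (g w - g z)%C with ((g w - g z - e * (w - z)) + e * (w - z))%C by ring.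
    eapply Rle_trans; [apply Cmod_triangle|]. rewrite Cmod_mult. lra. }
  set (t := Cmod (w - z)) in *.
  assert (Ht : 0 <= t) by apply Cmod_ge_0.
  assert (A1 : e' * Cmod (g w - g z) <= e' * ((Cmod e + 1) * t)).
  { apply Rmult_le_compat_l; [lra|]. eapply Rle_trans; [exact G|].
    apply Rmult_le_compat_r; lra. }
  assert (A3 : Cmod d * Cmod (g w - g z - e * (w - z)) <= Cmod d * (e' * t)).
  { apply Rmult_le_compat_l; assumption. }
  apply Rle_trans with (e' * k * t).
  - unfold k. nra.
  - apply Rmult_le_compat_r; assumption.
Qed.

Lemma cderiv_ext_loc (f g : C -> C) (z d : C) (r : R) : 0 < r ->
  (forall w, Cmod (w - z) < r -> f w = g w) -> cderiv f z d -> cderiv g z d.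
Proof.
  intros Hr E H e He. destruct (H e He) as [del [Hd Hdel]].
  exists (Rmin del r). split; [apply Rmin_glb_lt; assumption|].
  intros w Hw.
  destruct (Rlt_Rmin _ _ _ Hw) as [W2 W3].
  rewrite <- (E w W3), <- (E z). { apply Hdel, W2. }
  replace (z - z)%C with (RtoC 0) by ring. rewrite Cmod_0. exact Hr.
Qed.

Lemma cderiv_eq (f : C -> C) (z d d' : C) : d = d' -> cderiv f z d -> cderiv f z d'.
Proof. intros ->. auto. Qed.

Lemma ccont_ext_loc (f g : C -> C) (z : C) (r : R) : 0 < r ->
  (forall w, Cmod (w - z) < r -> f w = g w) -> ccont f z -> ccont g z.
Proof.
  intros Hr E H e He. destruct (H e He) as [del [Hd Hdel]].
  exists (Rmin del r). split; [apply Rmin_glb_lt; assumption|].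
  intros w Hw.
  destruct (Rlt_Rmin _ _ _ Hw) as [W2 W3].
  rewrite <- (E w W3), <- (E z). { apply Hdel, W2. }
  replace (z - z)%C with (RtoC 0) by ring. rewrite Cmod_0. exact Hr.
Qed.

Lemma cderiv_inv (z : C) : z <> 0 -> cderiv (fun w => (/ w)%C) z (- / (z * z))%C.
Proof.
  intros Hz e He.
  assert (Hm : 0 < Cmod z) by (apply Cmod_gt_0; exact Hz).
  set (t := Cmod z) in *.
  set (del := Rmin (t / 2) (e * (t * t * t) / 2)).
  assert (Hdel : 0 < del).
  { unfold del. apply Rmin_glb_lt; [lra|].
    assert (0 < t * t * t) by (repeat apply Rmult_lt_0_compat; assumption). nra. }
  exists del. split; [exact Hdel|]. intros w Hw.
  destruct (Rlt_Rmin _ _ _ Hw) as [W1 W2].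
  assert (Hwm : t / 2 < Cmod w).
  { assert (HH := Cmod_triangle_inv z w). rewrite Cmod_minus_sym in HH. fold t in HH. lra. }
  assert (Hw0 : w <> 0).
  { intros ->. rewrite Cmod_0 in Hwm. lra. }
  replace (/ w - / z - - / (z * z) * (w - z))%C with ((w - z) * (w - z) * / (z * z * w))%C
    by (field; split; assumption).
  rewrite !Cmod_mult, Cmod_inv, !Cmod_mult.
  2:{ repeat apply Cmult_neq_0; assumption. }
  fold t. set (s := Cmod (w - z)) in *.
  assert (Hs : 0 <= s) by apply Cmod_ge_0.
  assert (Hpos : 0 < t * t * Cmod w) by (repeat apply Rmult_lt_0_compat; lra).
  apply (Rmult_le_reg_r (t * t * Cmod w)); [exact Hpos|].
  replace (s * s * / (t * t * Cmod w) * (t * t * Cmod w)) with (s * s) by (field; lra).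
  assert (A : e * (t * t * t) / 2 <= e * (t * t * Cmod w)).
  { assert (0 < e * (t * t)) by (repeat apply Rmult_lt_0_compat; lra). nra. }
  nra.
Qed.

Lemma cderiv_opp (f : C -> C) (z d : C) : cderiv f z d -> cderiv (fun w => (- f w)%C) z (- d).
Proof.
  intros H e He. destruct (H e He) as [del [Hd Hdel]]. exists del. split; [exact Hd|].
  intros w Hw. replace (- f w - - f z - - d * (w - z))%C with (- (f w - f z - d * (w - z)))%C by ring.
  rewrite Cmod_opp. auto.
Qed.

Lemma cderiv_minus (f g : C -> C) (z d e : C) :
  cderiv f z d -> cderiv g z e -> cderiv (fun w => (f w - g w)%C) z (d - e).
Proof. intros Hf Hg. apply cderiv_plus; [exact Hf|apply cderiv_opp; exact Hg]. Qed.

Lemma cderiv_div (f g : C -> C) (z d e : C) : g z <> 0 ->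
  cderiv f z d -> cderiv g z e -> exists d', cderiv (fun w => (f w / g w)%C) z d'.
Proof.
  intros H0 Hf Hg. eexists. unfold Cdiv. apply cderiv_mult; [exact Hf|].
  exact (cderiv_comp (fun w => (/ w)%C) g z _ _ Hg (cderiv_inv (g z) H0)).
Qed.

Lemma ccont_continuous_line (f : C -> C) (l : R -> C) (t : R) :
  (forall s u, Cmod (l s - l u) <= Rabs (s - u)) -> ccont f (l t) ->
  continuous (fun s => fst (f (l s))) t /\ continuous (fun s => snd (f (l s))) t.
Proof.
  intros Hl H.
  split; apply filterlim_locally; intros eps;
    destruct (H (eps / 2) ltac:(assert (Hp := cond_pos eps); lra)) as [del [Hd Hdel]];
    exists (mkposreal del Hd); intros s Hs;
    assert (Hs' : Rabs (s - t) < del) by exact Hs;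
    assert (Hc : Cmod (f (l s) - f (l t)) <= eps / 2)
      by (apply Hdel; eapply Rle_lt_trans; [apply Hl|exact Hs']);
    assert (Hp := cond_pos eps);
    unfold ball; simpl; unfold AbsRing_ball, abs, minus, plus, opp; simpl.
  - eapply Rle_lt_trans; [exact (re_le_Cmod (f (l s) - f (l t)))|lra].
  - eapply Rle_lt_trans; [exact (im_le_Cmod (f (l s) - f (l t)))|lra].
Qed.

(** * Contour integrals over rectangles *)

Definition exCI (h : R -> C) (a b : R) : Prop :=
  ex_RInt (fun t => fst (h t)) a b /\ ex_RInt (fun t => snd (h t)) a b.

Definition CI (h : R -> C) (a b : R) : C :=
  (RInt (fun t => fst (h t)) a b, RInt (fun t => snd (h t)) a b).

Lemma exCI_Chasles_sub (h : R -> C) (a b c : R) : a <= b <= c ->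
  exCI h a c -> exCI h a b /\ exCI h b c.
Proof.
  intros H [H1 H2].
  repeat split.
  - apply (ex_RInt_Chasles_1 (V := R_CompleteNormedModule) _ a b c); assumption.
  - apply (ex_RInt_Chasles_1 (V := R_CompleteNormedModule) _ a b c); assumption.
  - apply (ex_RInt_Chasles_2 (V := R_CompleteNormedModule) _ a b c); assumption.
  - apply (ex_RInt_Chasles_2 (V := R_CompleteNormedModule) _ a b c); assumption.
Qed.

Lemma CI_Chasles (h : R -> C) (a b c : R) : a <= b <= c -> exCI h a c ->
  CI h a c = (CI h a b + CI h b c)%C.
Proof.
  intros H H0. destruct (exCI_Chasles_sub h a b c H H0) as [[A1 A2] [B1 B2]].
  unfold CI, Cplus. simpl. f_equal; symmetry; apply (RInt_Chasles (V := R_CompleteNormedModule)); assumption.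
Qed.

Lemma exCI_plus (g h : R -> C) (a b : R) : exCI g a b -> exCI h a b ->
  exCI (fun t => (g t + h t)%C) a b /\
  CI (fun t => (g t + h t)%C) a b = (CI g a b + CI h a b)%C.
Proof.
  intros [A1 A2] [B1 B2]. split.
  - split; apply (ex_RInt_plus (V := R_NormedModule)); assumption.
  - unfold CI, Cplus; simpl. f_equal; apply (RInt_plus (V := R_CompleteNormedModule)); assumption.
Qed.

Lemma exCI_scal (c : C) (h : R -> C) (a b : R) : exCI h a b ->
  exCI (fun t => (c * h t)%C) a b /\ CI (fun t => (c * h t)%C) a b = (c * CI h a b)%C.
Proof.
  intros [A1 A2].
  assert (E1 := RInt_correct (V := R_CompleteNormedModule) _ _ _ A1).
  assert (E2 := RInt_correct (V := R_CompleteNormedModule) _ _ _ A2).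
  assert (F1 := is_RInt_minus _ _ _ _ _ _ (is_RInt_scal _ _ _ (fst c) _ E1) (is_RInt_scal _ _ _ (snd c) _ E2)).
  assert (F2 := is_RInt_plus _ _ _ _ _ _ (is_RInt_scal _ _ _ (fst c) _ E2) (is_RInt_scal _ _ _ (snd c) _ E1)).
  split.
  - split; eexists; [exact F1|exact F2].
  - unfold CI, Cmult; simpl. f_equal.
    + apply (is_RInt_unique (V := R_CompleteNormedModule)). exact F1.
    + apply (is_RInt_unique (V := R_CompleteNormedModule)). exact F2.
Qed.

Lemma CI_ext (g h : R -> C) (a b : R) : a <= b -> (forall t, a <= t <= b -> g t = h t) ->
  CI g a b = CI h a b.
Proof.
  intros Hab H. unfold CI.
  f_equal; apply (RInt_ext (V := R_CompleteNormedModule)); intros t; rewrite Rmin_left, Rmax_right by assumption;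
  intros Ht; rewrite H; try reflexivity; lra.
Qed.

(** The factor 2 comes from estimating real and imaginary parts separately; only absolute constants
    are affected. *)
Lemma CI_bound (h : R -> C) (a b M : R) : a <= b -> exCI h a b ->
  (forall t, a <= t <= b -> Cmod (h t) <= M) -> Cmod (CI h a b) <= 2 * M * (b - a).
Proof.
  intros Hab [A1 A2] H.
  eapply Rle_trans; [apply Cmod_le_Re_Im|]. unfold CI, Re, Im; simpl.
  assert (B1 := abs_RInt_le_const _ a b M Hab A1).
  assert (B2 := abs_RInt_le_const _ a b M Hab A2).
  assert (B1' := B1 (fun t Ht => Rle_trans _ _ _ (re_le_Cmod (h t)) (H t Ht))).
  assert (B2' := B2 (fun t Ht => Rle_trans _ _ _ (im_le_Cmod (h t)) (H t Ht))).
  lra.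
Qed.

Definition rcont (f : C -> C) (a b c d : R) : Prop :=
  forall z, a <= Re z <= b -> c <= Im z <= d -> ccont f z.

Lemma exCI_hor (f : C -> C) (a b y : R) : a <= b ->
  (forall x, a <= x <= b -> ccont f (x, y)) -> exCI (fun x => f (x, y)) a b.
Proof.
  intros Hab H.
  assert (K : forall t, Rmin a b <= t <= Rmax a b ->
    continuous (fun s => fst (f (s, y))) t /\ continuous (fun s => snd (f (s, y))) t).
  { intros t. rewrite Rmin_left, Rmax_right by assumption. intros Ht.
    apply (ccont_continuous_line f (fun s => (s, y))).
    - intros s u. eapply Rle_trans; [apply Cmod_le_Re_Im|]. simpl.
      replace (y + - y) with 0 by ring. rewrite Rabs_R0. unfold Rminus. lra.
    - apply H; assumption. }
  split; apply (ex_RInt_continuous (V := R_CompleteNormedModule)); intros t Ht; apply (K t Ht).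
Qed.

Lemma exCI_ver (f : C -> C) (c d x : R) : c <= d ->
  (forall y, c <= y <= d -> ccont f (x, y)) -> exCI (fun y => f (x, y)) c d.
Proof.
  intros Hab H.
  assert (K : forall t, Rmin c d <= t <= Rmax c d ->
    continuous (fun s => fst (f (x, s))) t /\ continuous (fun s => snd (f (x, s))) t).
  { intros t. rewrite Rmin_left, Rmax_right by assumption. intros Ht.
    apply (ccont_continuous_line f (fun s => (x, s))).
    - intros s u. eapply Rle_trans; [apply Cmod_le_Re_Im|]. simpl.
      replace (x + - x) with 0 by ring. rewrite Rabs_R0. unfold Rminus. lra.
    - apply H; assumption. }
  split; apply (ex_RInt_continuous (V := R_CompleteNormedModule)); intros t Ht; apply (K t Ht).
Qed.

(* The contour integral of [f] along the positively oriented boundary of [a,b] x [c,d]. *)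
Definition rint (f : C -> C) (a b c d : R) : C :=
  (CI (fun x => f (x, c)) a b - CI (fun x => f (x, d)) a b
   + Ci * (CI (fun y => f (b, y)) c d - CI (fun y => f (a, y)) c d))%C.

Lemma rcont_sub (f : C -> C) (a b c d a' b' c' d' : R) :
  a <= a' -> b' <= b -> c <= c' -> d' <= d -> rcont f a b c d -> rcont f a' b' c' d'.
Proof. intros ? ? ? ? H z Hx Hy. apply H; lra. Qed.

Lemma rint_split_x (f : C -> C) (a m b c d : R) : a <= m <= b -> c <= d -> rcont f a b c d ->
  rint f a b c d = (rint f a m c d + rint f m b c d)%C.
Proof.
  intros Hm Hcd H. unfold rint.
  rewrite (CI_Chasles (fun x => f (x, c)) a m b Hm) by (apply exCI_hor; [lra|]; intros; apply H; simpl; lra).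
  rewrite (CI_Chasles (fun x => f (x, d)) a m b Hm) by (apply exCI_hor; [lra|]; intros; apply H; simpl; lra).
  ring.
Qed.

Lemma rint_split_y (f : C -> C) (a b c m d : R) : a <= b -> c <= m <= d -> rcont f a b c d ->
  rint f a b c d = (rint f a b c m + rint f a b m d)%C.
Proof.
  intros Hm Hcd H. unfold rint.
  rewrite (CI_Chasles (fun y => f (a, y)) c m d Hcd) by (apply exCI_ver; [lra|]; intros; apply H; simpl; lra).
  rewrite (CI_Chasles (fun y => f (b, y)) c m d Hcd) by (apply exCI_ver; [lra|]; intros; apply H; simpl; lra).
  ring.
Qed.

Definition bdry (a b c d : R) (z : C) : Prop :=
  (a <= Re z <= b /\ (Im z = c \/ Im z = d)) \/ (c <= Im z <= d /\ (Re z = a \/ Re z = b)).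

Definition bcont (f : C -> C) (a b c d : R) : Prop := forall z, bdry a b c d z -> ccont f z.

Lemma bdry_rect (a b c d : R) (z : C) : a <= b -> c <= d -> bdry a b c d z ->
  a <= Re z <= b /\ c <= Im z <= d.
Proof. intros ? ? [[? [?|?]]|[? [?|?]]]; lra. Qed.

Lemma rcont_bcont (f : C -> C) (a b c d : R) : a <= b -> c <= d ->
  rcont f a b c d -> bcont f a b c d.
Proof. intros Hab Hcd H z Hz. destruct (bdry_rect a b c d z Hab Hcd Hz). apply H; assumption. Qed.

Lemma rint_plus (f g : C -> C) (a b c d : R) : a <= b -> c <= d ->
  bcont f a b c d -> bcont g a b c d ->
  rint (fun z => (f z + g z)%C) a b c d = (rint f a b c d + rint g a b c d)%C.
Proof.
  intros Hab Hcd Hf Hg. unfold rint.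
  destruct (exCI_plus (fun x => f (x, c)) (fun x => g (x, c)) a b) as [_ ->];
    try (apply exCI_hor; [lra|]; intros; (apply Hf || apply Hg); left; simpl; lra).
  destruct (exCI_plus (fun x => f (x, d)) (fun x => g (x, d)) a b) as [_ ->];
    try (apply exCI_hor; [lra|]; intros; (apply Hf || apply Hg); left; simpl; lra).
  destruct (exCI_plus (fun x => f (a, x)) (fun x => g (a, x)) c d) as [_ ->];
    try (apply exCI_ver; [lra|]; intros; (apply Hf || apply Hg); right; simpl; lra).
  destruct (exCI_plus (fun x => f (b, x)) (fun x => g (b, x)) c d) as [_ ->];
    try (apply exCI_ver; [lra|]; intros; (apply Hf || apply Hg); right; simpl; lra).
  ring.
Qed.

Lemma rint_scal (k : C) (f : C -> C) (a b c d : R) : a <= b -> c <= d ->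
  bcont f a b c d -> rint (fun z => (k * f z)%C) a b c d = (k * rint f a b c d)%C.
Proof.
  intros Hab Hcd Hf. unfold rint.
  destruct (exCI_scal k (fun x => f (x, c)) a b) as [_ ->];
    try (apply exCI_hor; [lra|]; intros; apply Hf; left; simpl; lra).
  destruct (exCI_scal k (fun x => f (x, d)) a b) as [_ ->];
    try (apply exCI_hor; [lra|]; intros; apply Hf; left; simpl; lra).
  destruct (exCI_scal k (fun x => f (a, x)) c d) as [_ ->];
    try (apply exCI_ver; [lra|]; intros; apply Hf; right; simpl; lra).
  destruct (exCI_scal k (fun x => f (b, x)) c d) as [_ ->];
    try (apply exCI_ver; [lra|]; intros; apply Hf; right; simpl; lra).
  ring.
Qed.

Lemma rint_ext (f g : C -> C) (a b c d : R) : a <= b -> c <= d ->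
  (forall z, bdry a b c d z -> f z = g z) -> rint f a b c d = rint g a b c d.
Proof.
  intros Hab Hcd H. unfold rint.
  rewrite (CI_ext (fun x => f (x, c)) (fun x => g (x, c))) by (try assumption; intros; apply H; left; simpl; auto).
  rewrite (CI_ext (fun x => f (x, d)) (fun x => g (x, d))) by (try assumption; intros; apply H; left; simpl; auto).
  rewrite (CI_ext (fun x => f (a, x)) (fun x => g (a, x))) by (try assumption; intros; apply H; right; simpl; auto).
  rewrite (CI_ext (fun x => f (b, x)) (fun x => g (b, x))) by (try assumption; intros; apply H; right; simpl; auto).
  reflexivity.
Qed.

Lemma rint_bound (f : C -> C) (a b c d M : R) : a <= b -> c <= d -> bcont f a b c d ->
  (forall z, bdry a b c d z -> Cmod (f z) <= M) ->
  Cmod (rint f a b c d) <= 4 * M * ((b - a) + (d - c)).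
Proof.
  intros Hab Hcd Hf H. unfold rint.
  assert (B1 : Cmod (CI (fun x => f (x, c)) a b) <= 2 * M * (b - a)).
  { apply CI_bound; [lra|apply exCI_hor; [lra|]; intros; apply Hf; left; simpl; lra|].
    intros; apply H; left; simpl; auto. }
  assert (B2 : Cmod (CI (fun x => f (x, d)) a b) <= 2 * M * (b - a)).
  { apply CI_bound; [lra|apply exCI_hor; [lra|]; intros; apply Hf; left; simpl; lra|].
    intros; apply H; left; simpl; auto. }
  assert (B3 : Cmod (CI (fun x => f (a, x)) c d) <= 2 * M * (d - c)).
  { apply CI_bound; [lra|apply exCI_ver; [lra|]; intros; apply Hf; right; simpl; lra|].
    intros; apply H; right; simpl; auto. }
  assert (B4 : Cmod (CI (fun x => f (b, x)) c d) <= 2 * M * (d - c)).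
  { apply CI_bound; [lra|apply exCI_ver; [lra|]; intros; apply Hf; right; simpl; lra|].
    intros; apply H; right; simpl; auto. }
  eapply Rle_trans; [apply Cmod_triangle|]. rewrite Cmod_mult, Cmod_Ci, Rmult_1_l.
  assert (T1 := Cmod_triangle_minus (CI (fun x => f (x, c)) a b) (CI (fun x => f (x, d)) a b)).
  assert (T2 := Cmod_triangle_minus (CI (fun x => f (b, x)) c d) (CI (fun x => f (a, x)) c d)).
  lra.
Qed.

Lemma is_RInt_affine (p q a b : R) :
  is_RInt (fun t => p + q * t) a b (p * (b - a) + q * (b * b - a * a) / 2).
Proof.
  replace (p * (b - a) + q * (b * b - a * a) / 2)
    with (minus (p * b + q * (b * b) / 2) (p * a + q * (a * a) / 2))
    by (unfold minus, plus, opp; simpl; field).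
  apply (is_RInt_derive (V := R_CompleteNormedModule) (fun t => p * t + q * (t * t) / 2)).
  - intros x _. auto_derive; [exact I|field].
  - intros x _. apply (ex_derive_continuous (K := R_AbsRing) (V := R_NormedModule)). auto_derive. exact I.
Qed.

Lemma CI_affine (p q : C) (a b : R) :
  CI (fun t => (p + q * RtoC t)%C) a b = (p * RtoC (b - a) + q * RtoC ((b * b - a * a) / 2))%C.
Proof.
  unfold CI.
  apply injective_projections; simpl; apply (is_RInt_unique (V := R_CompleteNormedModule)).
  - replace (fst p * (b - a) - snd p * 0 + (fst q * ((b * b - a * a) / 2) - snd q * 0))
      with (fst p * (b - a) + fst q * (b * b - a * a) / 2) by field.
    eapply is_RInt_ext; [|apply is_RInt_affine]. intros; simpl; ring.
  - replace (fst p * 0 + snd p * (b - a) + (fst q * 0 + snd q * ((b * b - a * a) / 2)))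
      with (snd p * (b - a) + snd q * (b * b - a * a) / 2) by field.
    eapply is_RInt_ext; [|apply is_RInt_affine]. intros; simpl; ring.
Qed.

Lemma pair_RI (x y : R) : ((x, y) : C) = (RtoC x + Ci * RtoC y)%C.
Proof. apply injective_projections; simpl; ring. Qed.

Lemma rint_affine (p q : C) (a b c d : R) : a <= b -> c <= d ->
  rint (fun z => (p + q * z)%C) a b c d = 0.
Proof.
  intros Hab Hcd. unfold rint.
  rewrite (CI_ext (fun x => (p + q * (x, c))%C) (fun x => ((p + q * (Ci * RtoC c)) + q * RtoC x)%C))
    by (try assumption; intros; rewrite pair_RI; ring).
  rewrite (CI_ext (fun x => (p + q * (x, d))%C) (fun x => ((p + q * (Ci * RtoC d)) + q * RtoC x)%C))
    by (try assumption; intros; rewrite pair_RI; ring).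
  rewrite (CI_ext (fun y => (p + q * (a, y))%C) (fun y => ((p + q * RtoC a) + (q * Ci) * RtoC y)%C))
    by (try assumption; intros; rewrite pair_RI; ring).
  rewrite (CI_ext (fun y => (p + q * (b, y))%C) (fun y => ((p + q * RtoC b) + (q * Ci) * RtoC y)%C))
    by (try assumption; intros; rewrite pair_RI; ring).
  rewrite !CI_affine.
  replace (b * b - a * a) with ((b - a) * (a + b)) by ring.
  rewrite !RtoC_minus. ring.
Qed.

Lemma ccont_affine (p q z : C) : ccont (fun w => (p + q * w)%C) z.
Proof.
  eapply cderiv_ccont. apply cderiv_plus; [apply cderiv_const|].
  apply cderiv_mult; [apply cderiv_const|apply cderiv_id].
Qed.

Lemma ccont_plus (f g : C -> C) (z : C) : ccont f z -> ccont g z -> ccont (fun w => (f w + g w)%C) z.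
Proof.
  intros Hf Hg e He.
  destruct (Hf (e / 2) ltac:(lra)) as [d1 [Hd1 H1]].
  destruct (Hg (e / 2) ltac:(lra)) as [d2 [Hd2 H2]].
  exists (Rmin d1 d2). split; [apply Rmin_glb_lt; assumption|].
  intros w Hw.
  destruct (Rlt_Rmin _ _ _ Hw) as [W1 W2].
  specialize (H1 w W1). specialize (H2 w W2).
  replace (f w + g w - (f z + g z))%C with ((f w - f z) + (g w - g z))%C by ring.
  eapply Rle_trans; [apply Cmod_triangle|]. lra.
Qed.

Definition rect := ((R * R) * (R * R))%type.

Definition rintr (f : C -> C) (s : rect) : C :=
  rint f (fst (fst s)) (snd (fst s)) (fst (snd s)) (snd (snd s)).

(** Bisection step of Goursat's argument. The last branch is taken without a test: if the other
    three quarters all fail, the triangle inequality makes the fourth one succeed. *)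
Definition quarter (f : C -> C) (s : rect) : rect :=
  let a := fst (fst s) in let b := snd (fst s) in
  let c := fst (snd s) in let d := snd (snd s) in
  let m := (a + b) / 2 in let n := (c + d) / 2 in
  if Rle_dec (Cmod (rintr f s)) (4 * Cmod (rint f a m c n)) then ((a, m), (c, n))
  else if Rle_dec (Cmod (rintr f s)) (4 * Cmod (rint f m b c n)) then ((m, b), (c, n))
  else if Rle_dec (Cmod (rintr f s)) (4 * Cmod (rint f a m n d)) then ((a, m), (n, d))
  else ((m, b), (n, d)).

Lemma quarter_spec (f : C -> C) (s : rect) :
  let a := fst (fst s) in let b := snd (fst s) in
  let c := fst (snd s) in let d := snd (snd s) in
  let s' := quarter f s in
  let a' := fst (fst s') in let b' := snd (fst s') in
  let c' := fst (snd s') in let d' := snd (snd s') in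
  a <= b -> c <= d -> rcont f a b c d ->
  a <= a' /\ b' <= b /\ c <= c' /\ d' <= d /\ b' - a' = (b - a) / 2 /\ d' - c' = (d - c) / 2 /\
  Cmod (rintr f s) <= 4 * Cmod (rintr f s').
Proof.
  destruct s as [[a b] [c d]]. simpl. intros Hab Hcd Hf.
  unfold quarter. simpl. unfold rintr at 1 3 5. simpl.
  set (m := (a + b) / 2). set (n := (c + d) / 2).
  assert (Hm : a <= m <= b) by (unfold m; lra).
  assert (Hn : c <= n <= d) by (unfold n; lra).
  assert (S : rint f a b c d = (rint f a m c n + rint f m b c n + (rint f a m n d + rint f m b n d))%C).
  { rewrite (rint_split_y f a b c n d) by (try lra; assumption).
    rewrite (rint_split_x f a m b c n), (rint_split_x f a m b n d);
      try lra; try reflexivity; apply (rcont_sub f a b c d); lra || assumption. }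
  assert (T : Cmod (rint f a b c d) <= Cmod (rint f a m c n) + Cmod (rint f m b c n)
     + (Cmod (rint f a m n d) + Cmod (rint f m b n d))).
  { rewrite S. eapply Rle_trans; [apply Cmod_triangle|].
    apply Rplus_le_compat; apply Cmod_triangle. }
  unfold rintr; simpl.
  destruct Rle_dec; simpl; [repeat split; try lra; unfold m, n; lra|].
  destruct Rle_dec; simpl; [repeat split; try lra; unfold m, n; lra|].
  destruct Rle_dec; simpl; [repeat split; try lra; unfold m, n; lra|].
  repeat split; try lra; unfold m, n; lra.
Qed.

Lemma nested_intervals (u v : nat -> R) :
  (forall n, u n <= u (S n)) -> (forall n, v (S n) <= v n) -> (forall n, u n <= v n) ->
  exists x, forall n, u n <= x <= v n.
Proof.
  intros Hu Hv H.
  assert (Mu : forall n k, u n <= u (n + k)%nat).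
  { intros n k. induction k; [rewrite Nat.add_0_r; lra|]. rewrite Nat.add_succ_r. specialize (Hu (n + k)%nat). lra. }
  assert (Mv : forall n k, v (n + k)%nat <= v n).
  { intros n k. induction k; [rewrite Nat.add_0_r; lra|]. rewrite Nat.add_succ_r. specialize (Hv (n + k)%nat). lra. }
  assert (UV : forall n k, u n <= v k).
  { intros n k. eapply Rle_trans; [apply (Mu n k)|]. eapply Rle_trans; [apply H|].
    rewrite Nat.add_comm. apply Mv. }
  destruct (completeness (fun y => exists n, y = u n)) as [x [Hx1 Hx2]].
  - exists (v 0%nat). intros y [n ->]. apply UV.
  - exists (u 0%nat), 0%nat. reflexivity.
  - exists x. intros n. split.
    + apply Hx1. exists n. reflexivity.
    + apply Hx2. intros y [k ->]. apply UV.
Qed.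

Lemma pow_half_small (A e : R) : 0 < e -> exists n, A * (/ 2) ^ n < e.
Proof.
  intros He.
  destruct (pow_lt_1_zero (/ 2) ltac:(rewrite Rabs_right; lra) (e / (Rabs A + 1))) as [n Hn].
  { apply Rdiv_lt_0_compat; [lra|]. assert (H := Rabs_pos A). lra. }
  exists n. specialize (Hn n (le_n n)).
  assert (Hp : 0 < (/ 2) ^ n) by (apply pow_lt; lra).
  rewrite Rabs_right in Hn by lra.
  assert (HA := Rabs_pos A).
  apply (Rmult_lt_compat_l (Rabs A + 1)) in Hn; [|lra].
  replace ((Rabs A + 1) * (e / (Rabs A + 1))) with e in Hn by (field; lra).
  assert (HB := Rle_abs A). nra.
Qed.

Lemma goursat (f : C -> C) (a b c d : R) : a <= b -> c <= d ->
  (forall z, a <= Re z <= b -> c <= Im z <= d -> exists l, cderiv f z l) ->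
  rint f a b c d = 0.
Proof.
  intros Hab Hcd Hf.
  assert (Hc : rcont f a b c d).
  { intros z Hx Hy. destruct (Hf z Hx Hy) as [l Hl]. eapply cderiv_ccont; exact Hl. }
  set (s := fix s (n : nat) : rect := match n with O => ((a, b), (c, d)) | S k => quarter f (s k) end).
  set (an n := fst (fst (s n))). set (bn n := snd (fst (s n))).
  set (cn n := fst (snd (s n))). set (dn n := snd (snd (s n))).
  assert (I : forall n, a <= an n /\ an n <= bn n /\ bn n <= b /\ c <= cn n /\ cn n <= dn n /\ dn n <= d /\
     bn n - an n = (b - a) * (/ 2) ^ n /\ dn n - cn n = (d - c) * (/ 2) ^ n /\
     Cmod (rint f a b c d) <= 4 ^ n * Cmod (rintr f (s n))).
  { induction n as [|n IH].
    - unfold an, bn, cn, dn, rintr; simpl. repeat split; lra.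
    - destruct IH as (A1 & A2 & A3 & A4 & A5 & A6 & A7 & A8 & A9).
      destruct (quarter_spec f (s n) A2 A5) as (B1 & B2 & B3 & B4 & B5 & B6 & B7).
      { apply (rcont_sub f a b c d); assumption. }
      change (quarter f (s n)) with (s (S n)) in B1, B2, B3, B4, B5, B6, B7.
      fold (an n) (an (S n)) (bn n) (bn (S n)) (cn n) (cn (S n)) (dn n) (dn (S n)) in B1, B2, B3, B4, B5, B6.
      simpl ((/ 2) ^ S n). simpl (4 ^ S n). assert (0 < 4 ^ n) by (apply pow_lt; lra).
      repeat split; try lra. nra. }
  assert (Step : forall n, an n <= an (S n) /\ bn (S n) <= bn n /\ cn n <= cn (S n) /\ dn (S n) <= dn n).
  { intros n. destruct (I n) as (A1 & A2 & A3 & A4 & A5 & A6 & A7 & A8 & A9).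
    destruct (quarter_spec f (s n) A2 A5) as (B1 & B2 & B3 & B4 & B5 & B6 & B7).
    { apply (rcont_sub f a b c d); assumption. }
    repeat split; assumption. }
  destruct (nested_intervals an bn) as [x Hx]; try (intros n; apply (Step n) || apply (I n)).
  destruct (nested_intervals cn dn) as [y Hy]; try (intros n; apply (Step n) || apply (I n)).
  assert (Hxy : a <= x <= b /\ c <= y <= d).
  { specialize (Hx 0%nat). specialize (Hy 0%nat). unfold an, bn, cn, dn in Hx, Hy. simpl in Hx, Hy. split; assumption. }
  destruct (Hf (x, y)) as [l Hl]; try (simpl; tauto).
  apply Cmod_eq_0. apply Rle_antisym; [|apply Cmod_ge_0].
  set (W := (b - a) + (d - c)). assert (HW : 0 <= W) by (unfold W; lra).
  apply Rnot_lt_le. intros Hpos.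
  (* Chosen so that the final estimate [4 * e * (W * W)] is at most half of the modulus of the
     integral, which is then zero. *)
  set (e := Cmod (rint f a b c d) / (8 * (W * W + 1))).
  assert (He : 0 < e) by (apply Rdiv_lt_0_compat; [exact Hpos|nra]).
  destruct (Hl e He) as [del [Hd Hdel]].
  destruct (pow_half_small W del Hd) as [n Hn].
  destruct (I n) as (A1 & A2 & A3 & A4 & A5 & A6 & A7 & A8 & A9).
  specialize (Hx n). specialize (Hy n).
  set (p := (/ 2) ^ n) in *. assert (Hp : 0 < p) by (apply pow_lt; lra).
  set (z0 := (x, y) : C).
  set (aff := fun z : C => ((f z0 - l * z0) + l * z)%C).
  assert (Ca : rcont aff (an n) (bn n) (cn n) (dn n)) by (intros z _ _; apply ccont_affine).
  (* The first-order part of [f] at the limit point has vanishing contour integral, so [f] may be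
     replaced by the remainder, which is at most [e * (W * p)] on the small rectangle. The perimeter
     gives another factor [W * p], and [p * p] cancels [4 ^ n]. *)
  set (g := fun z => (f z + (-1) * aff z)%C).
  assert (Cg : rcont g (an n) (bn n) (cn n) (dn n)).
  { intros z Hz1 Hz2. apply ccont_plus.
    - apply Hc; lra.
    - unfold aff. apply (ccont_ext_loc (fun z => (- (f z0 - l * z0) + (- l) * z)%C) _ _ 1 Rlt_0_1); [intros; ring|].
      apply ccont_affine. }
  assert (E : rintr f (s n) = rint g (an n) (bn n) (cn n) (dn n)).
  { unfold g. rewrite rint_plus; try assumption; try (apply rcont_bcont; try assumption).
    - rewrite rint_scal by (try assumption; apply rcont_bcont; assumption). unfold aff at 1. rewrite rint_affine by assumption.
      unfold rintr, an, bn, cn, dn. ring.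
    - apply (rcont_sub f a b c d); assumption.
    - intros z _ _. unfold aff. apply (ccont_ext_loc (fun z => (- (f z0 - l * z0) + (- l) * z)%C) _ _ 1 Rlt_0_1); [intros; ring|].
      apply ccont_affine. }
  assert (Bd : Cmod (rint g (an n) (bn n) (cn n) (dn n)) <= 4 * (e * (W * p)) * ((bn n - an n) + (dn n - cn n))).
  { apply rint_bound; try assumption; [apply rcont_bcont; assumption|]. intros z Hz.
    assert (Hz' : an n <= Re z <= bn n /\ cn n <= Im z <= dn n).
    { destruct Hz as [[? [?|?]]|[? [?|?]]]; lra. }
    assert (Dz : Cmod (z - z0) <= W * p).
    { eapply Rle_trans; [apply Cmod_le_Re_Im|].
      unfold z0, Cminus, Cplus, Copp, Re, Im in *. simpl in *.
      assert (Rabs (fst z + - x) <= (b - a) * p) by (apply Rabs_le; lra).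
      assert (Rabs (snd z + - y) <= (d - c) * p) by (apply Rabs_le; lra).
      unfold W. lra. }
    unfold g, aff.
    replace (f z + (-1) * (f z0 - l * z0 + l * z))%C with (f z - f z0 - l * (z - z0))%C by ring.
    eapply Rle_trans; [apply Hdel; fold z0; lra|]. apply Rmult_le_compat_l; [lra|exact Dz]. }
  rewrite E in A9. rewrite A7, A8 in Bd.
  assert (P4 : 4 ^ n * (p * p) = 1).
  { unfold p. rewrite <- !Rpow_mult_distr. replace (4 * (/ 2 * / 2)) with 1 by field. apply pow1. }
  assert (P5 : 0 < 4 ^ n) by (apply pow_lt; lra).
  assert (Fin : Cmod (rint f a b c d) <= 4 * e * (W * W)).
  { eapply Rle_trans; [exact A9|].
    apply Rle_trans with (4 ^ n * (4 * (e * (W * p)) * ((b - a) * p + (d - c) * p))).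
    - apply Rmult_le_compat_l; [lra|exact Bd].
    - right. replace ((b - a) * p + (d - c) * p) with (W * p) by (unfold W; ring).
      replace (4 ^ n * (4 * (e * (W * p)) * (W * p))) with (4 * e * (W * W) * (4 ^ n * (p * p))) by ring.
      rewrite P4. ring. }
  assert (Ee : e * (8 * (W * W + 1)) = Cmod (rint f a b c d)) by (unfold e; field; nra).
  nra.
Qed.

Lemma rint_degenerate (f : C -> C) (a b c d : R) : a = b \/ c = d -> rint f a b c d = 0.
Proof.
  intros [-> | ->]; unfold rint, CI; rewrite !RInt_point; apply injective_projections; simpl; unfold zero; simpl; ring.
Qed.

(** A small square around [p] is cut out: its integral tends to 0 because [f] is bounded near [p],
    and the four remaining rectangles avoid [p]. The square is clipped to the rectangle since [p]
    may lie on the boundary, and then some pieces degenerate. *)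
Lemma goursat_except (f : C -> C) (a b c d : R) (p : C) : a <= Re p <= b -> c <= Im p <= d ->
  (forall z, a <= Re z <= b -> c <= Im z <= d -> ccont f z) ->
  (forall z, a <= Re z <= b -> c <= Im z <= d -> z <> p -> exists l, cderiv f z l) ->
  rint f a b c d = 0.
Proof.
  intros Hx Hy Hc Hf.
  apply Cmod_eq_0. apply Rle_antisym; [|apply Cmod_ge_0].
  destruct (Hc p Hx Hy 1 Rlt_0_1) as [del [Hd Hdel]].
  set (M := Cmod (f p) + 1). assert (HM : 0 < M) by (assert (H := Cmod_ge_0 (f p)); unfold M; lra).
  assert (K : forall e, 0 < e < del -> Cmod (rint f a b c d) <= 4 * M * (2 * e)).
  { intros e [He Hed].
    set (x1 := Rmax a (Re p - e / 4)). set (x2 := Rmin b (Re p + e / 4)).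
    set (y1 := Rmax c (Im p - e / 4)). set (y2 := Rmin d (Im p + e / 4)).
    assert (X1 : a <= x1 <= Re p /\ Re p - e / 4 <= x1 /\ (x1 = a \/ x1 < Re p)).
    { unfold x1. repeat split; [apply Rmax_l|apply Rmax_lub; lra|apply Rmax_r|].
      unfold Rmax. destruct Rle_dec; [right; lra|left; reflexivity]. }
    assert (X2 : Re p <= x2 <= b /\ x2 <= Re p + e / 4 /\ (x2 = b \/ Re p < x2)).
    { unfold x2. repeat split; [apply Rmin_glb; lra|apply Rmin_l|apply Rmin_r|].
      unfold Rmin. destruct Rle_dec; [left; reflexivity|right; lra]. }
    assert (Y1 : c <= y1 <= Im p /\ Im p - e / 4 <= y1 /\ (y1 = c \/ y1 < Im p)).
    { unfold y1. repeat split; [apply Rmax_l|apply Rmax_lub; lra|apply Rmax_r|].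
      unfold Rmax. destruct Rle_dec; [right; lra|left; reflexivity]. }
    assert (Y2 : Im p <= y2 <= d /\ y2 <= Im p + e / 4 /\ (y2 = d \/ Im p < y2)).
    { unfold y2. repeat split; [apply Rmin_glb; lra|apply Rmin_l|apply Rmin_r|].
      unfold Rmin. destruct Rle_dec; [left; reflexivity|right; lra]. }
    assert (Z1 : rint f a x1 c d = 0).
    { destruct X1 as (A & B & [->|L]).
      - apply rint_degenerate; auto.
      - apply goursat; try lra. intros z Hz1 Hz2. apply Hf; try lra. intros ->. lra. }
    assert (Z2 : rint f x2 b c d = 0).
    { destruct X2 as (A & B & [->|L]).
      - apply rint_degenerate; auto.
      - apply goursat; try lra. intros z Hz1 Hz2. apply Hf; try lra. intros ->. lra. }
    assert (Z3 : rint f x1 x2 c y1 = 0).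
    { destruct Y1 as (A & B & [->|L]).
      - apply rint_degenerate; auto.
      - apply goursat; try lra. intros z Hz1 Hz2. apply Hf; try lra. intros ->. lra. }
    assert (Z4 : rint f x1 x2 y2 d = 0).
    { destruct Y2 as (A & B & [->|L]).
      - apply rint_degenerate; auto.
      - apply goursat; try lra. intros z Hz1 Hz2. apply Hf; try lra. intros ->. lra. }
    rewrite (rint_split_x f a x1 b c d) by (try lra; exact Hc).
    rewrite (rint_split_x f x1 x2 b c d) by (try lra; apply (rcont_sub f a b c d); lra || exact Hc).
    rewrite (rint_split_y f x1 x2 c y1 d) by (try lra; apply (rcont_sub f a b c d); lra || exact Hc).
    rewrite (rint_split_y f x1 x2 y1 y2 d) by (try lra; apply (rcont_sub f a b c d); lra || exact Hc).
    rewrite Z1, Z2, Z3, Z4.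
    replace (0 + (0 + (rint f x1 x2 y1 y2 + 0) + 0))%C with (rint f x1 x2 y1 y2) by ring.
    eapply Rle_trans.
    - apply (rint_bound f x1 x2 y1 y2 M); try lra; [apply rcont_bcont; try lra; apply (rcont_sub f a b c d); lra || exact Hc|].
      intros z Hz.
      assert (Hz' : x1 <= Re z <= x2 /\ y1 <= Im z <= y2) by (destruct Hz as [[? [?|?]]|[? [?|?]]]; lra).
      assert (Dz : Cmod (z - p) < del).
      { eapply Rle_lt_trans; [apply Cmod_le_Re_Im|].
        unfold Cminus, Cplus, Copp, Re, Im in *. simpl in *.
        assert (Rabs (fst z + - fst p) <= e / 4) by (apply Rabs_le; lra).
        assert (Rabs (snd z + - snd p) <= e / 4) by (apply Rabs_le; lra). lra. }
      specialize (Hdel z Dz).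
      assert (T := Cmod_triangle (f z - f p) (f p)). replace (f z - f p + f p)%C with (f z) in T by ring.
      unfold M. lra.
    - apply Rmult_le_compat_l; lra. }
  apply Rnot_lt_le. intros Hpos.
  set (e := Rmin (del / 2) (Cmod (rint f a b c d) / (16 * M))).
  assert (He : 0 < e) by (apply Rmin_glb_lt; [lra|apply Rdiv_lt_0_compat; lra]).
  assert (E1 : e <= del / 2) by apply Rmin_l.
  assert (E2 : e <= Cmod (rint f a b c d) / (16 * M)) by apply Rmin_r.
  assert (K1 := K e ltac:(lra)).
  apply (Rmult_le_compat_r (16 * M)) in E2; [|lra].
  replace (Cmod (rint f a b c d) / (16 * M) * (16 * M)) with (Cmod (rint f a b c d)) in E2 by (field; lra).
  lra.
Qed.

(** * Cauchy formula and its consequences *)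

(** Contours are squares instead of circles, so that bisection and real integrals suffice. Distances
    from the centre to the contour vary between h and 2h, which is why [2 * h < r] recurs below. *)
Definition sint (f : C -> C) (z : C) (h : R) : C :=
  rint f (Re z - h) (Re z + h) (Im z - h) (Im z + h).

Definition sbdry (z : C) (h : R) : C -> Prop :=
  bdry (Re z - h) (Re z + h) (Im z - h) (Im z + h).

Lemma sbdry_bounds (z w : C) (h : R) : 0 < h -> sbdry z h w ->
  h <= Cmod (w - z) <= 2 * h.
Proof.
  intros Hh Hw. split.
  - destruct Hw as [[? [E|E]]|[? [E|E]]].
    + eapply Rle_trans; [|exact (im_le_Cmod (w - z))].
      unfold Im, Re, Cminus, Cplus, Copp in *. simpl in *. rewrite E.
      replace (snd z - h + - snd z) with (- h) by ring.
      rewrite Rabs_Ropp, Rabs_right by lra. lra.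
    + eapply Rle_trans; [|exact (im_le_Cmod (w - z))].
      unfold Im, Re, Cminus, Cplus, Copp in *. simpl in *. rewrite E.
      replace (snd z + h + - snd z) with (h) by ring.
      rewrite Rabs_right by lra. lra.
    + eapply Rle_trans; [|exact (re_le_Cmod (w - z))].
      unfold Im, Re, Cminus, Cplus, Copp in *. simpl in *. rewrite E.
      replace (fst z - h + - fst z) with (- h) by ring.
      rewrite Rabs_Ropp, Rabs_right by lra. lra.
    + eapply Rle_trans; [|exact (re_le_Cmod (w - z))].
      unfold Im, Re, Cminus, Cplus, Copp in *. simpl in *. rewrite E.
      replace (fst z + h + - fst z) with (h) by ring.
      rewrite Rabs_right by lra. lra.
  - eapply Rle_trans; [apply Cmod_le_Re_Im|].
    destruct (bdry_rect (Re z - h) (Re z + h) (Im z - h) (Im z + h) w) as [A B]; [lra|lra|exact Hw|].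
    unfold Im, Re, Cminus, Cplus, Copp in *. simpl in *.
    assert (Rabs (fst w + - fst z) <= h) by (apply Rabs_le; lra).
    assert (Rabs (snd w + - snd z) <= h) by (apply Rabs_le; lra). lra.
Qed.

Lemma sq_add_sq_neq_0 (x h : R) : 0 < h -> x ^ 2 + h ^ 2 <> 0.
Proof. intros Hh. assert (H1 := pow2_ge_0 x). assert (H2 := pow_lt h 2 Hh). lra. Qed.

Lemma is_RInt_inv_sq (h p : R) : 0 < h ->
  is_RInt (fun x => h / ((x - p) ^ 2 + h ^ 2)) (p - h) (p + h) (PI / 2).
Proof.
  intros Hh.
  replace (PI / 2) with (minus (atan ((p + h - p) / h)) (atan ((p - h - p) / h))).
  2:{ replace ((p + h - p) / h) with 1 by (field; lra).
      replace ((p - h - p) / h) with (- (1)) by (field; lra).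
      rewrite atan_opp, atan_1. unfold minus, plus, opp; simpl. field. }
  apply (is_RInt_derive (V := R_CompleteNormedModule) (fun x => atan ((x - p) / h))).
  - intros x _. auto_derive; [lra|]. field. split; [apply sq_add_sq_neq_0; exact Hh|lra].
  - intros x _. apply (ex_derive_continuous (K := R_AbsRing) (V := R_NormedModule)). auto_derive.
    apply (sq_add_sq_neq_0 (x + - p) h Hh).
Qed.

Lemma CI_imag_inv_sq (h p : R) (k : C) : 0 < h ->
  CI (fun x => (k * RtoC (h / ((x - p) ^ 2 + h ^ 2)))%C) (p - h) (p + h) = (k * RtoC (PI / 2))%C.
Proof.
  intros Hh. assert (H := is_RInt_inv_sq h p Hh).
  assert (E : exCI (fun x => RtoC (h / ((x - p) ^ 2 + h ^ 2))) (p - h) (p + h)).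
  { split; simpl; [eexists; exact H|]. apply ex_RInt_const. }
  destruct (exCI_scal k _ _ _ E) as [_ ->]. f_equal. unfold CI; simpl.
  apply injective_projections; simpl.
  - apply (is_RInt_unique (V := R_CompleteNormedModule)). exact H.
  - rewrite RInt_const. unfold scal; simpl. unfold mult; simpl. ring.
Qed.

Lemma CI_minus (g h : R -> C) (a b : R) : a <= b -> exCI g a b -> exCI h a b ->
  (CI g a b - CI h a b)%C = CI (fun t => (g t - h t)%C) a b.
Proof.
  intros Hab Hg Hh.
  destruct (exCI_scal (-1) h a b Hh) as [Eh1 Eh2].
  destruct (exCI_plus g _ a b Hg Eh1) as [_ E].
  rewrite (CI_ext (fun t => (g t - h t)%C) (fun t => (g t + -1 * h t)%C)); [|assumption|intros; ring].
  rewrite E, Eh2. ring.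
Qed.

Lemma cderiv_inv_shift (a z : C) : z <> a -> exists l, cderiv (fun w => (/ (w - a))%C) z l.
Proof.
  intros H. eexists.
  apply (cderiv_comp (fun w => (/ w)%C) (fun w => (w - a)%C)).
  - apply cderiv_minus; [apply cderiv_id|apply cderiv_const].
  - apply cderiv_inv. intros E. apply H. replace z with (z - a + a)%C by ring. rewrite E. ring.
Qed.

(** Opposite sides are subtracted before integrating: the difference of the two integrands is a
    constant times h/(t^2 + h^2), whose integral is a difference of arctangents equal to pi/2. *)
Lemma sint_inv_center (a : C) (h : R) : 0 < h ->
  sint (fun w => (/ (w - a))%C) a h = (RtoC (2 * PI) * Ci)%C.
Proof.
  intros Hh.
  assert (Cb : bcont (fun w => (/ (w - a))%C) (Re a - h) (Re a + h) (Im a - h) (Im a + h)).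
  { intros z Hz. destruct (cderiv_inv_shift a z) as [l Hl].
    - intros ->. destruct (sbdry_bounds a a h Hh Hz) as [H _].
      replace (a - a)%C with (RtoC 0) in H by ring. rewrite Cmod_0 in H. lra.
    - eapply cderiv_ccont; exact Hl. }
  unfold sint, rint.
  rewrite (CI_minus (fun x => (/ (((x, (Im a - h)%R) : C) - a))%C)); [|lra| |].
  2:{ apply (exCI_hor (fun w => (/ (w - a))%C)); [lra|]. intros; apply Cb; left; simpl; lra. }
  2:{ apply (exCI_hor (fun w => (/ (w - a))%C)); [lra|]. intros; apply Cb; left; simpl; lra. }
  rewrite (CI_minus (fun y => (/ ((((Re a + h)%R, y) : C) - a))%C)); [|lra| |].
  2:{ apply (exCI_ver (fun w => (/ (w - a))%C)); [lra|]. intros; apply Cb; right; simpl; lra. }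
  2:{ apply (exCI_ver (fun w => (/ (w - a))%C)); [lra|]. intros; apply Cb; right; simpl; lra. }
  rewrite (CI_ext _ (fun x => ((2 * Ci) * RtoC (h / ((x - Re a) ^ 2 + h ^ 2)))%C)); [|lra|].
  2:{ intros t _. destruct a as [p q]. simpl. unfold Cinv, Cminus, Cplus, Copp, Cmult. simpl.
      assert (H1 := sq_add_sq_neq_0 (t - p) h Hh).
      apply injective_projections; simpl; field; intros E; apply H1; rewrite <- E; ring. }
  rewrite (CI_ext (fun t => (/ ((((Re a + h)%R, t) : C) - a) - / ((((Re a - h)%R, t) : C) - a))%C)
    (fun y => (2 * RtoC (h / ((y - Im a) ^ 2 + h ^ 2)))%C)); [|lra|].
  2:{ intros t _. destruct a as [p q]. simpl. unfold Cinv, Cminus, Cplus, Copp, Cmult. simpl.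
      assert (H1 := sq_add_sq_neq_0 (t - q) h Hh).
      apply injective_projections; simpl; field; intros E; apply H1; rewrite <- E; ring. }
  rewrite !CI_imag_inv_sq by assumption.
  rewrite RtoC_div, RtoC_mult by lra. field.
Qed.

Definition hol (f : C -> C) (z : C) (r : R) : Prop :=
  forall w, Cmod (w - z) < r -> exists d, cderiv f w d.

(** The difference quotient with prescribed value [l] at [a]; with [l] the derivative it is
    continuous there, which is what [goursat_except] asks for. *)
Definition dquot (f : C -> C) (a l : C) (w : C) : C :=
  if Req_EM_T (Cmod (w - a)) 0 then l else ((f w - f a) / (w - a))%C.

Lemma dquot_neq (f : C -> C) (a l w : C) : w <> a -> dquot f a l w = ((f w - f a) / (w - a))%C.
Proof.
  intros H. unfold dquot. destruct Req_EM_T as [E|E]; [|reflexivity].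
  elim H. apply Cmod_eq_0_minus, E.
Qed.

Lemma dquot_eq (f : C -> C) (a l : C) : dquot f a l a = l.
Proof.
  unfold dquot. destruct Req_EM_T as [E|E]; [reflexivity|].
  elim E. replace (a - a)%C with (RtoC 0) by ring. apply Cmod_0.
Qed.

Lemma Cminus_neq_0 (w a : C) : w <> a -> (w - a)%C <> 0.
Proof. intros H E. apply H. replace w with (w - a + a)%C by ring. rewrite E. ring. Qed.

Lemma dquot_ccont (f : C -> C) (a l : C) : cderiv f a l -> ccont (dquot f a l) a.
Proof.
  intros H e He. destruct (H e He) as [del [Hd Hdel]]. exists del. split; [exact Hd|].
  intros w Hw. rewrite dquot_eq.
  unfold dquot. destruct Req_EM_T as [E|E].
  - replace (l - l)%C with (RtoC 0) by ring. rewrite Cmod_0. lra.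
  - assert (Hn : (w - a)%C <> 0) by (intros E0; apply E; rewrite E0; apply Cmod_0).
    replace ((f w - f a) / (w - a) - l)%C with ((f w - f a - l * (w - a)) / (w - a))%C by (field; exact Hn).
    rewrite Cmod_div by exact Hn.
    assert (Hp : 0 < Cmod (w - a)) by (apply Cmod_gt_0; exact Hn).
    apply (Rmult_le_reg_r (Cmod (w - a))); [exact Hp|].
    unfold Rdiv. rewrite Rmult_assoc, Rinv_l, Rmult_1_r by lra. apply Hdel, Hw.
Qed.

Lemma cderiv_dquot (f : C -> C) (a l z d : C) : z <> a -> cderiv f z d ->
  exists d', cderiv (dquot f a l) z d'.
Proof.
  intros Hz Hd.
  destruct (cderiv_div (fun w => (f w - f a)%C) (fun w => (w - a)%C) z (d - 0) (1 - 0)) as [d' Hd'].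
  - apply Cminus_neq_0, Hz.
  - apply cderiv_minus; [exact Hd|apply cderiv_const].
  - apply cderiv_minus; [apply cderiv_id|apply cderiv_const].
  - exists d'. apply (cderiv_ext_loc _ _ z d' (Cmod (z - a))) with (3 := Hd').
    + apply Cmod_gt_0, Cminus_neq_0, Hz.
    + intros w Hw. rewrite dquot_neq; [reflexivity|]. intros ->.
      rewrite Cmod_minus_sym in Hw. lra.
Qed.

Lemma Re_Im_minus_bound (z w : C) (h : R) : Cmod (w - z) < h ->
  Re z - h < Re w < Re z + h /\ Im z - h < Im w < Im z + h.
Proof.
  intros H.
  assert (H1 := Rle_lt_trans _ _ _ (re_le_Cmod (w - z)) H).
  assert (H2 := Rle_lt_trans _ _ _ (im_le_Cmod (w - z)) H).
  apply Rabs_def2 in H1. apply Rabs_def2 in H2.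
  unfold Re, Im, Cminus, Cplus, Copp in *. simpl in *. lra.
Qed.

Lemma rect_Cmod (z w : C) (h : R) :
  Re z - h <= Re w <= Re z + h -> Im z - h <= Im w <= Im z + h -> Cmod (w - z) <= 2 * h.
Proof.
  intros A B. eapply Rle_trans; [apply Cmod_le_Re_Im|].
  unfold Im, Re, Cminus, Cplus, Copp in *. simpl in *.
  assert (Rabs (fst w + - fst z) <= h) by (apply Rabs_le; lra).
  assert (Rabs (snd w + - snd z) <= h) by (apply Rabs_le; lra). lra.
Qed.

(* Subdividing the square, the integral of [1/(w-a)] reduces to a small square centred at [a]. *)
Lemma sint_inv (z a : C) (h : R) : Cmod (a - z) < h ->
  sint (fun w => (/ (w - a))%C) z h = (RtoC (2 * PI) * Ci)%C.
Proof.
  intros Ha. destruct (Re_Im_minus_bound z a h Ha) as [Hx Hy].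
  set (g := fun w => (/ (w - a))%C).
  set (e := Rmin (Rmin (Re a - (Re z - h)) (Re z + h - Re a)) (Rmin (Im a - (Im z - h)) (Im z + h - Im a)) / 2).
  assert (He : 0 < e /\ Re z - h < Re a - e /\ Re a + e < Re z + h /\ Im z - h < Im a - e /\ Im a + e < Im z + h).
  { unfold e.
    assert (M1 := Rmin_l (Rmin (Re a - (Re z - h)) (Re z + h - Re a)) (Rmin (Im a - (Im z - h)) (Im z + h - Im a))).
    assert (M2 := Rmin_r (Rmin (Re a - (Re z - h)) (Re z + h - Re a)) (Rmin (Im a - (Im z - h)) (Im z + h - Im a))).
    assert (M3 := Rmin_l (Re a - (Re z - h)) (Re z + h - Re a)).
    assert (M4 := Rmin_r (Re a - (Re z - h)) (Re z + h - Re a)).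
    assert (M5 := Rmin_l (Im a - (Im z - h)) (Im z + h - Im a)).
    assert (M6 := Rmin_r (Im a - (Im z - h)) (Im z + h - Im a)).
    assert (0 < Rmin (Rmin (Re a - (Re z - h)) (Re z + h - Re a)) (Rmin (Im a - (Im z - h)) (Im z + h - Im a)))
      by (repeat apply Rmin_glb_lt; lra).
    lra. }
  destruct He as (He & X1 & X2 & Y1 & Y2).
  assert (Hd : forall w, w <> a -> exists l, cderiv g w l) by (intros; apply cderiv_inv_shift; assumption).
  assert (Hcc : forall w, w <> a -> ccont g w).
  { intros w Hw. destruct (Hd w Hw) as [l Hl]. eapply cderiv_ccont, Hl. }
  unfold sint.
  set (x0 := Re z - h) in *. set (x1 := Re z + h) in *. set (y0 := Im z - h) in *. set (y1 := Im z + h) in *.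
  transitivity (rint g (Re a - e) (Re a + e) (Im a - e) (Im a + e)); [|apply sint_inv_center; exact He].
  assert (Chl : forall p q r y, p <= q <= r -> y <> Im a ->
     CI (fun x => g (x, y)) p r = (CI (fun x => g (x, y)) p q + CI (fun x => g (x, y)) q r)%C).
  { intros p q r y Hq Hy'. apply CI_Chasles; [exact Hq|]. apply exCI_hor; [lra|].
    intros x _. apply Hcc. intros E. apply Hy'. rewrite <- E. reflexivity. }
  assert (Cvl : forall p q r x, p <= q <= r -> x <> Re a ->
     CI (fun y => g (x, y)) p r = (CI (fun y => g (x, y)) p q + CI (fun y => g (x, y)) q r)%C).
  { intros p q r x Hq Hy'. apply CI_Chasles; [exact Hq|]. apply exCI_ver; [lra|].
    intros y _. apply Hcc. intros E. apply Hy'. rewrite <- E. reflexivity. }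
  assert (Z1 : rint g x0 (Re a - e) y0 y1 = 0).
  { apply goursat; try lra. intros w Hw1 Hw2. apply Hd. intros ->. lra. }
  assert (Z2 : rint g (Re a + e) x1 y0 y1 = 0).
  { apply goursat; try lra. intros w Hw1 Hw2. apply Hd. intros ->. lra. }
  assert (Z3 : rint g (Re a - e) (Re a + e) y0 (Im a - e) = 0).
  { apply goursat; try lra. intros w Hw1 Hw2. apply Hd. intros ->. lra. }
  assert (Z4 : rint g (Re a - e) (Re a + e) (Im a + e) y1 = 0).
  { apply goursat; try lra. intros w Hw1 Hw2. apply Hd. intros ->. lra. }
  replace (rint g x0 x1 y0 y1) with (rint g x0 (Re a - e) y0 y1 + rint g (Re a + e) x1 y0 y1
    + rint g (Re a - e) (Re a + e) y0 (Im a - e) + rint g (Re a - e) (Re a + e) (Im a + e) y1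
    + rint g (Re a - e) (Re a + e) (Im a - e) (Im a + e))%C.
  { rewrite Z1, Z2, Z3, Z4. ring. }
  unfold rint.
  rewrite (Chl x0 (Re a - e) x1 y0), (Chl (Re a - e) (Re a + e) x1 y0) by lra.
  rewrite (Chl x0 (Re a - e) x1 y1), (Chl (Re a - e) (Re a + e) x1 y1) by lra.
  rewrite (Cvl y0 (Im a - e) y1 (Re a - e)), (Cvl (Im a - e) (Im a + e) y1 (Re a - e)) by lra.
  rewrite (Cvl y0 (Im a - e) y1 (Re a + e)), (Cvl (Im a - e) (Im a + e) y1 (Re a + e)) by lra.
  ring.
Qed.

(** The continued difference quotient at [a] has zero integral, being continuous at [a] and
    differentiable elsewhere; what is left is [f a] times the integral of 1/(w - a). *)
Theorem cauchy_formula (f : C -> C) (z a : C) (h r : R) : 2 * h < r -> hol f z r -> Cmod (a - z) < h ->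
  sint (fun w => (f w / (w - a))%C) z h = (RtoC (2 * PI) * Ci * f a)%C.
Proof.
  intros Hr Hf Ha.
  assert (Hh : 0 < h) by (assert (H := Cmod_ge_0 (a - z)); lra).
  destruct (Hf a ltac:(lra)) as [l Hl].
  destruct (Re_Im_minus_bound z a h Ha) as [Hx Hy].
  set (q := dquot f a l).
  assert (Hin : forall w, Re z - h <= Re w <= Re z + h -> Im z - h <= Im w <= Im z + h -> Cmod (w - z) < r).
  { intros w A B. assert (HH := rect_Cmod z w h A B). lra. }
  assert (Z : sint q z h = 0).
  { apply (goursat_except q _ _ _ _ a); try lra.
    - intros w A B. destruct (Ceq_dec w a) as [->|N].
      + apply dquot_ccont, Hl.
      + destruct (Hf w (Hin w A B)) as [d Hd].
        destruct (cderiv_dquot f a l w d N Hd) as [d' Hd']. eapply cderiv_ccont, Hd'.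
    - intros w A B N. destruct (Hf w (Hin w A B)) as [d Hd]. exact (cderiv_dquot f a l w d N Hd). }
  assert (Nb : forall w, sbdry z h w -> w <> a).
  { intros w Hw ->. destruct (sbdry_bounds z a h Hh Hw). lra. }
  assert (Bq : bcont q (Re z - h) (Re z + h) (Im z - h) (Im z + h)).
  { intros w Hw. destruct (bdry_rect (Re z - h) (Re z + h) (Im z - h) (Im z + h) w) as [A B]; [lra|lra|exact Hw|].
    destruct (Hf w (Hin w A B)) as [d Hd].
    destruct (cderiv_dquot f a l w d (Nb w Hw) Hd) as [d' Hd']. eapply cderiv_ccont, Hd'. }
  assert (Bi : bcont (fun w => (/ (w - a))%C) (Re z - h) (Re z + h) (Im z - h) (Im z + h)).
  { intros w Hw. destruct (cderiv_inv_shift a w (Nb w Hw)) as [d Hd]. eapply cderiv_ccont, Hd. }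
  transitivity (sint (fun w => (q w + f a * / (w - a))%C) z h).
  - apply rint_ext; [lra|lra|]. intros w Hw. unfold q. rewrite dquot_neq by (apply Nb, Hw).
    field. apply Cminus_neq_0, Nb, Hw.
  - unfold sint. rewrite rint_plus; [|lra|lra|exact Bq|].
    + rewrite rint_scal; [|lra|lra|exact Bi].
      change (sint q z h + f a * sint (fun w => (/ (w - a))%C) z h = RtoC (2 * PI) * Ci * f a)%C.
      rewrite Z, sint_inv by assumption. ring.
    + intros w Hw. destruct (cderiv_inv_shift a w (Nb w Hw)) as [d Hd].
      eapply cderiv_ccont.
      exact (cderiv_mult (fun _ => f a) (fun w => (/ (w - a))%C) w 0 d (cderiv_const _ _) Hd).
Qed.

Lemma sint_bound (f : C -> C) (z : C) (h M : R) : 0 < h ->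
  (forall w, sbdry z h w -> ccont f w) -> (forall w, sbdry z h w -> Cmod (f w) <= M) ->
  Cmod (sint f z h) <= 16 * h * M.
Proof.
  intros Hh Hc HM. eapply Rle_trans; [apply (rint_bound f _ _ _ _ M); try lra; assumption|]. lra.
Qed.

Lemma Cmod_2PI_Ci : Cmod (RtoC (2 * PI) * Ci) = 2 * PI.
Proof. rewrite Cmod_mult, Cmod_Ci, Cmod_R, Rabs_right by (assert (H := PI_RGT_0); lra). ring. Qed.

Lemma PI_ge_3 : 3 <= PI.
Proof. assert (H := PI2_3_2). lra. Qed.

Lemma hol_ccont (f : C -> C) (z w : C) (r : R) : hol f z r -> Cmod (w - z) < r -> ccont f w.
Proof. intros H Hw. destruct (H w Hw) as [d Hd]. eapply cderiv_ccont, Hd. Qed.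

Lemma ccont_mult (f g : C -> C) (z : C) : ccont f z -> ccont g z -> ccont (fun w => (f w * g w)%C) z.
Proof.
  intros Hf Hg eps He.
  assert (P1 := Cmod_ge_0 (f z)). assert (P2 := Cmod_ge_0 (g z)).
  set (k := Cmod (f z) + Cmod (g z) + 2).
  destruct (small_factor eps k He ltac:(unfold k; lra)) as (e' & He' & E1 & E2).
  destruct (Hf e' He') as [d1 [Hd1 H1]].
  destruct (Hg e' He') as [d2 [Hd2 H2]].
  exists (Rmin d1 d2). split; [apply Rmin_glb_lt; assumption|].
  intros w Hw.
  destruct (Rlt_Rmin _ _ _ Hw) as [W1 W2].
  specialize (H1 w W1). specialize (H2 w W2).
  replace (f w * g w - f z * g z)%C with ((f w - f z) * g w + f z * (g w - g z))%C by ring.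
  eapply Rle_trans; [apply Cmod_triangle|]. rewrite !Cmod_mult.
  assert (G : Cmod (g w) <= Cmod (g z) + 1).
  { assert (HH := Cmod_triangle_inv (g w) (g z)). lra. }
  assert (A1 : Cmod (f w - f z) * Cmod (g w) <= e' * (Cmod (g z) + 1)).
  { apply Rmult_le_compat; try apply Cmod_ge_0; assumption. }
  assert (A3 : Cmod (f z) * Cmod (g w - g z) <= Cmod (f z) * e').
  { apply Rmult_le_compat_l; assumption. }
  apply Rle_trans with (e' * k); [unfold k; nra|exact E2].
Qed.

Lemma ccont_const (k z : C) : ccont (fun _ => k) z.
Proof. eapply cderiv_ccont, cderiv_const. Qed.

Lemma ccont_inv_shift (a w : C) : w <> a -> ccont (fun v => (/ (v - a))%C) w.
Proof. intros H. destruct (cderiv_inv_shift a w H) as [d Hd]. eapply cderiv_ccont, Hd. Qed.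

Lemma Cmod_inv_le (x : C) (b : R) : 0 < b <= Cmod x -> Cmod (/ x) <= / b.
Proof.
  intros [H1 H2]. assert (Hx : x <> 0) by (apply Cmod_gt_0; lra).
  rewrite Cmod_inv by exact Hx. apply Rinv_le_contravar; assumption.
Qed.

(** Takes the place of the maximum principle at the price of a constant: the contour estimate gives
    32 M, and division by 2 pi leaves less than 6 M. *)
Lemma cauchy_estimate (f : C -> C) (z a : C) (h r M : R) : 0 < h -> 2 * h < r -> hol f z r ->
  Cmod (a - z) <= h / 2 -> (forall w, sbdry z h w -> Cmod (f w) <= M) -> Cmod (f a) <= 6 * M.
Proof.
  intros Hh Hr Hf Ha HM.
  assert (F := cauchy_formula f z a h r Hr Hf ltac:(lra)).
  assert (Hd : forall w, sbdry z h w -> h / 2 <= Cmod (w - a)).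
  { intros w Hw. destruct (sbdry_bounds z w h Hh Hw) as [A _].
    assert (HH := Cmod_triangle_inv (w - z) (a - z)). replace (w - z - (a - z))%C with (w - a)%C in HH by ring. lra. }
  assert (Nb : forall w, sbdry z h w -> w <> a).
  { intros w Hw ->. specialize (Hd a Hw). replace (a - a)%C with (RtoC 0) in Hd by ring. rewrite Cmod_0 in Hd. lra. }
  assert (B : Cmod (sint (fun w => (f w / (w - a))%C) z h) <= 16 * h * (M * / (h / 2))).
  { apply sint_bound; [exact Hh| |].
    - intros w Hw. apply ccont_mult; [|apply ccont_inv_shift, Nb, Hw].
      apply (hol_ccont f z w r Hf). destruct (sbdry_bounds z w h Hh Hw). lra.
    - intros w Hw. unfold Cdiv. rewrite Cmod_mult.
      apply Rmult_le_compat; try apply Cmod_ge_0; [apply HM, Hw|].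
      apply Cmod_inv_le. split; [lra|]. apply Hd, Hw. }
  rewrite F, Cmod_mult, Cmod_2PI_Ci in B.
  replace (16 * h * (M * / (h / 2))) with (32 * M) in B by (field; lra).
  assert (HP := PI_ge_3). assert (H0 := Cmod_ge_0 (f a)). nra.
Qed.

Lemma sint_plus (f g : C -> C) (z : C) (h : R) : 0 < h ->
  (forall w, sbdry z h w -> ccont f w) -> (forall w, sbdry z h w -> ccont g w) ->
  sint (fun w => (f w + g w)%C) z h = (sint f z h + sint g z h)%C.
Proof. intros. apply rint_plus; try lra; assumption. Qed.

Lemma sint_scal (k : C) (f : C -> C) (z : C) (h : R) : 0 < h ->
  (forall w, sbdry z h w -> ccont f w) ->
  sint (fun w => (k * f w)%C) z h = (k * sint f z h)%C.
Proof. intros. apply rint_scal; try lra; assumption. Qed.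

Lemma two_PI_Ci_neq_0 : (RtoC (2 * PI) * Ci)%C <> 0.
Proof. apply Cmod_gt_0. rewrite Cmod_2PI_Ci. assert (H := PI_RGT_0). lra. Qed.

(** The Cauchy kernel at z + u is expanded in u as a finite geometric sum in 1/(w - z), with the
    exact remainder u^3/((w - z)^3 (w - z - u)). The condition on u keeps the last factor of the
    denominator at least h/2 in modulus. *)
Theorem taylor3 (f : C -> C) (z : C) (h r M : R) : 0 < h -> 2 * h < r -> hol f z r ->
  (forall w, Cmod (w - z) < r -> Cmod (f w) <= M) ->
  exists c1 c2, Cmod c1 <= 3 * M / h /\ Cmod c2 <= 3 * M / h ^ 2 /\
    forall u, Cmod u <= h / 2 ->
      Cmod (f (z + u)%C - (f z + c1 * u + c2 * (u * u))) <= 6 * M / h ^ 3 * Cmod u ^ 3.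
Proof.
  intros Hh Hr Hf HM.
  set (k := (/ (RtoC (2 * PI) * Ci))%C).
  assert (Hkm : Cmod k <= / 6).
  { unfold k. apply Cmod_inv_le. rewrite Cmod_2PI_Ci. assert (HH := PI_ge_3). lra. }
  set (i := fun w => (/ (w - z))%C).
  assert (Nb : forall w, sbdry z h w -> w <> z).
  { intros w Hw ->. destruct (sbdry_bounds z z h Hh Hw) as [A _].
    replace (z - z)%C with (RtoC 0) in A by ring. rewrite Cmod_0 in A. lra. }
  assert (Cf : forall w, sbdry z h w -> ccont f w).
  { intros w Hw. apply (hol_ccont f z w r Hf). destruct (sbdry_bounds z w h Hh Hw). lra. }
  assert (Ci' : forall w, sbdry z h w -> ccont i w).
  { intros w Hw. apply ccont_inv_shift, Nb, Hw. }
  assert (Mf : forall w, sbdry z h w -> Cmod (f w) <= M).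
  { intros w Hw. apply HM. destruct (sbdry_bounds z w h Hh Hw). lra. }
  assert (Mi : forall w, sbdry z h w -> Cmod (i w) <= / h).
  { intros w Hw. apply Cmod_inv_le. split; [lra|]. apply (sbdry_bounds z w h Hh Hw). }
  assert (HMp : 0 <= M) by (eapply Rle_trans; [apply Cmod_ge_0|apply (HM z)];
     replace (z - z)%C with (RtoC 0) by ring; rewrite Cmod_0; lra).
  assert (Hih : 0 < / h) by (apply Rinv_0_lt_compat, Hh).
  set (g1 := fun w => (f w * i w)%C). set (g2 := fun w => (g1 w * i w)%C). set (g3 := fun w => (g2 w * i w)%C).
  assert (C1 : forall w, sbdry z h w -> ccont g1 w) by (intros; apply ccont_mult; auto).
  assert (C2 : forall w, sbdry z h w -> ccont g2 w) by (intros; apply ccont_mult; auto).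
  assert (C3 : forall w, sbdry z h w -> ccont g3 w) by (intros; apply ccont_mult; auto).
  assert (M1 : forall w, sbdry z h w -> Cmod (g1 w) <= M * / h).
  { intros w Hw. unfold g1. rewrite Cmod_mult. apply Rmult_le_compat; auto using Cmod_ge_0. }
  assert (M2 : forall w, sbdry z h w -> Cmod (g2 w) <= M * / h * / h).
  { intros w Hw. unfold g2. rewrite Cmod_mult. apply Rmult_le_compat; auto using Cmod_ge_0. }
  assert (M3 : forall w, sbdry z h w -> Cmod (g3 w) <= M * / h * / h * / h).
  { intros w Hw. unfold g3. rewrite Cmod_mult. apply Rmult_le_compat; auto using Cmod_ge_0. }
  exists (k * sint g2 z h)%C, (k * sint g3 z h)%C.
  split; [|split].
  - rewrite Cmod_mult. assert (B := sint_bound g2 z h _ Hh C2 M2).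
    replace (16 * h * (M * / h * / h)) with (16 * (M / h)) in B by (field; lra).
    assert (0 <= M / h) by (apply Rmult_le_pos; lra).
    assert (HH := Cmod_ge_0 (sint g2 z h)). assert (HH' := Cmod_ge_0 k).
    apply Rle_trans with (/ 6 * (16 * (M / h))); [apply Rmult_le_compat; assumption|lra].
  - rewrite Cmod_mult. assert (B := sint_bound g3 z h _ Hh C3 M3).
    replace (16 * h * (M * / h * / h * / h)) with (16 * (M / h ^ 2)) in B by (field; lra).
    assert (0 <= M / h ^ 2) by (apply Rmult_le_pos; [lra|left; apply Rinv_0_lt_compat, pow_lt, Hh]).
    assert (HH := Cmod_ge_0 (sint g3 z h)). assert (HH' := Cmod_ge_0 k).
    apply Rle_trans with (/ 6 * (16 * (M / h ^ 2))); [apply Rmult_le_compat; assumption|lra].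
  - intros u Hu.
    set (j := fun w => (/ (w - (z + u)))%C).
    assert (Hd : forall w, sbdry z h w -> h / 2 <= Cmod (w - (z + u))).
    { intros w Hw. destruct (sbdry_bounds z w h Hh Hw) as [A _].
      assert (HH := Cmod_triangle_inv (w - z) u). replace (w - z - u)%C with (w - (z + u))%C in HH by ring. lra. }
    assert (Nu : forall w, sbdry z h w -> w <> (z + u)%C).
    { intros w Hw ->. specialize (Hd _ Hw). replace (z + u - (z + u))%C with (RtoC 0) in Hd by ring. rewrite Cmod_0 in Hd. lra. }
    assert (Cj : forall w, sbdry z h w -> ccont j w) by (intros; apply ccont_inv_shift; auto).
    set (g4 := fun w => (g3 w * j w)%C).
    assert (C4 : forall w, sbdry z h w -> ccont g4 w) by (intros; apply ccont_mult; auto).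
    assert (M4 : forall w, sbdry z h w -> Cmod (g4 w) <= M * / h * / h * / h * / (h / 2)).
    { intros w Hw. unfold g4. rewrite Cmod_mult. apply Rmult_le_compat; auto using Cmod_ge_0.
      apply Cmod_inv_le. split; [lra|]. apply Hd, Hw. }
    assert (F0 := cauchy_formula f z z h r Hr Hf ltac:(replace (z - z)%C with (RtoC 0) by ring; rewrite Cmod_0; lra)).
    assert (Fu := cauchy_formula f z (z + u)%C h r Hr Hf ltac:(replace (z + u - z)%C with u by ring; lra)).
    change (sint g1 z h = (RtoC (2 * PI) * Ci * f z)%C) in F0.
    assert (E : sint (fun w => (f w / (w - (z + u)))%C) z h
      = (sint g1 z h + (u * sint g2 z h + (u * u * sint g3 z h + u * u * u * sint g4 z h)))%C).
    { transitivity (sint (fun w => (g1 w + (u * g2 w + (u * u * g3 w + u * u * u * g4 w)))%C) z h).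
      - apply rint_ext; [lra|lra|]. intros w Hw. unfold g4, g3, g2, g1, i, j. field.
        split; [apply Cminus_neq_0, Nu, Hw|apply Cminus_neq_0, Nb, Hw].
      - assert (S : forall q g, (forall w, sbdry z h w -> ccont g w) -> forall w, sbdry z h w -> ccont (fun w => (q * g w)%C) w).
        { intros q g Hg w Hw. apply (ccont_mult (fun _ => q) g); [apply ccont_const|auto]. }
        rewrite sint_plus; [|exact Hh|exact C1|].
        + rewrite sint_plus; [|exact Hh|apply S, C2|].
          * rewrite sint_plus; [|exact Hh|apply S, C3|apply S, C4].
            rewrite !sint_scal by assumption. reflexivity.
          * intros w Hw. apply ccont_plus; [apply (S (u * u)%C g3 C3 w Hw)|apply (S (u * u * u)%C g4 C4 w Hw)].
        + intros w Hw. apply ccont_plus; [apply (S u g2 C2 w Hw)|].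
          apply ccont_plus; [apply (S (u * u)%C g3 C3 w Hw)|apply (S (u * u * u)%C g4 C4 w Hw)]. }
    rewrite Fu, F0 in E.
    assert (E' : (f (z + u) - (f z + k * sint g2 z h * u + k * sint g3 z h * (u * u)))%C
       = (k * (u * u * u) * sint g4 z h)%C).
    { assert (Hk := two_PI_Ci_neq_0). unfold k. clear -E Hk. revert E Hk.
      generalize (RtoC (2 * PI) * Ci)%C. intros T E HT.
      replace (f (z + u)%C) with (/ T * (T * f (z + u)%C))%C by (field; exact HT).
      rewrite E. field. exact HT. }
    rewrite E', !Cmod_mult.
    assert (B := sint_bound g4 z h _ Hh C4 M4).
    replace (16 * h * (M * / h * / h * / h * / (h / 2))) with (32 * (M / h ^ 3)) in B by (field; lra).
    assert (0 <= M / h ^ 3) by (apply Rmult_le_pos; [lra|left; apply Rinv_0_lt_compat, pow_lt, Hh]).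
    assert (HU := Cmod_ge_0 u). assert (HU3 : 0 <= Cmod u ^ 3) by (apply pow_le, HU).
    assert (HH := Cmod_ge_0 (sint g4 z h)). assert (HH' := Cmod_ge_0 k).
    apply Rle_trans with (/ 6 * Cmod u ^ 3 * (32 * (M / h ^ 3))); [|nra].
    apply Rmult_le_compat; try assumption.
    + apply Rmult_le_pos; [assumption|]. repeat apply Rmult_le_pos; assumption.
    + replace (Cmod u * Cmod u * Cmod u) with (Cmod u ^ 3) by ring. apply Rmult_le_compat_r; assumption.
Qed.

Lemma cderiv_unique (f : C -> C) (z d e : C) : cderiv f z d -> cderiv f z e -> d = e.
Proof.
  intros Hd He. apply Cmod_eq_0_minus. apply Rle_antisym; [|apply Cmod_ge_0].
  apply Rnot_lt_le. intros Hpos. set (t := Cmod (d - e)) in *.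
  destruct (Hd (t / 4) ltac:(lra)) as [d1 [P1 H1]].
  destruct (He (t / 4) ltac:(lra)) as [d2 [P2 H2]].
  set (s := Rmin d1 d2 / 2).
  assert (Hs : 0 < s /\ s < d1 /\ s < d2).
  { assert (M1 := Rmin_l d1 d2). assert (M2 := Rmin_r d1 d2).
    assert (0 < Rmin d1 d2) by (apply Rmin_glb_lt; assumption). unfold s. lra. }
  assert (E : Cmod (z + RtoC s - z) = s).
  { replace (z + RtoC s - z)%C with (RtoC s) by ring. rewrite Cmod_R, Rabs_right; lra. }
  specialize (H1 (z + RtoC s)%C ltac:(lra)). specialize (H2 (z + RtoC s)%C ltac:(lra)).
  rewrite E in H1, H2.
  assert (K : Cmod ((d - e) * RtoC s) <= t / 4 * s + t / 4 * s).
  { replace ((d - e) * RtoC s)%C with ((f (z + RtoC s) - f z - e * (z + RtoC s - z))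
      - (f (z + RtoC s) - f z - d * (z + RtoC s - z)))%C by ring.
    eapply Rle_trans; [apply Cmod_triangle_minus|]. lra. }
  rewrite Cmod_mult, Cmod_R, (Rabs_right s) in K by lra. fold t in K. nra.
Qed.

(** * Smoothness of holomorphic functions and division by their zeros *)

Lemma hol_sub (f : C -> C) (z w : C) (r s : R) : Cmod (w - z) + s <= r -> hol f z r -> hol f w s.
Proof.
  intros H Hf v Hv. apply Hf. replace (v - z)%C with ((v - w) + (w - z))%C by ring.
  assert (T := Cmod_triangle (v - w) (w - z)). lra.
Qed.

Lemma hol_locally_bounded (f : C -> C) (z : C) (r : R) : 0 < r -> hol f z r ->
  exists s M, 0 < s <= r /\ forall w, Cmod (w - z) < s -> Cmod (f w) <= M.
Proof.
  intros Hr Hf.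
  destruct (hol_ccont f z z r Hf) with (e := 1) as [d [Hd H]]; [|lra|].
  { replace (z - z)%C with (RtoC 0) by ring. rewrite Cmod_0. exact Hr. }
  exists (Rmin d r), (Cmod (f z) + 1). repeat split; [apply Rmin_glb_lt; assumption|apply Rmin_r|].
  intros w Hw. specialize (H w ltac:(eapply Rlt_le_trans; [exact Hw|apply Rmin_l])).
  assert (T := Cmod_triangle_inv (f w) (f z)). lra.
Qed.

Lemma lin_remainder_cderiv (f : C -> C) (z c0 c1 : C) (s K : R) : 0 < s ->
  (forall u, Cmod u <= s -> Cmod (f (z + u)%C - (c0 + c1 * u)) <= K * Cmod u ^ 2) ->
  cderiv f z c1.
Proof.
  intros Hs H.
  assert (E0 : f z = c0).
  { apply Cmod_eq_0_minus. apply Rle_antisym; [|apply Cmod_ge_0].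
    specialize (H 0 ltac:(rewrite Cmod_0; lra)). rewrite Cmod_0 in H.
    replace (z + 0)%C with z in H by ring. replace (c0 + c1 * 0)%C with c0 in H by ring. lra. }
  intros e He.
  set (m := Rabs K + 1).
  assert (Hm : 0 < m) by (unfold m; assert (H2 := Rabs_pos K); lra).
  exists (Rmin s (e / m)). split; [apply Rmin_glb_lt; [exact Hs|apply Rdiv_lt_0_compat; assumption]|].
  intros w Hw.
  destruct (Rlt_Rmin _ _ _ Hw) as [W1 W2].
  specialize (H (w - z)%C ltac:(lra)). replace (z + (w - z))%C with w in H by ring.
  set (u := (w - z)%C) in *. set (t := Cmod u) in *. assert (Ht : 0 <= t) by apply Cmod_ge_0.
  replace (f w - f z - c1 * u)%C with (f w - (c0 + c1 * u))%C by (rewrite E0; ring).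
  eapply Rle_trans; [exact H|].
  assert (W3 : t * m <= e).
  { apply Rlt_le in W2. apply (Rmult_le_compat_r m) in W2; [|lra]. unfold Rdiv in W2.
    rewrite Rmult_assoc, Rinv_l, Rmult_1_r in W2 by lra. exact W2. }
  assert (HK := Rle_abs K).
  apply Rle_trans with (t * m * t); [unfold m; nra|]. apply Rmult_le_compat_r; assumption.
Qed.

Lemma quad_remainder_lin (f : C -> C) (z c0 c1 c2 : C) (s K : R) : 0 < s -> 0 <= K ->
  (forall u, Cmod u <= s -> Cmod (f (z + u)%C - (c0 + c1 * u + c2 * (u * u))) <= K * Cmod u ^ 3) ->
  forall u, Cmod u <= s -> Cmod (f (z + u)%C - (c0 + c1 * u)) <= (Cmod c2 + K * s) * Cmod u ^ 2.
Proof.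
  intros Hs HK H u Hu. specialize (H u Hu).
  replace (f (z + u)%C - (c0 + c1 * u))%C
    with ((f (z + u)%C - (c0 + c1 * u + c2 * (u * u))) + c2 * (u * u))%C by ring.
  eapply Rle_trans; [apply Cmod_triangle|]. rewrite !Cmod_mult.
  set (t := Cmod u) in *. assert (Ht : 0 <= t) by apply Cmod_ge_0.
  assert (K * t ^ 3 <= K * s * (t * t)).
  { replace (K * t ^ 3) with (K * t * (t * t)) by ring.
    apply Rmult_le_compat_r; [nra|]. nra. }
  simpl. nra.
Qed.

Lemma taylor3_deriv (f D : C -> C) (z : C) (h r M : R) : 0 < h -> 2 * h < r ->
  (forall w, Cmod (w - z) < r -> cderiv f w (D w)) ->
  (forall w, Cmod (w - z) < r -> Cmod (f w) <= M) ->
  exists c2, cderiv D z (2 * c2)%C /\ Cmod (D z) <= 3 * M / h /\ Cmod c2 <= 3 * M / h ^ 2 /\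
    forall u, Cmod u <= h / 2 ->
      Cmod (f (z + u)%C - (f z + D z * u + c2 * (u * u))) <= 6 * M / h ^ 3 * Cmod u ^ 3.
Proof.
  intros Hh Hr HD HM.
  assert (Hf : hol f z r) by (intros w Hw; exists (D w); apply HD, Hw).
  destruct (taylor3 f z h r M Hh Hr Hf HM) as (c1 & c2 & B1 & B2 & T).
  assert (Hz : Cmod (z - z) = 0) by (replace (z - z)%C with (RtoC 0) by ring; apply Cmod_0).
  assert (HMp : 0 <= M) by (eapply Rle_trans; [apply Cmod_ge_0|apply (HM z); lra]).
  assert (HK : 0 <= 6 * M / h ^ 3).
  { apply Rmult_le_pos; [lra|]. left. apply Rinv_0_lt_compat, pow_lt, Hh. }
  assert (E1 : D z = c1).
  { apply (cderiv_unique f z); [apply HD; lra|].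
    eapply (lin_remainder_cderiv f z (f z) c1 (h / 2)); [lra|].
      apply (quad_remainder_lin f z (f z) c1 c2 (h / 2) (6 * M / h ^ 3)); [lra|exact HK|exact T]. }
  exists c2. rewrite E1. repeat split; try assumption.
  set (K := 6 * M / h ^ 3) in *.
  (* The derivative of the cubic remainder [g] at z + u is estimated on a disc of radius |u|. There
     |g| <= 8 K |u|^3, and the first Taylor coefficient at scale |u|/3 is at most 3 (8 K
     |u|^3)/(|u|/3) = 72 K |u|^2. *)
  assert (Main : forall u, Cmod u <= h / 4 -> Cmod (D (z + u)%C - (c1 + 2 * c2 * u)) <= 72 * K * Cmod u ^ 2).
  { intros u Hu. destruct (Req_dec (Cmod u) 0) as [U0|U0].
    { apply Cmod_eq_0 in U0. rewrite U0, Cmod_0. replace (z + 0)%C with z by ring.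
      rewrite E1. replace (c1 - (c1 + 2 * c2 * 0))%C with (RtoC 0) by ring. rewrite Cmod_0. simpl. lra. }
    assert (Hup : 0 < Cmod u) by (assert (H := Cmod_ge_0 u); lra).
    set (g := fun w => (f w - (f z + c1 * (w - z) + c2 * ((w - z) * (w - z))))%C).
    assert (Dg : forall w, Cmod (w - z) < r -> cderiv g w (D w - (c1 + 2 * c2 * (w - z)))%C).
    { intros w Hw. unfold g. apply cderiv_minus; [apply HD, Hw|].
      assert (Di : cderiv (fun v => (v - z)%C) w (1 - 0)) by (apply cderiv_minus; [apply cderiv_id|apply cderiv_const]).
      eapply cderiv_eq; cycle 1.
      { apply cderiv_plus; [apply cderiv_plus; [apply cderiv_const|]|];
          (apply cderiv_mult; [apply cderiv_const|]); [exact Di|]. apply cderiv_mult; exact Di. }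
      cbv beta. ring. }
    assert (Dist : forall w, Cmod (w - (z + u)) < Cmod u -> Cmod (w - z) <= 2 * Cmod u).
    { intros w Hw. replace (w - z)%C with ((w - (z + u)) + u)%C by ring.
      assert (TT := Cmod_triangle (w - (z + u)) u). lra. }
    destruct (taylor3 g (z + u)%C (Cmod u / 3) (Cmod u) (K * (2 * Cmod u) ^ 3)) as (b1 & b2 & Bb & _ & Tb).
    - lra.
    - lra.
    - intros w Hw. eexists. apply Dg. specialize (Dist w Hw). lra.
    - intros w Hw. specialize (Dist w Hw). specialize (T (w - z)%C ltac:(lra)).
      replace (z + (w - z))%C with w in T by ring. unfold g.
      eapply Rle_trans; [exact T|]. apply Rmult_le_compat_l; [exact HK|].
      apply pow_incr. split; [apply Cmod_ge_0|exact Dist].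
    - assert (Eb : (D (z + u)%C - (c1 + 2 * c2 * (z + u - z)))%C = b1).
      { apply (cderiv_unique g (z + u)%C).
        - apply Dg. replace (z + u - z)%C with u by ring. lra.
        - eapply (lin_remainder_cderiv g (z + u)%C _ b1 (Cmod u / 3 / 2)); [lra|].
          eapply quad_remainder_lin; [lra| |exact Tb]. apply Rmult_le_pos.
          + apply Rmult_le_pos; [lra|]. apply Rmult_le_pos; [exact HK|apply pow_le; lra].
          + left. apply Rinv_0_lt_compat, pow_lt. lra. }
      replace (z + u - z)%C with u in Eb by ring. rewrite Eb.
      eapply Rle_trans; [exact Bb|]. right. field. lra. }
  intros e He.
  set (s := Rmin (h / 4) (e / (72 * K + 1))).
  exists s. split; [apply Rmin_glb_lt; [lra|apply Rdiv_lt_0_compat; lra]|].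
  intros w Hw.
  destruct (Rlt_Rmin _ _ _ Hw) as [W1 W2].
  specialize (Main (w - z)%C ltac:(lra)). replace (z + (w - z))%C with w in Main by ring.
  rewrite E1. replace (D w - c1 - 2 * c2 * (w - z))%C with (D w - (c1 + 2 * c2 * (w - z)))%C by ring.
  eapply Rle_trans; [exact Main|].
  set (t := Cmod (w - z)) in *. assert (Ht : 0 <= t) by apply Cmod_ge_0.
  apply Rlt_le, (Rmult_le_compat_r (72 * K + 1)) in W2; [|lra].
  unfold Rdiv in W2. rewrite Rmult_assoc, Rinv_l, Rmult_1_r in W2 by lra. simpl. nra.
Qed.

(** The only issue is differentiability of the quotient at [a]: its derivative there is the second
    Taylor coefficient of [f], and the cubic remainder divided by u is the quadratic error
    required. *)
Lemma hol_factor (f : C -> C) (z a : C) (r : R) : hol f z r -> Cmod (a - z) < r -> f a = 0 ->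
  exists g, hol g z r /\ forall w, Cmod (w - z) < r -> f w = ((w - a) * g w)%C.
Proof.
  intros Hf Ha Fa.
  assert (Hfa : hol f a (r - Cmod (a - z))) by (apply (hol_sub f z a r); [lra|exact Hf]).
  destruct (hol_locally_bounded f a (r - Cmod (a - z)) ltac:(lra) Hfa) as (s & M & Hs & HM).
  destruct (taylor3 f a (s / 3) s M) as (c1 & c2 & _ & _ & T); [lra|lra| |exact HM|].
  { apply (hol_sub f a a (r - Cmod (a - z))); [|exact Hfa]. replace (a - a)%C with (RtoC 0) by ring.
    rewrite Cmod_0. lra. }
  exists (dquot f a c1). split.
  - intros w Hw. destruct (Ceq_dec w a) as [->|N].
    + exists c2. apply (lin_remainder_cderiv _ a c1 c2 (s / 3 / 2) (6 * M / (s / 3) ^ 3)); [lra|].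
      intros u Hu. destruct (Ceq_dec u 0) as [->|N].
      { replace (a + 0)%C with a by ring. rewrite dquot_eq, Cmod_0.
        replace (c1 - (c1 + c2 * 0))%C with (RtoC 0) by ring. rewrite Cmod_0. simpl. lra. }
      assert (Na : (a + u)%C <> a).
      { intros E. apply N. replace u with (a + u - a)%C by ring. rewrite E. ring. }
      rewrite dquot_neq by exact Na. rewrite Fa in *.
      assert (Hu0 : 0 < Cmod u) by (apply Cmod_gt_0; exact N).
      specialize (T u Hu).
      replace (a + u - a)%C with u by ring.
      replace ((f (a + u) - 0) / u - (c1 + c2 * u))%C
        with ((f (a + u) - (0 + c1 * u + c2 * (u * u))) / u)%C by (field; exact N).
      rewrite Cmod_div by exact N.
      apply (Rmult_le_reg_r (Cmod u)); [exact Hu0|]. unfold Rdiv at 1.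
      rewrite Rmult_assoc, Rinv_l, Rmult_1_r by lra.
      eapply Rle_trans; [exact T|]. right. ring.
    + destruct (Hf w Hw) as [d Hd]. exact (cderiv_dquot f a c1 w d N Hd).
  - intros w Hw. destruct (Ceq_dec w a) as [->|N].
    + rewrite Fa. ring.
    + rewrite dquot_neq by exact N. rewrite Fa. field. apply Cminus_neq_0, N.
Qed.

Definition cprod (l : list C) (w : C) : C := fold_right (fun a p => ((w - a) * p)%C) 1 l.

(** Zeros are divided out once each, without multiplicity; distinctness makes the later ones zeros
    of the cofactor. *)
Lemma hol_factor_list (z : C) (r : R) (l : list C) : NoDup l -> forall f, hol f z r ->
  (forall a, In a l -> Cmod (a - z) < r /\ f a = 0) ->
  exists g, hol g z r /\ forall w, Cmod (w - z) < r -> f w = (cprod l w * g w)%C.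
Proof.
  induction 1 as [|a l Ha Hl IH]; intros f Hf Hz.
  - exists f. split; [exact Hf|]. intros w _. simpl. ring.
  - destruct (Hz a (or_introl eq_refl)) as [Ha1 Ha2].
    destruct (hol_factor f z a r Hf Ha1 Ha2) as (g & Hg & Eg).
    destruct (IH g Hg) as (g' & Hg' & Eg').
    + intros b Hb. destruct (Hz b (or_intror Hb)) as [Hb1 Hb2]. split; [exact Hb1|].
      rewrite (Eg b Hb1) in Hb2.
      assert (N : (b - a)%C <> 0) by (apply Cminus_neq_0; intros ->; contradiction).
      replace (g b) with (/ (b - a) * ((b - a) * g b))%C by (field; exact N). rewrite Hb2. ring.
    + exists g'. split; [exact Hg'|]. intros w Hw. rewrite (Eg w Hw), (Eg' w Hw). simpl. ring.
Qed.

Lemma cprod_le (l : list C) (w : C) (b : R) :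
  (forall a, In a l -> Cmod (w - a) <= b) -> Cmod (cprod l w) <= b ^ length l.
Proof.
  induction l as [|a l IH]; intros H; simpl; [rewrite Cmod_1; lra|].
  rewrite Cmod_mult. apply Rmult_le_compat; try apply Cmod_ge_0; [apply H; left; reflexivity|].
  apply IH. intros; apply H; right; assumption.
Qed.

Lemma cprod_ge (l : list C) (w : C) (b : R) : 0 <= b ->
  (forall a, In a l -> b <= Cmod (w - a)) -> b ^ length l <= Cmod (cprod l w).
Proof.
  intros Hb. induction l as [|a l IH]; intros H; simpl; [rewrite Cmod_1; lra|].
  rewrite Cmod_mult. apply Rmult_le_compat; [exact Hb|apply pow_le, Hb|apply H; left; reflexivity|].
  apply IH. intros; apply H; right; assumption.
Qed.

(** Jensen's inequality by division. On the square of half-side 10, contained in |w| <= 20, each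
    factor w - a has modulus at least 9; for |s| <= 2 it is at most 3. Each zero therefore gains a
    factor 3, and the cofactor is carried inside by [cauchy_estimate]. *)
Lemma zeros_bound (f : C -> C) (M : R) (l : list C) : hol f 0 21 ->
  (forall w, Cmod w <= 20 -> Cmod (f w) <= M) -> NoDup l ->
  (forall a, In a l -> Cmod a < 1 /\ f a = 0) ->
  forall s, Cmod s <= 2 -> Cmod (f s) * 3 ^ length l <= 6 * M.
Proof.
  intros Hf HM Hl Hz s Hs.
  assert (R0 : forall w, (w - 0)%C = w) by (intros; ring).
  destruct (hol_factor_list 0 21 l Hl f Hf) as (g & Hg & Eg).
  { intros a Ha. destruct (Hz a Ha). rewrite R0. split; [lra|assumption]. }
  assert (B : Cmod (g s) <= 6 * (M / 9 ^ length l)).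
  { apply (cauchy_estimate g 0 s 10 21); try lra; [exact Hg|rewrite R0; lra|].
    intros w Hw. destruct (sbdry_bounds 0 w 10 ltac:(lra) Hw) as [W1 W2]. rewrite R0 in W1, W2.
    assert (P : 9 ^ length l <= Cmod (cprod l w)).
    { apply cprod_ge; [lra|]. intros a Ha. destruct (Hz a Ha) as [Ha1 _].
      assert (T := Cmod_triangle_inv w a). lra. }
    assert (P0 : 0 < 9 ^ length l) by (apply pow_lt; lra).
    assert (F := HM w ltac:(lra)). rewrite (Eg w), Cmod_mult in F by (rewrite R0; lra).
    apply (Rmult_le_reg_r (9 ^ length l)); [exact P0|].
    unfold Rdiv. rewrite Rmult_assoc, Rinv_l, Rmult_1_r by lra.
    assert (G := Cmod_ge_0 (g w)). nra. }
  rewrite (Eg s), Cmod_mult by (rewrite R0; lra).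
  assert (P : Cmod (cprod l s) <= 3 ^ length l).
  { apply cprod_le. intros a Ha. destruct (Hz a Ha) as [Ha1 _].
    assert (T := Cmod_triangle_minus s a). lra. }
  assert (E9 : 9 ^ length l = 3 ^ length l * 3 ^ length l) by (rewrite <- Rpow_mult_distr; f_equal; lra).
  assert (P3 : 0 < 3 ^ length l) by (apply pow_lt; lra).
  rewrite E9 in B. set (p := 3 ^ length l) in *.
  apply Rle_trans with (p * (6 * (M / (p * p))) * p).
  - apply Rmult_le_compat_r; [lra|]. apply Rmult_le_compat; try apply Cmod_ge_0; assumption.
  - right. field. lra.
Qed.

(** * Exponential polynomials *)

Lemma cexp_add (z w : C) : cexp (z + w) = (cexp z * cexp w)%C.
Proof.
  unfold cexp, Cmult, Cplus, Re, Im. simpl. rewrite exp_plus, cos_plus, sin_plus.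
  apply injective_projections; simpl; ring.
Qed.

Lemma cexp_0 : cexp 0 = 1.
Proof. unfold cexp. simpl. rewrite exp_0, cos_0, sin_0. apply injective_projections; simpl; ring. Qed.

Lemma Cmod_cexp (z : C) : Cmod (cexp z) = exp (Re z).
Proof.
  assert (H := Cmod2_alt (cexp z)). unfold cexp, Re, Im in *. simpl fst in *. simpl snd in *.
  assert (S := sin2_cos2 (snd z)). unfold Rsqr in S.
  assert (P := exp_pos (fst z)).
  apply Rsqr_inj; [apply Cmod_ge_0|lra|].
  rewrite <- !Rsqr_pow2 in H. rewrite H. unfold Rsqr. nra.
Qed.

Lemma cexp_neq_0 (z : C) : cexp z <> 0.
Proof. apply Cmod_gt_0. rewrite Cmod_cexp. apply exp_pos. Qed.

Definition ei (a : R) (z : C) : C := cexp (Ci * RtoC a * z).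

Lemma ei_add (a : R) (z w : C) : ei a (z + w) = (ei a z * ei a w)%C.
Proof. unfold ei. rewrite <- cexp_add. f_equal. ring. Qed.

Lemma Cmod_ei (a : R) (z : C) : Cmod (ei a z) = exp (- a * Im z).
Proof. unfold ei. rewrite Cmod_cexp. f_equal. unfold Re, Im. simpl. ring. Qed.

Lemma Cmod_ei_real (a t : R) : Cmod (ei a (RtoC t)) = 1.
Proof. rewrite Cmod_ei. simpl. rewrite Rmult_0_r. apply exp_0. Qed.

Lemma exp_le_mono (x y : R) : x <= y -> exp x <= exp y.
Proof. intros [H| ->]; [left; apply exp_increasing, H|right; reflexivity]. Qed.

Lemma Cmod_ei_le (a : R) (z : C) (b : R) : Rabs a * Cmod z <= b -> Cmod (ei a z) <= exp b.
Proof.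
  intros H. rewrite Cmod_ei. apply exp_le_mono. eapply Rle_trans; [apply Rle_abs|].
  rewrite Rabs_mult, Rabs_Ropp. eapply Rle_trans; [|exact H].
  apply Rmult_le_compat_l; [apply Rabs_pos|apply im_le_Cmod].
Qed.

(* Leaving the steps h free makes the predicate invariant under translations and lets each
   elimination below choose its own step. *)
Fixpoint Kill (l : list R) (F : C -> C) : Prop :=
  match l with
  | nil => forall z, F z = 0
  | a :: l => forall h, Kill l (fun z => (F (z + h) - ei a h * F z)%C)
  end.

Lemma Kill_ext (l : list R) : forall F G, (forall z, F z = G z) -> Kill l F -> Kill l G.
Proof.
  induction l as [|a l IH]; simpl; intros F G E H.
  - intros z. rewrite <- E. apply H.
  - intros h. eapply IH; [|apply (H h)]. intros z. cbv beta. rewrite !E. reflexivity.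
Qed.

Lemma Kill_plus (l : list R) : forall F G, Kill l F -> Kill l G -> Kill l (fun z => (F z + G z)%C).
Proof.
  induction l as [|a l IH]; simpl; intros F G HF HG.
  - intros z. rewrite HF, HG. ring.
  - intros h. eapply Kill_ext; [|apply (IH _ _ (HF h) (HG h))]. intros z. cbv beta. ring.
Qed.

Lemma Kill_scal (c : C) (l : list R) : forall F, Kill l F -> Kill l (fun z => (c * F z)%C).
Proof.
  induction l as [|a l IH]; simpl; intros F HF.
  - intros z. rewrite HF. ring.
  - intros h. eapply Kill_ext; [|apply (IH _ (HF h))]. intros z. cbv beta. ring.
Qed.

Lemma Kill_shift (l : list R) : forall F k, Kill l F -> Kill l (fun z => F (z + k)%C).
Proof.
  induction l as [|a l IH]; simpl; intros F k HF.
  - intros z. apply HF.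
  - intros h. eapply Kill_ext; [|apply (IH _ k (HF h))]. intros z. cbv beta.
    replace (z + h + k)%C with (z + k + h)%C by ring. reflexivity.
Qed.

Lemma Kill_app_r (l' l : list R) (F : C -> C) : Kill l F -> Kill (l' ++ l) F.
Proof.
  revert F. induction l' as [|a l' IH]; simpl; intros F HF; [exact HF|].
  intros h. apply IH. eapply Kill_ext; [|apply Kill_plus; [apply (Kill_shift l F h HF)|apply (Kill_scal (- ei a h) l F HF)]].
  intros z. cbv beta. ring.
Qed.

Lemma Kill_zero (l : list R) : Kill l (fun _ => 0).
Proof. rewrite <- (app_nil_r l). apply Kill_app_r. simpl. reflexivity. Qed.

Lemma Kill_app_l (l l' : list R) : forall F, Kill l F -> Kill (l ++ l') F.
Proof.
  induction l as [|a l IH]; simpl; intros F HF.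
  - eapply Kill_ext; [|apply Kill_zero]. intros z. symmetry. apply HF.
  - intros h. apply IH, HF.
Qed.

Definition pexp (a : R) (x y w : C) (z : C) : C := (ei a z * (x + y * z + w * (z * z)))%C.

(** Every step of the difference operator lowers the degree of the polynomial amplitude, so a
    quadratic one needs the frequency three times. *)
Lemma Kill_pexp (a : R) (x y w : C) : Kill (a :: a :: a :: nil) (pexp a x y w).
Proof.
  intros h h' h'' z. unfold pexp. rewrite !ei_add. ring.
Qed.

(** The linear recurrence is factored into first-order ones: the difference [F1] is annihilated by
    the tail of the list, and [F] is recovered from it one step at a time. No gap between
    frequencies enters, since nothing is divided. *)
Lemma Kill_bound (l : list R) : forall (F : C -> C) (z : C) (W S : R), Kill l F ->
  1 <= W -> 0 <= S -> (forall a, In a l -> Cmod (ei a z) <= W) ->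
  (forall i, (i < length l)%nat -> Cmod (F (RtoC (INR i) * z)%C) <= S) ->
  forall m, Cmod (F (RtoC (INR m) * z)%C) <= (2 * W) ^ m * (1 + W) ^ length l * S.
Proof.
  induction l as [|a l IH]; intros F z W S HF HW HS Ha Hi m.
  - simpl in HF. rewrite HF, Cmod_0. apply Rmult_le_pos; [|exact HS].
    apply Rmult_le_pos; apply pow_le; lra.
  - set (F1 := fun v => (F (v + z) - ei a z * F v)%C).
    assert (St : forall i, (RtoC (INR i) * z + z)%C = (RtoC (INR (Datatypes.S i)) * z)%C).
    { intros i. rewrite S_INR, RtoC_plus. ring. }
    assert (Wa : Cmod (ei a z) <= W) by (apply Ha; left; reflexivity).
    assert (H1 : forall k, Cmod (F1 (RtoC (INR k) * z)%C) <= (2 * W) ^ k * (1 + W) ^ length l * ((1 + W) * S)).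
    { apply (IH F1 z W); [apply HF|exact HW|apply Rmult_le_pos; lra| |].
      - intros b Hb. apply Ha. right; exact Hb.
      - intros i Hil. unfold F1. rewrite St. eapply Rle_trans; [apply Cmod_triangle_minus|].
        rewrite Cmod_mult.
        assert (A1 : Cmod (F (RtoC (INR (Datatypes.S i)) * z)%C) <= S) by (apply Hi; simpl; lia).
        assert (A2 : Cmod (F (RtoC (INR i) * z)%C) <= S) by (apply Hi; simpl; lia).
        assert (Cmod (ei a z) * Cmod (F (RtoC (INR i) * z)%C) <= W * S)
          by (apply Rmult_le_compat; try apply Cmod_ge_0; assumption). lra. }
    induction m as [|m IHm].
    + assert (A : Cmod (F (RtoC (INR 0) * z)%C) <= S) by (apply Hi; simpl; lia).
      assert (P : 1 <= (1 + W) ^ length (a :: l)) by (apply pow_R1_Rle; lra).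
      simpl pow at 1. nra.
    + replace (F (RtoC (INR (Datatypes.S m)) * z)%C) with (F1 (RtoC (INR m) * z) + ei a z * F (RtoC (INR m) * z))%C
        by (unfold F1; rewrite St; ring).
      eapply Rle_trans; [apply Cmod_triangle|]. rewrite Cmod_mult.
      specialize (H1 m).
      assert (A : Cmod (ei a z) * Cmod (F (RtoC (INR m) * z)%C) <= W * ((2 * W) ^ m * (1 + W) ^ length (a :: l) * S))
        by (apply Rmult_le_compat; try apply Cmod_ge_0; assumption).
      simpl length in *. simpl pow in *.
      set (p := (2 * W) ^ m) in *. set (q := (1 + W) ^ length l) in *.
      assert (Hp : 0 <= p) by (apply pow_le; lra). assert (Hq : 0 <= q) by (apply pow_le; lra).
      assert (0 <= p * q * ((1 + W) * S)) by (repeat apply Rmult_le_pos; lra).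
      apply Rle_trans with (p * q * ((1 + W) * S) + W * (p * ((1 + W) * q) * S)); [lra|].
      replace (2 * W * p * ((1 + W) * q) * S) with (2 * W * (p * q * ((1 + W) * S))) by ring.
      replace (W * (p * ((1 + W) * q) * S)) with (W * (p * q * ((1 + W) * S))) by ring. nra.
Qed.

Lemma exp_pow (x : R) (n : nat) : exp x ^ n = exp (INR n * x).
Proof.
  induction n as [|n IH]; [simpl; rewrite Rmult_0_l, exp_0; reflexivity|].
  simpl pow. rewrite IH, <- exp_plus, S_INR. f_equal. ring.
Qed.

Lemma Kill_doubling (l : list R) (F : C -> C) (n : nat) (Om b : R) : Kill l F ->
  (1 <= n)%nat -> (length l <= n)%nat -> 0 <= Om -> (forall a, In a l -> Rabs a <= Om) ->
  0 <= b -> (forall z, Cmod z <= 1 -> Cmod (F z) <= b) ->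
  forall z, Cmod z <= 20 -> Cmod (F z) <= 2 ^ (21 * n) * exp (21 * Om) * b.
Proof.
  intros HF Hn1 Hn HOm Ha Hb HB z Hz.
  assert (Hn0 : 0 < INR n) by (apply lt_0_INR; lia).
  (* With step z/(20 n) the first n samples stay in the unit disc, where [F] is bounded by [b], and
     20 n steps reach z. The factor [W] is used 21 n times in all, giving exp(21 Om). *)
  set (m := (20 * n)%nat).
  assert (Hm : INR m = 20 * INR n) by (unfold m; rewrite mult_INR; simpl; ring).
  set (z0 := (z / RtoC (INR m))%C).
  assert (Hm0 : RtoC (INR m) <> 0).
  { intros E. apply (f_equal fst) in E. simpl in E. lra. }
  assert (Cz0 : Cmod z0 * INR n <= 1).
  { unfold z0. rewrite Cmod_div by exact Hm0. rewrite Cmod_R, Rabs_right by lra.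
    rewrite Hm. replace (Cmod z / (20 * INR n) * INR n) with (Cmod z / 20) by (field; lra). lra. }
  assert (Cz0p := Cmod_ge_0 z0).
  set (W := exp (Om * Cmod z0)).
  assert (HW : 1 <= W).
  { unfold W. rewrite <- exp_0. apply exp_le_mono. apply Rmult_le_pos; assumption. }
  assert (Hz0 : (RtoC (INR m) * z0)%C = z) by (unfold z0; field; exact Hm0).
  assert (K := Kill_bound l F z0 W b HF HW Hb).
  rewrite <- Hz0. eapply Rle_trans; [apply K|].
  - intros a Hal. apply Cmod_ei_le. apply Rmult_le_compat_r; [exact Cz0p|apply Ha, Hal].
  - intros i Hi. apply HB. rewrite Cmod_mult, Cmod_R, Rabs_right by (apply Rle_ge, pos_INR).
    assert (INR i <= INR n) by (apply le_INR; lia). nra.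
  - apply Rmult_le_compat_r; [exact Hb|].
    assert (E1 : (2 * W) ^ m <= 2 ^ m * exp (20 * Om)).
    { rewrite Rpow_mult_distr. apply Rmult_le_compat_l; [apply pow_le; lra|].
      unfold W. rewrite exp_pow. apply exp_le_mono. rewrite Hm. nra. }
    assert (E2 : (1 + W) ^ length l <= 2 ^ n * exp Om).
    { apply Rle_trans with ((2 * W) ^ n).
      - apply Rle_trans with ((1 + W) ^ n); [apply Rle_pow; [lra|exact Hn]|]. apply pow_incr. lra.
      - rewrite Rpow_mult_distr. apply Rmult_le_compat_l; [apply pow_le; lra|].
        unfold W. rewrite exp_pow. apply exp_le_mono. nra. }
    replace (2 ^ (21 * n)) with (2 ^ m * 2 ^ n) by (rewrite <- pow_add; f_equal; unfold m; lia).
    replace (21 * Om) with (20 * Om + Om) by ring. rewrite exp_plus.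
    replace (2 ^ m * 2 ^ n * (exp (20 * Om) * exp Om)) with (2 ^ m * exp (20 * Om) * (2 ^ n * exp Om)) by ring.
    apply Rmult_le_compat; try assumption; apply pow_le; lra.
Qed.

(** * Recovering one coefficient by elimination of the other frequencies *)

Lemma sin_ge_third (t : R) : 0 <= t <= PI / 2 -> t / 3 <= sin t.
Proof.
  intros [H1 H2]. assert (P4 := PI_4).
  destruct (sin_bound t 0 H1 ltac:(assert (HP := PI_RGT_0); lra)) as [B _].
  eapply Rle_trans; [|exact B].
  unfold sin_approx, sin_term. simpl.
  assert (t * t <= 4) by nra. nra.
Qed.

Lemma one_minus_ei (t : R) : 0 <= Rabs t <= PI -> 2 * sin (Rabs t / 2) <= Cmod (1 - ei t 1).
Proof.
  intros Ht. unfold ei, cexp.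
  assert (E : (Ci * RtoC t * 1)%C = (0, t)) by (apply injective_projections; simpl; ring).
  rewrite E. simpl. rewrite exp_0, !Rmult_1_l.
  assert (Hs : 0 <= sin (Rabs t / 2)) by (apply sin_ge_0; lra).
  assert (S2 : sin (Rabs t / 2) * sin (Rabs t / 2) = (1 - cos t) / 2).
  { assert (C2 := cos_2a_sin (Rabs t / 2)). replace (2 * (Rabs t / 2)) with (Rabs t) in C2 by field.
    assert (CA : cos (Rabs t) = cos t).
    { unfold Rabs. destruct Rcase_abs; [apply cos_neg|reflexivity]. }
    rewrite CA in C2. lra. }
  assert (H := Cmod2_alt (1 - (cos t, sin t))). unfold Re, Im in H. simpl in H.
  assert (SC := sin2_cos2 t). unfold Rsqr in SC.
  set (c := Cmod (1 - (cos t, sin t))) in *. assert (Hc : 0 <= c) by apply Cmod_ge_0.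
  assert (E2 : c * c = (2 * sin (Rabs t / 2)) * (2 * sin (Rabs t / 2))).
  { rewrite Rmult_1_r in H. rewrite H. nra. }
  apply Rsqr_incr_0_var; [|exact Hc]. unfold Rsqr. lra.
Qed.

(* The cost of eliminating, with step at most 1/n, a frequency at distance d: the first factor is
   the operator norm, the second bounds its effect on the coefficients of a quadratic polynomial. *)
Definition loss (n d : R) : R := Rmax 1 (6 * n / d) * (1 + 6 / d) ^ 2.

(** If |d| >= pi n, the step pi/|d| makes 1 - e^{idh} equal to 2 and the operator has norm at most
    1. Otherwise the largest permitted step 1/n is taken, where |1 - e^{idh}| >= |d|/(3n). *)
Lemma step_choice (n d : R) : 1 <= n -> d <> 0 -> exists h, 0 < h <= / n /\
  0 < Cmod (1 - ei (d * h) 1) /\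
  2 / Cmod (1 - ei (d * h) 1) <= Rmax 1 (6 * n / Rabs d) /\
  h / Cmod (1 - ei (d * h) 1) <= 3 / Rabs d.
Proof.
  intros Hn Hd. assert (HD : 0 < Rabs d) by (apply Rabs_pos_lt, Hd).
  assert (HP := PI_RGT_0). assert (HP4 := PI_4).
  destruct (Rle_dec (PI * n) (Rabs d)) as [H|H].
  - exists (PI / Rabs d).
    assert (Hh : 0 < PI / Rabs d) by (apply Rdiv_lt_0_compat; assumption).
    assert (Et : Rabs (d * (PI / Rabs d)) = PI).
    { rewrite Rabs_mult, (Rabs_right (PI / Rabs d)) by lra. field. lra. }
    assert (B := one_minus_ei (d * (PI / Rabs d)) ltac:(rewrite Et; lra)).
    rewrite Et, sin_PI2 in B.
    set (c := Cmod (1 - ei (d * (PI / Rabs d)) 1)) in *.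
    repeat split.
    + exact Hh.
    + apply (Rmult_le_reg_r (Rabs d * n)); [nra|].
      replace (PI / Rabs d * (Rabs d * n)) with (PI * n) by (field; lra).
      replace (/ n * (Rabs d * n)) with (Rabs d) by (field; lra). exact H.
    + lra.
    + eapply Rle_trans; [|apply Rmax_l]. apply (Rmult_le_reg_r c); [lra|].
      unfold Rdiv. rewrite Rmult_assoc, Rinv_l by lra. lra.
    + apply (Rmult_le_reg_r (c * Rabs d)); [nra|].
      replace (PI / Rabs d / c * (c * Rabs d)) with PI by (field; split; lra).
      replace (3 / Rabs d * (c * Rabs d)) with (3 * c) by (field; lra). lra.
  - exists (/ n). assert (Hh : 0 < / n) by (apply Rinv_0_lt_compat; lra).
    assert (Et : Rabs (d * / n) = Rabs d / n).
    { rewrite Rabs_mult, (Rabs_right (/ n)) by lra. reflexivity. }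
    assert (Et2 : 0 < Rabs d / n < PI).
    { split; [apply Rdiv_lt_0_compat; lra|]. apply (Rmult_lt_reg_r n); [lra|].
      unfold Rdiv. rewrite Rmult_assoc, Rinv_l by lra. lra. }
    assert (B := one_minus_ei (d * / n) ltac:(rewrite Et; lra)).
    rewrite Et in B.
    assert (B' := sin_ge_third (Rabs d / n / 2) ltac:(lra)).
    set (c := Cmod (1 - ei (d * / n) 1)) in *.
    assert (Bc : Rabs d / n / 3 <= c) by lra.
    assert (Bc' : Rabs d <= 3 * (c * n)).
    { apply (Rmult_le_compat_r (3 * n)) in Bc; [|lra].
      replace (Rabs d / n / 3 * (3 * n)) with (Rabs d) in Bc by (field; lra). lra. }
    repeat split.
    + exact Hh.
    + lra.
    + lra.
    + eapply Rle_trans; [|apply Rmax_r]. apply (Rmult_le_reg_r (c * Rabs d)); [apply Rmult_lt_0_compat; lra|].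
      replace (2 / c * (c * Rabs d)) with (2 * Rabs d) by (field; lra).
      replace (6 * n / Rabs d * (c * Rabs d)) with (6 * (c * n)) by (field; lra). lra.
    + apply (Rmult_le_reg_r (c * Rabs d * n)); [repeat apply Rmult_lt_0_compat; lra|].
      replace (/ n / c * (c * Rabs d * n)) with (Rabs d) by (field; lra).
      replace (3 / Rabs d * (c * Rabs d * n)) with (3 * (c * n)) by (field; lra). lra.
Qed.

(** Interpolation at 0, 1/2 and 1: the three coefficients are at most b, 10 b and 8 b. *)
Lemma quad_coeff_bound (x y w : C) (b : R) :
  (forall t, 0 <= t <= 1 -> Cmod (x + y * RtoC t + w * (RtoC t * RtoC t)) <= b) ->
  Cmod x + Cmod y + Cmod w <= 20 * b.
Proof.
  intros H.
  assert (H0 := H 0 ltac:(lra)). assert (H1 := H 1 ltac:(lra)). assert (H2 := H (/ 2) ltac:(lra)).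
  set (q0 := (x + y * RtoC 0 + w * (RtoC 0 * RtoC 0))%C) in *.
  set (q1 := (x + y * RtoC 1 + w * (RtoC 1 * RtoC 1))%C) in *.
  set (q2 := (x + y * RtoC (/ 2) + w * (RtoC (/ 2) * RtoC (/ 2)))%C) in *.
  assert (Eh : (2 * RtoC (/ 2))%C = 1) by (rewrite <- RtoC_mult; f_equal; field).
  assert (Ex : x = q0) by (unfold q0; ring).
  assert (Ew : w = (2 * (q1 + q0) - 4 * q2)%C).
  { unfold q0, q1, q2. replace (4 * (x + y * RtoC (/ 2) + w * (RtoC (/ 2) * RtoC (/ 2))))%C
      with (4 * x + 2 * y * (2 * RtoC (/ 2)) + w * ((2 * RtoC (/ 2)) * (2 * RtoC (/ 2))))%C by ring.
    rewrite Eh. ring. }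
  assert (Ey : y = (q1 - x - w)%C) by (unfold q1; ring).
  assert (Bx : Cmod x <= b) by (rewrite Ex; exact H0).
  assert (Bw : Cmod w <= 8 * b).
  { rewrite Ew. eapply Rle_trans; [apply Cmod_triangle_minus|]. rewrite !Cmod_mult, !Cmod_R, !Rabs_right by lra.
    assert (T := Cmod_triangle q1 q0). lra. }
  assert (By : Cmod y <= 10 * b).
  { rewrite Ey. eapply Rle_trans; [apply Cmod_triangle_minus|].
    assert (T := Cmod_triangle_minus q1 x). lra. }
  assert (0 <= b) by (eapply Rle_trans; [apply Cmod_ge_0|exact Bx]). lra.
Qed.

Definition rprod (l : list R) : R := fold_right Rmult 1 l.

(** The operator F(t) -> (F(t) - e^{-iah} F(t + h))/(1 - q), with q = e^{i(a0 - a)h}, removes one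
    occurrence of the frequency a and fixes e^{i a0 t}. On quadratic amplitudes at a0 it is
    unipotent: the leading coefficient is kept and lower ones are shifted, so it can be inverted at
    bounded cost. Each use shortens the interval by at most 1/n, whence its length in the
    hypothesis. *)
Lemma pexp_extract (l : list R) : forall (n a0 : R) (x y w : C) (G : C -> C) (b : R),
  1 <= n -> Kill l G -> (forall a, In a l -> a <> a0) -> 0 <= b ->
  (forall t, 0 <= t <= 1 + INR (length l) / n -> Cmod (pexp a0 x y w (RtoC t) + G (RtoC t)) <= b) ->
  Cmod x + Cmod y + Cmod w <= 20 * rprod (map (fun a => loss n (Rabs (a - a0))) l) * b.
Proof.
  induction l as [|a l IH]; intros n a0 x y w G b Hn HG Ha Hb0 Hb.
  - simpl. rewrite Rmult_1_r. apply quad_coeff_bound. intros t Ht. simpl in HG, Hb.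
    specialize (Hb t ltac:(unfold Rdiv; lra)). rewrite HG in Hb. unfold pexp in Hb.
    rewrite Cplus_0_r, Cmod_mult, Cmod_ei_real, Rmult_1_l in Hb. exact Hb.
  - assert (Hd : a0 - a <> 0) by (assert (a <> a0) by (apply Ha; left; reflexivity); lra).
    destruct (step_choice n (a0 - a) Hn Hd) as (h & Hh & Hc & L1 & L2).
    rewrite (Rabs_minus_sym a0 a) in L1, L2.
    set (d := Rabs (a - a0)) in *.
    assert (HD : 0 < d) by (unfold d; rewrite Rabs_minus_sym; apply Rabs_pos_lt, Hd).
    set (q := ei ((a0 - a) * h) 1) in *.
    assert (Eq : q = (ei a0 (RtoC h) * ei (- a) (RtoC h))%C).
    { unfold q, ei. rewrite <- cexp_add. f_equal. rewrite RtoC_mult, RtoC_minus, RtoC_opp. ring. }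
    assert (Eqn : (ei a (RtoC h) * ei (- a) (RtoC h))%C = 1).
    { unfold ei. rewrite <- cexp_add, <- cexp_0. f_equal. rewrite RtoC_opp. ring. }
    assert (Hq : (1 - q)%C <> 0) by (apply Cmod_gt_0; exact Hc).
    assert (Mq : Cmod q = 1) by (unfold q; apply (Cmod_ei_real _ 1)).
    set (zt := (q / (1 - q))%C).
    (* The quantity |q/(1 - q)| h governs how far the lower coefficients move: inverting the
       operator changes y by at most 2k|w| and x by at most k(|y| + |w|), since h <= 1. This is the
       origin of the factor (1 + 2k)^2. *)
    set (k := Cmod zt * h).
    assert (Hk : 0 <= k <= 3 / d).
    { unfold k, zt. rewrite Cmod_div, Mq by exact Hq.
      replace (1 / Cmod (1 - q) * h) with (h / Cmod (1 - q)) by (field; lra). split; [|exact L2].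
      apply Rmult_le_pos; [lra|left; apply Rinv_0_lt_compat, Hc]. }
    set (G' := fun z => (- (ei (- a) (RtoC h) / (1 - q)) * (G (z + RtoC h) - ei a (RtoC h) * G z))%C).
    assert (KG : Kill l G') by (apply Kill_scal, HG).
    set (w' := w). set (y' := (y - 2 * zt * RtoC h * w)%C).
    set (x' := (x - zt * RtoC h * (y + RtoC h * w))%C).
    assert (Hb' : 0 <= Rmax 1 (6 * n / d) * b).
    { apply Rmult_le_pos; [|exact Hb0]. eapply Rle_trans; [|apply Rmax_l]. lra. }
    assert (IHl := IH n a0 x' y' w' G' (Rmax 1 (6 * n / d) * b) Hn KG
      (fun c Hc' => Ha c (or_intror Hc')) Hb').
    assert (Hstep : forall t, 0 <= t <= 1 + INR (length l) / n ->
      Cmod (pexp a0 x' y' w' (RtoC t) + G' (RtoC t)) <= Rmax 1 (6 * n / d) * b).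
    { intros t Ht.
      set (F := fun z => (pexp a0 x y w z + G z)%C).
      assert (E : (pexp a0 x' y' w' (RtoC t) + G' (RtoC t))%C
        = ((F (RtoC t) - ei (- a) (RtoC h) * F (RtoC (t + h))) / (1 - q))%C).
      { unfold F, G', pexp, x', y', w', zt. rewrite RtoC_plus, ei_add.
        replace (G (RtoC t)) with (ei a (RtoC h) * ei (- a) (RtoC h) * G (RtoC t))%C at 2 by (rewrite Eqn; ring).
        assert (Hq' := Hq). rewrite Eq in *. field. exact Hq'. }
      rewrite E, Cmod_div by exact Hq.
      assert (F1 : Cmod (F (RtoC t)) <= b).
      { apply Hb. simpl length. rewrite S_INR. unfold Rdiv in *. assert (0 < / n) by (apply Rinv_0_lt_compat; lra). lra. }
      assert (F2 : Cmod (F (RtoC (t + h))) <= b).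
      { apply Hb. simpl length. rewrite S_INR. unfold Rdiv in *. assert (0 < / n) by (apply Rinv_0_lt_compat; lra). lra. }
      apply Rle_trans with (2 / Cmod (1 - q) * b).
      - unfold Rdiv. rewrite Rmult_assoc, (Rmult_comm (/ _)), <- Rmult_assoc.
        apply Rmult_le_compat_r; [left; apply Rinv_0_lt_compat, Hc|].
        eapply Rle_trans; [apply Cmod_triangle_minus|]. rewrite Cmod_mult, Cmod_ei_real. lra.
      - apply Rmult_le_compat_r; assumption. }
    specialize (IHl Hstep).
    assert (Mh : Cmod (RtoC h) = h) by (rewrite Cmod_R; apply Rabs_right; lra).
    assert (Mz : Cmod (zt * RtoC h) = k) by (rewrite Cmod_mult, Mh; reflexivity).
    assert (h1 : h <= 1).
    { destruct Hh as [_ Hh]. eapply Rle_trans; [exact Hh|]. rewrite <- Rinv_1. apply Rinv_le_contravar; lra. }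
    assert (By : Cmod y <= Cmod y' + 2 * k * Cmod w').
    { replace y with (y' + 2 * (zt * RtoC h) * w')%C by (unfold y', w'; ring).
      eapply Rle_trans; [apply Cmod_triangle|]. rewrite !Cmod_mult, <- Cmod_mult, Mz, Cmod_R, Rabs_right by lra. lra. }
    assert (Bx : Cmod x <= Cmod x' + k * (Cmod y + Cmod w')).
    { replace x with (x' + (zt * RtoC h) * (y + RtoC h * w'))%C by (unfold x', w'; ring).
      eapply Rle_trans; [apply Cmod_triangle|]. rewrite Cmod_mult, Mz. apply Rplus_le_compat_l.
      apply Rmult_le_compat_l; [apply Hk|].
      eapply Rle_trans; [apply Cmod_triangle|]. rewrite Cmod_mult, Mh.
      assert (P := Cmod_ge_0 w'). nra. }
    assert (P1 := Cmod_ge_0 x'). assert (P2 := Cmod_ge_0 y'). assert (P3 := Cmod_ge_0 w').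
    assert (Sum : Cmod x + Cmod y + Cmod w <= (1 + 2 * k) ^ 2 * (Cmod x' + Cmod y' + Cmod w')).
    { change (Cmod w) with (Cmod w'). simpl. nra. }
    assert (K6 : (1 + 2 * k) ^ 2 <= (1 + 6 / d) ^ 2).
    { apply pow_incr. split; [lra|]. replace (6 / d) with (2 * (3 / d)) by (field; lra). lra. }
    simpl map. simpl rprod. fold d. unfold loss at 1.
    set (rp := rprod (map (fun a1 => loss n (Rabs (a1 - a0))) l)) in *.
    eapply Rle_trans; [exact Sum|].
    apply Rle_trans with ((1 + 6 / d) ^ 2 * (20 * rp * (Rmax 1 (6 * n / d) * b))); [|right; ring].
    apply Rmult_le_compat; [apply pow2_ge_0|lra|exact K6|exact IHl].
Qed.

(** * Sums of chirps *)

Lemma exp_quad_bound (x : R) : Rabs x <= 1 -> Rabs (exp x - 1 - x) <= 3 * x ^ 2.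
Proof.
  intros Hx. apply Rabs_le_between in Hx.
  assert (L := exp_ineq1_le x). rewrite Rabs_right by lra.
  destruct (Rle_dec 0 x) as [P|P].
  - assert (D : exp x * (1 - x / 2) ^ 2 <= 1).
    { assert (L2 := exp_ineq1_le (- (x / 2))).
      assert (S : (1 - x / 2) ^ 2 <= exp (- (x / 2)) ^ 2) by (apply pow_incr; lra).
      assert (E : exp x * exp (- (x / 2)) ^ 2 = 1).
      { simpl. rewrite Rmult_1_r, <- !exp_plus. replace (x + (- (x / 2) + - (x / 2))) with 0 by field. apply exp_0. }
      assert (Hp := exp_pos x). nra. }
    assert (Q : 1 <= (1 + x + 3 * x ^ 2) * (1 - x / 2) ^ 2).
    { replace ((1 + x + 3 * x ^ 2) * (1 - x / 2) ^ 2) with (1 + x * x * ((1 - x) * (9 / 4 - 3 / 4 * x) + x / 4)) by field.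
      assert (0 <= (1 - x) * (9 / 4 - 3 / 4 * x)) by (apply Rmult_le_pos; lra).
      assert (0 <= x * x * ((1 - x) * (9 / 4 - 3 / 4 * x) + x / 4)) by (repeat apply Rmult_le_pos; lra). lra. }
    assert (Pp : 0 < (1 - x / 2) ^ 2) by (apply pow_lt; lra).
    apply Rnot_lt_le. intros Hlt. assert (Q' : (1 + x + 3 * x ^ 2) * (1 - x / 2) ^ 2 < exp x * (1 - x / 2) ^ 2) by (apply Rmult_lt_compat_r; lra). lra.
  - assert (D : exp x * exp (- x) = 1) by (rewrite <- exp_plus, Rplus_opp_r; apply exp_0).
    assert (L2 := exp_ineq1_le (- x)). assert (Hp := exp_pos x).
    assert (exp x * (1 - x) <= 1) by nra. simpl. nra.
Qed.

Lemma sin_bounds_abs (y : R) : Rabs y <= 1 -> Rabs (sin y - y) <= y ^ 2 /\ Rabs (cos y - 1) <= y ^ 2 / 2.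
Proof.
  intros Hy. split.
  - assert (G : forall t, 0 <= t <= 1 -> Rabs (sin t - t) <= t ^ 2).
    { intros t Ht. assert (HP := PI2_3_2).
      destruct (sin_bound t 0) as [B1 B2]; [lra|lra|].
      unfold sin_approx, sin_term in B1, B2. simpl in B1, B2.
      apply Rabs_le. simpl. split; [nra|].
      destruct (Req_dec t 0) as [-> |N]; [rewrite sin_0; lra|]. assert (Q := sin_lt_x t ltac:(lra)). nra. }
    destruct (Rle_dec 0 y) as [P|P].
    + apply G. rewrite Rabs_right in Hy by lra. lra.
    + specialize (G (- y)). rewrite sin_neg in G. rewrite Rabs_left in Hy by lra.
      replace (- sin y - - y) with (- (sin y - y)) in G by ring. rewrite Rabs_Ropp in G.
      replace ((- y) ^ 2) with (y ^ 2) in G by ring. apply G. lra.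
  - assert (C2 := cos_2a_sin (y / 2)). replace (2 * (y / 2)) with y in C2 by field.
    assert (S : Rabs (sin (y / 2)) <= Rabs (y / 2)).
    { assert (G : forall t, 0 <= t <= 1 -> Rabs (sin t) <= t).
      { intros t Ht. assert (HP := PI2_3_2). rewrite Rabs_right by (apply Rle_ge, sin_ge_0; lra).
        destruct (Req_dec t 0) as [-> |N]; [rewrite sin_0; lra|]. left. apply sin_lt_x. lra. }
      apply Rabs_le_between in Hy.
      destruct (Rle_dec 0 y) as [P|P].
      - rewrite (Rabs_right (y / 2)) by lra. apply G. lra.
      - rewrite <- Rabs_Ropp, <- sin_neg, (Rabs_left (y / 2)) by lra. apply G. lra. }
    assert (S0 := Rabs_pos (sin (y / 2))).
    assert (Sq : sin (y / 2) * sin (y / 2) <= y / 2 * (y / 2)).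
    { apply (Rmult_le_compat _ _ _ _ S0 S0 S) in S. rewrite <- !Rabs_mult in S.
      rewrite !Rabs_right in S by nra. exact S. }
    rewrite C2. apply Rabs_le. simpl. nra.
Qed.

Lemma cexp_quad (h : C) : Cmod h <= 1 -> Cmod (cexp h - 1 - h) <= 10 * Cmod h ^ 2.
Proof.
  intros Hh.
  assert (Hx := Rle_trans _ _ _ (re_le_Cmod h) Hh). assert (Hy := Rle_trans _ _ _ (im_le_Cmod h) Hh).
  assert (X := exp_quad_bound (Re h) Hx). destruct (sin_bounds_abs (Im h) Hy) as [Y1 Y2].
  assert (N := Cmod2_alt h). destruct h as [x y]. unfold Re, Im in *. simpl fst in *. simpl snd in *.
  set (c := Cmod (x, y)) in *.
  eapply Rle_trans; [apply Cmod_le_Re_Im|]. unfold cexp, Re, Im. simpl.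
  apply Rabs_le_between in Hx, Hy, X, Y1, Y2. simpl in X, Y1, Y2.
  assert (E3 : exp x <= 3) by (eapply Rle_trans; [apply exp_le_mono|apply exp_le_3]; lra). assert (E0 := exp_pos x).
  assert (Rx : Rabs (exp x * cos y + - (1) + - x) <= 3 * (x * x + y * y)) by (apply Rabs_le; split; nra).
  assert (E1 : Rabs (exp x - 1) <= 4 * Rabs x).
  { unfold Rabs at 2. destruct Rcase_abs; apply Rabs_le; nra. }
  assert (Ry : Rabs (exp x * sin y + - 0 + - y) <= 5 * (x * x + y * y)).
  { replace (exp x * sin y + - 0 + - y) with (exp x * (sin y - y) + (exp x - 1) * y) by ring.
    eapply Rle_trans; [apply Rabs_triang|]. rewrite !Rabs_mult, (Rabs_right (exp x)) by lra.
    assert (A : Rabs (sin y - y) <= y * y) by (apply Rabs_le; lra).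
    assert (B : Rabs (exp x - 1) * Rabs y <= 4 * Rabs x * Rabs y) by (apply Rmult_le_compat_r; [apply Rabs_pos|exact E1]).
    assert (S1 : Rabs x * Rabs x = x * x) by (rewrite <- Rabs_mult; apply Rabs_right; nra).
    assert (S2 : Rabs y * Rabs y = y * y) by (rewrite <- Rabs_mult; apply Rabs_right; nra).
    assert (A0 := Rabs_pos (sin y - y)). assert (P1 := Rabs_pos x). assert (P2 := Rabs_pos y).
    assert (exp x * Rabs (sin y - y) <= 3 * (y * y)) by (apply Rmult_le_compat; lra). nra. }
  simpl in N |- *. rewrite Rmult_1_r in N. lra.
Qed.

Lemma cexp_lin (h : C) : Cmod h <= 1 -> Cmod (cexp h - 1) <= 11 * Cmod h.
Proof.
  intros H. assert (Q := cexp_quad h H). assert (P := Cmod_ge_0 h).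
  replace (cexp h - 1)%C with ((cexp h - 1 - h) + h)%C by ring.
  eapply Rle_trans; [apply Cmod_triangle|]. simpl in Q. nra.
Qed.

Lemma cexp_bd (h : C) : Cmod h <= 1 -> Cmod (cexp h) <= 3.
Proof.
  intros H. rewrite Cmod_cexp. eapply Rle_trans; [apply exp_le_mono|apply exp_le_3].
  eapply Rle_trans; [apply Rle_abs|]. eapply Rle_trans; [apply re_le_Cmod|exact H].
Qed.

Lemma cderiv_cexp (z : C) : cderiv cexp z (cexp z).
Proof.
  apply (lin_remainder_cderiv cexp z (cexp z) (cexp z) 1 (Cmod (cexp z) * 10)); [lra|].
  intros u Hu. rewrite cexp_add.
  replace (cexp z * cexp u - (cexp z + cexp z * u))%C with (cexp z * (cexp u - 1 - u))%C by ring.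
  rewrite Cmod_mult, Rmult_assoc. apply Rmult_le_compat_l; [apply Cmod_ge_0|apply cexp_quad, Hu].
Qed.

Definition csum {A : Type} (f : A -> C) (l : list A) : C := fold_right Cplus (RtoC 0) (map f l).

Lemma csum_perm {A : Type} (f : A -> C) (l l' : list A) : Permutation l l' -> csum f l = csum f l'.
Proof. induction 1; unfold csum in *; simpl; try congruence; try rewrite IHPermutation; try ring; reflexivity. Qed.

Lemma csum_bound {A : Type} (f : A -> C) (g : A -> R) (l : list A) :
  (forall x, In x l -> Cmod (f x) <= g x) -> Cmod (csum f l) <= fold_right Rplus 0 (map g l).
Proof.
  unfold csum. induction l as [|a l IH]; simpl; intros H; [rewrite Cmod_0; lra|].
  eapply Rle_trans; [apply Cmod_triangle|]. apply Rplus_le_compat; [apply H; left; reflexivity|].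
  apply IH. intros; apply H; right; assumption.
Qed.

Definition rsum {A : Type} (g : A -> R) (l : list A) : R := fold_right Rplus 0 (map g l).

Lemma rsum_le_const {A : Type} (g : A -> R) (l : list A) (c : R) :
  (forall x, In x l -> g x <= c) -> rsum g l <= INR (length l) * c.
Proof.
  unfold rsum. induction l as [|a l IH]; intros H; [simpl; lra|].
  simpl length. rewrite S_INR. simpl. specialize (IH (fun x Hx => H x (or_intror Hx))).
  specialize (H a (or_introl eq_refl)). lra.
Qed.

(** The phase along the curve in the rescaled variable: [om] and [be] are its terms of order one and
    two, [T] collects the higher ones. Only the linear term may be large. *)
Definition chirp (om be : R) (T : C -> C) (s : C) : C :=
  (ei om s * cexp (Ci * (RtoC be * (s * s) + T s)))%C.

Lemma Cmod_ei_im (om Q : R) (s : C) : Rabs om <= Q -> Cmod (ei om s) <= exp (Q * Rabs (Im s)).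
Proof.
  intros H. rewrite Cmod_ei. apply exp_le_mono. eapply Rle_trans; [apply Rle_abs|].
  rewrite Rabs_mult, Rabs_Ropp. apply Rmult_le_compat_r; [apply Rabs_pos|exact H].
Qed.

Lemma chirp_phase_bound (be e : R) (t s : C) : Cmod s <= 20 -> 400 * Rabs be + Cmod t <= e ->
  Cmod (Ci * (RtoC be * (s * s) + t)) <= e.
Proof.
  intros Hs H. rewrite Cmod_mult, Cmod_Ci, Rmult_1_l.
  eapply Rle_trans; [apply Cmod_triangle|]. rewrite !Cmod_mult, Cmod_R.
  assert (P := Cmod_ge_0 s). assert (P2 := Rabs_pos be). assert (Cmod s * Cmod s <= 400) by nra. nra.
Qed.

Lemma chirp_single (om be e : R) (T : C -> C) (b s : C) : Cmod s <= 20 -> e <= 1 ->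
  400 * Rabs be + Cmod (T s) <= e ->
  Cmod (b * chirp om be T s - pexp om b 0 0 s) <= Cmod (ei om s) * (11 * e * Cmod b).
Proof.
  intros Hs He H. assert (B := chirp_phase_bound be e (T s) s Hs H).
  unfold chirp, pexp. set (h := (Ci * (RtoC be * (s * s) + T s))%C) in *.
  replace (b * (ei om s * cexp h) - ei om s * (b + 0 * s + 0 * (s * s)))%C
    with (ei om s * ((cexp h - 1) * b))%C by ring.
  rewrite !Cmod_mult. apply Rmult_le_compat_l; [apply Cmod_ge_0|].
  apply Rmult_le_compat_r; [apply Cmod_ge_0|].
  eapply Rle_trans; [apply cexp_lin; lra|]. lra.
Qed.

(* Two chirps of nearly equal frequency: [e^{i psi} - 1] is replaced by the quadratic
   polynomial [i (de s + be s^2)]; the error is small relative to the coefficients themselves,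
   even when they cancel. *)
Lemma chirp_pair (o1 o2 b1 b2 e th : R) (T1 T2 : C -> C) (c1 c2 s : C) : Cmod s <= 20 ->
  0 <= e -> 0 <= th -> 401 * (th + e) <= 1 ->
  400 * Rabs b1 + Cmod (T1 s) <= e -> 400 * Rabs b2 + Cmod (T2 s) <= e ->
  Rabs (o2 - o1) <= th ->
  Cmod (T2 s - T1 s) <= e * (Rabs (o2 - o1) + Rabs (b2 - b1)) ->
  let x := (c1 + c2)%C in let y := (Ci * RtoC (o2 - o1) * c2)%C in let w := (Ci * RtoC (b2 - b1) * c2)%C in
  Cmod ((c1 * chirp o1 b1 T1 s + c2 * chirp o2 b2 T2 s) - pexp o1 x y w s)
    <= Cmod (ei o1 s) * (10000000 * (th + e) * (Cmod x + Cmod y + Cmod w)).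
Proof.
  intros Hs He Hth Hsm H1 H2 Hd HT x y w.
  set (de := o2 - o1) in *. set (be := b2 - b1) in *. set (t := (T2 s - T1 s)%C) in *.
  set (eta := Rabs de + Rabs be) in *.
  assert (Pd := Rabs_pos de). assert (Pb := Rabs_pos be). assert (Pt := Cmod_ge_0 t).
  assert (Ps := Cmod_ge_0 s).
  assert (Bb : Rabs be <= e).
  { unfold be, Rminus. eapply Rle_trans; [apply Rabs_triang|]. rewrite Rabs_Ropp.
    assert (Q1 := Cmod_ge_0 (T1 s)). assert (Q2 := Cmod_ge_0 (T2 s)).
    assert (Q3 := Rabs_pos b1). assert (Q4 := Rabs_pos b2). lra. }
  assert (Et : eta <= th + e) by (unfold eta; lra).
  assert (Heta : 0 <= eta) by (unfold eta; lra).
  set (h := (Ci * (RtoC b1 * (s * s) + T1 s))%C).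
  assert (Bh := chirp_phase_bound b1 e (T1 s) s Hs H1). fold h in Bh.
  set (lin := (RtoC de * s + RtoC be * (s * s))%C).
  set (psi := (Ci * (lin + t))%C).
  assert (Bl : Cmod lin <= 400 * eta).
  { unfold lin. eapply Rle_trans; [apply Cmod_triangle|]. rewrite !Cmod_mult, !Cmod_R.
    assert (Cmod s * Cmod s <= 400) by nra. unfold eta. nra. }
  assert (Bp : Cmod psi <= 401 * eta).
  { unfold psi. rewrite Cmod_mult, Cmod_Ci, Rmult_1_l. eapply Rle_trans; [apply Cmod_triangle|].
    assert (e * eta <= 1 * eta) by (apply Rmult_le_compat_r; lra). lra. }
  assert (E2 : chirp o2 b2 T2 s = (chirp o1 b1 T1 s * cexp psi)%C).
  { unfold chirp, ei, psi, lin, t, de, be. rewrite <- !cexp_add. f_equal. rewrite !RtoC_minus. ring. }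
  rewrite E2. unfold chirp, pexp. fold h.
  replace (c1 * (ei o1 s * cexp h) + c2 * (ei o1 s * cexp h * cexp psi) - ei o1 s * (x + y * s + w * (s * s)))%C
    with (ei o1 s * ((cexp h - 1) * (x + y * s + w * (s * s))
          + cexp h * (c2 * ((cexp psi - 1 - psi) + Ci * t))))%C
    by (unfold x, y, w, psi, lin; ring).
  rewrite Cmod_mult. apply Rmult_le_compat_l; [apply Cmod_ge_0|].
  assert (Px := Cmod_ge_0 x). assert (Py := Cmod_ge_0 y). assert (Pw := Cmod_ge_0 w).
  (* An identity, with no loss through cancellation: an error of the form |c2| eta times a small
     number is automatically relative to the coefficients y and w. *)
  assert (Byw : Cmod c2 * eta = Cmod y + Cmod w).
  { unfold y, w, eta. rewrite !Cmod_mult, Cmod_Ci, !Cmod_R. ring. }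
  assert (A1 : Cmod ((cexp h - 1) * (x + y * s + w * (s * s))) <= 11 * e * (400 * (Cmod x + Cmod y + Cmod w))).
  { rewrite Cmod_mult. apply Rmult_le_compat; try apply Cmod_ge_0.
    - eapply Rle_trans; [apply cexp_lin; lra|]. lra.
    - eapply Rle_trans; [apply Cmod_triangle|].
      eapply Rle_trans; [apply Rplus_le_compat_r, Cmod_triangle|]. rewrite !Cmod_mult.
      assert (Cmod s * Cmod s <= 400) by nra.
      assert (Cmod w * (Cmod s * Cmod s) <= Cmod w * 400) by (apply Rmult_le_compat_l; assumption).
      assert (Cmod y * Cmod s <= Cmod y * 400) by (apply Rmult_le_compat_l; lra). lra. }
  assert (A2 : Cmod (cexp h * (c2 * ((cexp psi - 1 - psi) + Ci * t))) <= 3 * ((10 * (401 * 401) * (th + e) + e) * (Cmod y + Cmod w))).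
  { rewrite !Cmod_mult. apply Rmult_le_compat; try apply Cmod_ge_0.
    - apply Rmult_le_pos; apply Cmod_ge_0.
    - apply cexp_bd. lra.
    - rewrite <- Byw.
      replace ((10 * (401 * 401) * (th + e) + e) * (Cmod c2 * eta)) with (Cmod c2 * ((10 * (401 * 401) * (th + e) + e) * eta)) by ring.
      apply Rmult_le_compat_l; [apply Cmod_ge_0|].
      eapply Rle_trans; [apply Cmod_triangle|]. rewrite Cmod_mult, Cmod_Ci, Rmult_1_l.
      assert (Q := cexp_quad psi ltac:(lra)).
      assert (Cmod psi ^ 2 <= (401 * eta) ^ 2) by (apply pow_incr; split; [apply Cmod_ge_0|exact Bp]).
      assert (eta * eta <= (th + e) * eta) by (apply Rmult_le_compat_r; lra). simpl in *. nra. }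
  eapply Rle_trans; [apply Cmod_triangle|].
  set (n := Cmod x + Cmod y + Cmod w) in *.
  assert (Cmod y + Cmod w <= n) by (unfold n; lra).
  assert ((10 * (401 * 401) * (th + e) + e) * (Cmod y + Cmod w) <= (10 * (401 * 401) * (th + e) + e) * n)
    by (apply Rmult_le_compat_l; lra).
  assert (0 <= n) by (unfold n; lra). nra.
Qed.

(** * Grouping nearly equal frequencies and doubling *)

Record entry (A : Type) := Entry { lead : A; ec0 : C; ec1 : C; ec2 : C; paired : bool }.
Arguments Entry {A}. Arguments lead {A}. Arguments ec0 {A}. Arguments ec1 {A}. Arguments ec2 {A}. Arguments paired {A}.

Definition nrm {A : Type} (d : entry A) : R := Cmod (ec0 d) + Cmod (ec1 d) + Cmod (ec2 d).

Lemma nrm_ge_0 {A : Type} (d : entry A) : 0 <= nrm d.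
Proof. unfold nrm. assert (H1 := Cmod_ge_0 (ec0 d)). assert (H2 := Cmod_ge_0 (ec1 d)). assert (H3 := Cmod_ge_0 (ec2 d)). lra. Qed.

(** An unpaired term keeps its own frequency and errs only through the higher phase; a merged pair
    also pays for the frequency gap, at most [th]. This asymmetry is what [chirps_doubling]
    exploits. *)
Definition rel_err {A : Type} (th e : R) (d : entry A) : R :=
  if paired d then 10000000 * (th + e) else 11 * e.

Definition term {A : Type} (Om : A -> R) (s : C) (d : entry A) : C :=
  pexp (Om (lead d)) (ec0 d) (ec1 d) (ec2 d) s.

Definition chirps {A : Type} (Om Be : A -> R) (T : A -> C -> C) (b : A -> C) (l : list A) (s : C) : C :=
  csum (fun m => (b m * chirp (Om m) (Be m) (T m) s)%C) l.

(** Greedy pairing: a point with a partner within [th] is at distance at least [sg] from all others,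
    by the hypothesis on triples, so both can be removed together. The bound k on the length carries
    the induction, since one or two points leave at each step. The last clause holds because x, y, w
    determine both amplitudes of a pair once its gap in [Om] or [Be] is non-zero; it later excludes
    that the sum vanishes identically. *)
Lemma clusters {A : Type} (Om Be : A -> R) (T : A -> C -> C) (b : A -> C) (l : list A) (th sg e Q : R) :
  0 < th <= sg -> 0 <= e -> 401 * (th + e) <= 1 ->
  (forall m, In m l -> Rabs (Om m) <= Q) ->
  (forall m s, In m l -> Cmod s <= 20 -> 400 * Rabs (Be m) + Cmod (T m s) <= e) ->
  (forall m n, In m l -> In n l -> m <> n -> Rabs (Om n - Om m) < th ->
     0 < Rabs (Om n - Om m) + Rabs (Be n - Be m) /\
     forall s, Cmod s <= 20 -> Cmod (T n s - T m s) <= e * (Rabs (Om n - Om m) + Rabs (Be n - Be m))) ->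
  (forall m n n', In m l -> In n l -> In n' l -> n <> m -> n' <> m -> n <> n' ->
     Rabs (Om n - Om m) < sg -> sg <= Rabs (Om n' - Om m)) ->
  forall k l', (length l' <= k)%nat -> NoDup l' -> incl l' l ->
  exists D : list (entry A),
    NoDup (map lead D) /\ (forall d, In d D -> In (lead d) l') /\ (length D <= length l')%nat /\
    (forall s, Cmod s <= 20 -> Cmod (chirps Om Be T b l' s - csum (term Om s) D)
        <= exp (Q * Rabs (Im s)) * rsum (fun d => rel_err th e d * nrm d) D) /\
    (forall d, In d D -> paired d = true -> exists n, In n l' /\ n <> lead d /\
        Rabs (Om n - Om (lead d)) < th /\ forall d', In d' D -> lead d' <> n) /\
    (forall d d', In d D -> In d' D -> lead d <> lead d' -> th <= Rabs (Om (lead d') - Om (lead d))) /\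
    ((forall d, In d D -> nrm d = 0) -> forall m, In m l' -> b m = 0).
Proof.
  intros [Hth Hts] He Hsm HQ H1 H2 H3.
  induction k as [|k IH]; intros l' Hk Hnd Hin.
  { destruct l'; [|simpl in Hk; lia]. exists nil.
    refine (conj _ (conj _ (conj _ (conj _ (conj _ (conj _ _))))));
      try (simpl; intros; contradiction); [constructor|apply le_n|].
    intros s Hs. unfold chirps, csum, rsum. simpl. replace (0 - 0)%C with (RtoC 0) by ring. rewrite Cmod_0. lra. }
  destruct l' as [|m t].
  { exists nil.
    refine (conj _ (conj _ (conj _ (conj _ (conj _ (conj _ _))))));
      try (simpl; intros; contradiction); [constructor|apply le_n|].
    intros s Hs. unfold chirps, csum, rsum. simpl. replace (0 - 0)%C with (RtoC 0) by ring. rewrite Cmod_0. lra. }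
  assert (Hm : In m l) by (apply Hin; left; reflexivity).
  apply NoDup_cons_iff in Hnd. destruct Hnd as [Hmt Hnd].
  destruct (excluded_middle_informative (exists n, In n t /\ Rabs (Om n - Om m) < th)) as [[n [Hn Hc]]|Hno].
  - destruct (in_split n t Hn) as (t1 & t2 & Et).
    assert (Hnl : In n l) by (apply Hin; right; exact Hn).
    assert (Hnm : n <> m) by (intros ->; contradiction).
    assert (Hnd' : NoDup (t1 ++ t2) /\ ~ In n (t1 ++ t2)) by (rewrite Et in Hnd; split; [eapply NoDup_remove_1|eapply NoDup_remove_2]; exact Hnd).
    destruct Hnd' as [Hnd' Hn'].
    assert (Hsub : forall x, In x (t1 ++ t2) -> In x t).
    { intros x Hx. rewrite Et. apply in_app_or in Hx. apply in_or_app. simpl. tauto. }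
    destruct (IH (t1 ++ t2)) as (D & D1 & D2 & D3 & D4 & D5 & D6 & D7).
    { rewrite Et in Hk. simpl in Hk. rewrite length_app in *. simpl in Hk. lia. }
    { exact Hnd'. }
    { intros x Hx. apply Hin. right. apply Hsub, Hx. }
    set (d0 := Entry m (b m + b n)%C (Ci * RtoC (Om n - Om m) * b n)%C (Ci * RtoC (Be n - Be m) * b n)%C true).
    destruct (H2 m n Hm Hnl (not_eq_sym Hnm) Hc) as [Heta HT].
    assert (Hfar : forall x, In x (t1 ++ t2) -> sg <= Rabs (Om x - Om m)).
    { intros x Hx. apply (H3 m n x); try assumption.
      - apply Hin; right; apply Hsub, Hx.
      - intros ->. apply Hmt, Hsub, Hx.
      - intros ->. contradiction.
      - lra. }
    exists (d0 :: D). refine (conj _ (conj _ (conj _ (conj _ (conj _ (conj _ _)))))).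
    + simpl. constructor; [|exact D1]. intros Hc'. apply in_map_iff in Hc'. destruct Hc' as [d [E Hd]].
      apply Hmt, Hsub. rewrite <- E. apply D2, Hd.
    + intros d [<-|Hd]; [left; reflexivity|]. right. apply Hsub, D2, Hd.
    + rewrite Et. simpl. rewrite length_app in *. simpl. lia.
    + intros s Hs.
      assert (Ep : chirps Om Be T b (m :: t) s = (b m * chirp (Om m) (Be m) (T m) s + b n * chirp (Om n) (Be n) (T n) s
          + chirps Om Be T b (t1 ++ t2) s)%C).
      { unfold chirps. rewrite (csum_perm _ (m :: t) (m :: n :: (t1 ++ t2))).
        - unfold csum. simpl. ring.
        - constructor. rewrite Et. symmetry. apply Permutation_middle. }
      rewrite Ep. unfold csum at 1. simpl. fold (csum (term Om s) D).
      replace (b m * chirp (Om m) (Be m) (T m) s + b n * chirp (Om n) (Be n) (T n) s + chirps Om Be T b (t1 ++ t2) s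
         - (term Om s d0 + csum (term Om s) D))%C
        with ((b m * chirp (Om m) (Be m) (T m) s + b n * chirp (Om n) (Be n) (T n) s - term Om s d0)
         + (chirps Om Be T b (t1 ++ t2) s - csum (term Om s) D))%C by ring.
      eapply Rle_trans; [apply Cmod_triangle|].
      unfold rsum. simpl. fold (rsum (fun d => rel_err th e d * nrm d) D). rewrite Rmult_plus_distr_l.
      apply Rplus_le_compat; [|apply D4, Hs].
      eapply Rle_trans; [apply (chirp_pair (Om m) (Om n) (Be m) (Be n) e th (T m) (T n) (b m) (b n) s); try assumption; try lra|].
      * apply H1; assumption.
      * apply H1; assumption.
      * apply HT, Hs.
      * apply Rmult_le_compat_r.
        -- apply Rmult_le_pos; [unfold rel_err; simpl; lra|]. apply (nrm_ge_0 d0).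
        -- apply Cmod_ei_im, HQ, Hm.
    + intros d [<-|Hd] Hp.
      * exists n. simpl. split; [right; exact Hn|]. split; [exact Hnm|]. split; [exact Hc|].
        intros d' [<-|Hd']; [simpl; congruence|]. intros E. apply Hn'. rewrite <- E. apply D2, Hd'.
      * destruct (D5 d Hd Hp) as (n' & N1 & N2 & N3 & N4). exists n'.
        split; [right; apply Hsub, N1|]. split; [exact N2|]. split; [exact N3|].
        intros d' [<-|Hd']; [|apply N4, Hd']. simpl. intros ->. apply Hmt, Hsub, N1.
    + intros d d' [<-|Hd] [<-|Hd'] N; simpl in *.
      * congruence.
      * specialize (Hfar (lead d') (D2 d' Hd')). lra.
      * specialize (Hfar (lead d) (D2 d Hd)). rewrite Rabs_minus_sym. lra.
      * apply D6; assumption.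
    + intros Hz x Hx.
      assert (Z0 := Hz d0 (or_introl eq_refl)). unfold nrm in Z0. simpl in Z0.
      assert (P1 := Cmod_ge_0 (b m + b n)).
      assert (P2 := Cmod_ge_0 (Ci * RtoC (Om n - Om m) * b n)). assert (P3 := Cmod_ge_0 (Ci * RtoC (Be n - Be m) * b n)).
      assert (Q1 : Cmod (b n) * (Rabs (Om n - Om m) + Rabs (Be n - Be m)) = 0).
      { rewrite !Cmod_mult, Cmod_Ci, !Cmod_R in *. lra. }
      assert (Q2 : b n = 0).
      { apply Cmod_eq_0. apply Rmult_integral in Q1. destruct Q1 as [Q1|Q1]; [exact Q1|lra]. }
      assert (Q3 : b m = 0).
      { assert (Z1 : Cmod (b m + b n) = 0) by lra. apply Cmod_eq_0 in Z1. rewrite Q2 in Z1. rewrite <- Z1. ring. }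
      destruct Hx as [<-|Hx]; [exact Q3|].
      rewrite Et in Hx. apply in_app_or in Hx. simpl in Hx.
      destruct (excluded_middle_informative (x = n)) as [->|N]; [exact Q2|].
      apply D7; [intros d Hd; apply Hz; right; exact Hd|]. apply in_or_app. destruct Hx as [Hx|[Hx|Hx]]; auto; congruence.
  - destruct (IH t) as (D & D1 & D2 & D3 & D4 & D5 & D6 & D7).
    { simpl in Hk. lia. } { exact Hnd. } { intros x Hx. apply Hin. right. exact Hx. }
    set (d0 := Entry m (b m) 0 0 false).
    assert (Hfar : forall x, In x t -> th <= Rabs (Om x - Om m)).
    { intros x Hx. apply Rnot_lt_le. intros Hlt. apply Hno. exists x. split; assumption. }
    exists (d0 :: D). refine (conj _ (conj _ (conj _ (conj _ (conj _ (conj _ _)))))).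
    + simpl. constructor; [|exact D1]. intros Hc'. apply in_map_iff in Hc'. destruct Hc' as [d [E Hd]].
      apply Hmt. rewrite <- E. apply D2, Hd.
    + intros d [<-|Hd]; [left; reflexivity|]. right. apply D2, Hd.
    + simpl. lia.
    + intros s Hs. unfold chirps, csum. simpl. fold (csum (term Om s) D).
      fold (csum (fun m0 => b m0 * chirp (Om m0) (Be m0) (T m0) s)%C t). fold (chirps Om Be T b t s).
      replace (b m * chirp (Om m) (Be m) (T m) s + chirps Om Be T b t s - (term Om s d0 + csum (term Om s) D))%C
        with ((b m * chirp (Om m) (Be m) (T m) s - term Om s d0) + (chirps Om Be T b t s - csum (term Om s) D))%C by ring.
      eapply Rle_trans; [apply Cmod_triangle|].
      unfold rsum. simpl. fold (rsum (fun d => rel_err th e d * nrm d) D). rewrite Rmult_plus_distr_l.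
      apply Rplus_le_compat; [|apply D4, Hs].
      eapply Rle_trans; [apply (chirp_single (Om m) (Be m) e (T m) (b m) s); try assumption; [lra|apply H1; assumption]|].
      unfold nrm, rel_err; simpl. rewrite Cmod_0, !Rplus_0_r. apply Rmult_le_compat_r.
      * apply Rmult_le_pos; [lra|apply Cmod_ge_0].
      * apply Cmod_ei_im, HQ, Hm.
    + intros d [<-|Hd] Hp; [discriminate|].
      destruct (D5 d Hd Hp) as (n' & N1 & N2 & N3 & N4). exists n'.
      split; [right; exact N1|]. split; [exact N2|]. split; [exact N3|].
      intros d' [<-|Hd']; [|apply N4, Hd']. simpl. intros ->. contradiction.
    + intros d d' [<-|Hd] [<-|Hd'] N; simpl in *.
      * congruence.
      * apply (Hfar (lead d') (D2 d' Hd')).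
      * rewrite Rabs_minus_sym. apply (Hfar (lead d) (D2 d Hd)).
      * apply D6; assumption.
    + intros Hz x [<-|Hx].
      * assert (Z0 := Hz d0 (or_introl eq_refl)). unfold nrm in Z0. simpl in Z0.
        rewrite Cmod_0, !Rplus_0_r in Z0. apply Cmod_eq_0, Z0.
      * apply D7; [intros d Hd; apply Hz; right; exact Hd|exact Hx].
Qed.

Lemma loss_ge_1 (n d : R) : 0 < d -> 1 <= loss n d.
Proof.
  intros Hd. unfold loss. assert (A := Rmax_l 1 (6 * n / d)).
  assert (0 < 6 / d) by (apply Rdiv_lt_0_compat; lra).
  assert (B : 1 <= (1 + 6 / d) ^ 2) by (apply pow_R1_Rle; lra). nra.
Qed.

Lemma loss_mono (n d d' : R) : 0 <= n -> 0 < d <= d' -> loss n d' <= loss n d.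
Proof.
  intros Hn Hd. unfold loss.
  assert (I : / d' <= / d) by (apply Rinv_le_contravar; lra).
  assert (I0 : 0 < / d') by (apply Rinv_0_lt_compat; lra).
  apply Rmult_le_compat.
  - eapply Rle_trans; [|apply Rmax_l]. lra.
  - apply pow2_ge_0.
  - apply Rle_max_compat_l. unfold Rdiv. apply Rmult_le_compat_l; lra.
  - apply pow_incr. unfold Rdiv. nra.
Qed.

Definition triple (om : R) : list R := [om; om; om].

Lemma Kill_csum {A : Type} (Om : A -> R) (D : list (entry A)) :
  Kill (flat_map (fun d => triple (Om (lead d))) D) (fun s => csum (term Om s) D).
Proof.
  induction D as [|d D IH].
  - simpl. reflexivity.
  - simpl flat_map.
    eapply Kill_ext; [|apply Kill_plus].
    2:{ apply (Kill_app_l (triple (Om (lead d))) (flat_map (fun d => triple (Om (lead d))) D)).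
        apply (Kill_pexp (Om (lead d)) (ec0 d) (ec1 d) (ec2 d)). }
    2:{ apply (Kill_app_r (triple (Om (lead d)))), IH. }
    intros z. reflexivity.
Qed.

Lemma rprod_triples {A : Type} (Om : A -> R) (D : list (entry A)) (g : R -> R) :
  rprod (map g (flat_map (fun d => triple (Om (lead d))) D))
    = rprod (map (fun d => g (Om (lead d)) ^ 3) D).
Proof.
  induction D as [|d D IH]; [reflexivity|].
  unfold rprod, triple in *. cbn [flat_map app map fold_right]. rewrite IH. ring.
Qed.

Lemma rprod_bound_all {B : Type} (g : B -> R) (D : list B) (L : R) : 1 <= L ->
  (forall d, In d D -> 0 <= g d <= L) -> 0 <= rprod (map g D) <= L ^ length D.
Proof.
  intros HL. unfold rprod. induction D as [|d D IH]; intros H; simpl; [lra|].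
  specialize (IH (fun x Hx => H x (or_intror Hx))). destruct (H d (or_introl eq_refl)).
  split; [apply Rmult_le_pos; lra|]. apply Rmult_le_compat; lra.
Qed.

(** At most one frequency can be close to a given one, so the large loss L' is paid at most once. *)
Lemma rprod_bound_one {B : Type} (g : B -> R) (D : list B) (L L' : R) (close : B -> Prop) : 1 <= L -> 1 <= L' -> NoDup D ->
  (forall d, In d D -> 0 <= g d <= L') -> (forall d, In d D -> ~ close d -> g d <= L) ->
  (forall d d', In d D -> In d' D -> close d -> close d' -> d = d') ->
  0 <= rprod (map g D) <= L' * L ^ length D.
Proof.
  intros HL HL'. induction D as [|d D IH]; intros Hnd H0 H1 H2; [unfold rprod; simpl; lra|].
  apply NoDup_cons_iff in Hnd. destruct Hnd as [Hd Hnd].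
  destruct (H0 d (or_introl eq_refl)) as [G0 G1].
  destruct (excluded_middle_informative (close d)) as [Hc|Hc].
  - assert (B1 : 0 <= rprod (map g D) <= L ^ length D).
    { apply rprod_bound_all; [exact HL|]. intros x Hx. split; [apply (H0 x (or_intror Hx))|].
      apply H1; [right; exact Hx|]. intros Hx'. rewrite (H2 d x) in Hd; simpl; auto. }
    unfold rprod in *. simpl. assert (P : 1 <= L ^ length D) by (apply pow_R1_Rle, HL).
    split; [apply Rmult_le_pos; lra|].
    apply Rle_trans with (L' * L ^ length D); [apply Rmult_le_compat; lra|]. apply Rmult_le_compat_l; [lra|]. nra.
  - assert (B1 : 0 <= rprod (map g D) <= L' * L ^ length D).
    { apply IH; try assumption; intros; [apply H0|apply H1|apply H2]; simpl; auto. }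
    specialize (H1 d (or_introl eq_refl) Hc).
    unfold rprod in *. simpl. split; [apply Rmult_le_pos; lra|].
    replace (L' * (L * L ^ length D)) with (L * (L' * L ^ length D)) by ring. apply Rmult_le_compat; lra.
Qed.

Lemma NoDup_map_inj {A B : Type} (f : A -> B) (l : list A) (x y : A) :
  NoDup (map f l) -> In x l -> In y l -> f x = f y -> x = y.
Proof.
  induction l as [|a l IH]; simpl; intros H Hx Hy E; [contradiction|].
  apply NoDup_cons_iff in H. destruct H as [H1 H2].
  destruct Hx as [->|Hx], Hy as [->|Hy]; auto.
  - elim H1. rewrite E. apply in_map, Hy.
  - elim H1. rewrite <- E. apply in_map, Hx.
Qed.

(** The other entries contribute three frequencies each, at most n in number; steps of length at
    most 1/n therefore extend the unit interval of [quad_coeff_bound] to no more than [0,2]. *)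
Lemma term_extract {A : Type} (Om : A -> R) (D : list (entry A)) (n : nat) (th b : R) (d : entry A) :
  0 < th -> (1 <= n)%nat -> (3 * length D <= n)%nat -> NoDup (map lead D) -> In d D ->
  (forall d d', In d D -> In d' D -> lead d <> lead d' -> th <= Rabs (Om (lead d') - Om (lead d))) ->
  0 <= b -> (forall t, 0 <= t <= 2 -> Cmod (csum (term Om (RtoC t)) D) <= b) ->
  exists D', NoDup (map lead D') /\ (length D' <= length D)%nat /\
    (forall d', In d' D' -> In d' D /\ lead d' <> lead d) /\
    nrm d <= 20 * rprod (map (fun d' => loss (INR n) (Rabs (Om (lead d') - Om (lead d))) ^ 3) D') * b.
Proof.
  intros Hth Hn Hlen Hnd Hd Hsep Hb HP.
  destruct (in_split d D Hd) as (D1 & D2 & E). exists (D1 ++ D2).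
  assert (Hnd' : NoDup (map lead (D1 ++ D2)) /\ ~ In (lead d) (map lead (D1 ++ D2))).
  { rewrite E, map_app in Hnd. simpl in Hnd. rewrite map_app.
    split; [eapply NoDup_remove_1|eapply NoDup_remove_2]; exact Hnd. }
  destruct Hnd' as [Hnd1 Hnd2].
  assert (Hoth : forall d', In d' (D1 ++ D2) -> In d' D /\ lead d' <> lead d).
  { intros d' Hd'. split.
    - rewrite E. apply in_app_or in Hd'. apply in_or_app. simpl. tauto.
    - intros El. apply Hnd2. rewrite <- El. apply in_map, Hd'. }
  assert (Hl1 : (length D = S (length (D1 ++ D2)))%nat) by (rewrite E, !length_app; simpl; lia).
  split; [exact Hnd1|]. split; [lia|]. split; [exact Hoth|].
  set (fr := flat_map (fun d' => triple (Om (lead d'))) (D1 ++ D2)).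
  assert (Lf : length fr = (3 * length (D1 ++ D2))%nat).
  { unfold fr. rewrite (flat_map_constant_length (c := 3)) by reflexivity. lia. }
  assert (Hn1 : 1 <= INR n) by (apply (le_INR 1), Hn).
  assert (X := pexp_extract fr (INR n) (Om (lead d)) (ec0 d) (ec1 d) (ec2 d)
     (fun s => csum (term Om s) (D1 ++ D2)) b Hn1 (Kill_csum Om (D1 ++ D2))).
  rewrite <- (rprod_triples Om (D1 ++ D2) (fun a => loss (INR n) (Rabs (a - Om (lead d))))).
  apply X.
  - intros a Ha. unfold fr in Ha. apply in_flat_map in Ha. destruct Ha as [d' [Hd' Ha]].
    assert (Ea : a = Om (lead d')) by (simpl in Ha; intuition congruence). subst a.
    destruct (Hoth d' Hd') as [Hi Hne]. specialize (Hsep d d' Hd Hi (not_eq_sym Hne)).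
    intros Eo. rewrite Eo, Rminus_diag, Rabs_R0 in Hsep. lra.
  - exact Hb.
  - intros t Ht. assert (Ht2 : 0 <= t <= 2).
    { split; [apply Ht|]. eapply Rle_trans; [apply Ht|].
      assert (INR (length fr) <= INR n) by (apply le_INR; lia).
      assert (INR (length fr) / INR n <= 1).
      { apply (Rmult_le_reg_r (INR n)); [lra|]. unfold Rdiv. rewrite Rmult_assoc, Rinv_l by lra. lra. }
      lra. }
    specialize (HP t Ht2). rewrite (csum_perm _ D (d :: D1 ++ D2)) in HP; [exact HP|].
    rewrite E. symmetry. apply Permutation_middle.
Qed.

(** An absorption argument. The approximating sum is at most B + E on [0,2], where E is the total
    error; extraction bounds each coefficient by a multiple of B + E, and the two numerical
    hypotheses turn this into E <= (B + E)/2, hence E <= B. The doubling inequality for the exact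
    exponential sum then carries over. *)
Theorem chirps_doubling {A : Type} (Om Be : A -> R) (T : A -> C -> C) (b : A -> C) (l : list A) (th sg e Q : R) :
  0 < th <= sg -> 0 <= e -> 401 * (th + e) <= 1 ->
  (forall m, In m l -> Rabs (Om m) <= Q) ->
  (forall m s, In m l -> Cmod s <= 20 -> 400 * Rabs (Be m) + Cmod (T m s) <= e) ->
  (forall m n, In m l -> In n l -> m <> n -> Rabs (Om n - Om m) < th ->
     0 < Rabs (Om n - Om m) + Rabs (Be n - Be m) /\
     forall s, Cmod s <= 20 -> Cmod (T n s - T m s) <= e * (Rabs (Om n - Om m) + Rabs (Be n - Be m))) ->
  (forall m n n', In m l -> In n l -> In n' l -> n <> m -> n' <> m -> n <> n' ->
     Rabs (Om n - Om m) < sg -> sg <= Rabs (Om n' - Om m)) ->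
  NoDup l -> (1 <= length l)%nat -> 0 <= Q ->
  let n := (3 * length l)%nat in let L0 := loss (INR n) sg ^ n in
  10000000 * (th + e) * (20 * L0) * (2 * INR (length l)) <= 1 ->
  11 * e * (20 * (loss (INR n) th ^ 3 * L0)) * (2 * INR (length l)) <= 1 ->
  forall B, 0 <= B -> (forall z, Cmod z <= 2 -> Cmod (chirps Om Be T b l z) <= B) ->
    (forall z, Cmod z <= 20 -> Cmod (chirps Om Be T b l z) <= 2 ^ (21 * n + 2) * exp (22 * Q) * B) /\
    (B = 0 -> forall m, In m l -> b m = 0).
Proof.
  intros Hth He Hsm HQ H1 H2 H3 Hnd Hlen HQ0 n L0 N1 N2 B HB HfB.
  destruct (clusters Om Be T b l th sg e Q Hth He Hsm HQ H1 H2 H3 (length l) l (le_n _) Hnd (incl_refl _))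
    as (D & D1 & D2 & D3 & D4 & D5 & D6 & D7).
  set (E := rsum (fun d => rel_err th e d * nrm d) D) in *.
  assert (Hrel : forall d : entry A, 0 <= rel_err th e d) by (intros d; unfold rel_err; destruct (paired d); lra).
  assert (HE : 0 <= E).
  { unfold E, rsum. clear -Hrel. induction D as [|d D IH]; simpl; [lra|].
    assert (P := Rmult_le_pos _ _ (Hrel d) (nrm_ge_0 d)). lra. }
  assert (Hn1 : (1 <= n)%nat) by (unfold n; lia).
  assert (Hn1' : 1 <= INR n) by (apply (le_INR 1), Hn1).
  assert (HPr : forall t, 0 <= t <= 2 -> Cmod (csum (term Om (RtoC t)) D) <= B + E).
  { intros t Ht. assert (Mt : Cmod (RtoC t) <= 2) by (rewrite Cmod_R, Rabs_right; lra).
    specialize (D4 (RtoC t) ltac:(lra)). simpl in D4. rewrite Rabs_R0, Rmult_0_r, exp_0, Rmult_1_l in D4.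
    specialize (HfB (RtoC t) Mt).
    replace (csum (term Om (RtoC t)) D) with (chirps Om Be T b l (RtoC t) - (chirps Om Be T b l (RtoC t) - csum (term Om (RtoC t)) D))%C by ring.
    eapply Rle_trans; [apply Cmod_triangle_minus|]. fold E in D4. lra. }
  assert (Ls1 : 1 <= loss (INR n) sg) by (apply loss_ge_1; lra).
  assert (Lt1 : 1 <= loss (INR n) th) by (apply loss_ge_1; lra).
  assert (L01 : 1 <= L0) by (apply pow_R1_Rle, Ls1).
  assert (Lt3 : 1 <= loss (INR n) th ^ 3) by (apply pow_R1_Rle, Lt1).
  (* A merged pair has its partner as only neighbour within [sg], so every other entry is far and
     the cost is at most [L0], against the error [th] + e. An unpaired term may have one other entry
     within [sg], though not within [th]; the additional cost [loss (INR n) th ^ 3] is set against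
     the smaller error e. *)
  assert (HD : forall d, In d D -> exists W, 0 <= W /\ nrm d <= W * (B + E) /\ rel_err th e d * W * (2 * INR (length l)) <= 1).
  { intros d Hd.
    destruct (term_extract Om D n th (B + E) d) as (D' & F1 & F2 & F3 & F4); try assumption; try lra; [unfold n; lia|].
    set (g := fun d' : entry A => loss (INR n) (Rabs (Om (lead d') - Om (lead d))) ^ 3) in *.
    assert (Hg : forall d', In d' D' -> 0 <= g d' <= loss (INR n) th ^ 3).
    { intros d' Hd'. destruct (F3 d' Hd') as [F5 F6].
      assert (S := D6 d d' Hd F5 (not_eq_sym F6)).
      assert (Q1 := loss_ge_1 (INR n) (Rabs (Om (lead d') - Om (lead d))) ltac:(lra)).
      split; [apply pow_le; lra|]. apply pow_incr. split; [lra|]. apply loss_mono; lra. }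
    assert (Hg' : forall d', In d' D' -> sg <= Rabs (Om (lead d') - Om (lead d)) -> g d' <= loss (INR n) sg ^ 3).
    { intros d' Hd' S.
      assert (Q1 := loss_ge_1 (INR n) (Rabs (Om (lead d') - Om (lead d))) ltac:(lra)).
      apply pow_incr. split; [lra|]. apply loss_mono; lra. }
    assert (Pw : (loss (INR n) sg ^ 3) ^ length D' <= L0).
    { rewrite <- pow_mult. apply Rle_pow; [exact Ls1|]. unfold n. lia. }
    assert (L3 : 1 <= loss (INR n) sg ^ 3) by (apply pow_R1_Rle, Ls1).
    exists (20 * rprod (map g D')).
    destruct (paired d) eqn:Ep.
    - destruct (D5 d Hd Ep) as (n' & P1 & P2 & P3 & P4).
      assert (R1 : 0 <= rprod (map g D') <= (loss (INR n) sg ^ 3) ^ length D').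
      { apply rprod_bound_all; [exact L3|]. intros d' Hd'. split; [apply (Hg d' Hd')|].
        apply Hg'; [exact Hd'|]. destruct (F3 d' Hd') as [F5 F6].
        apply (H3 (lead d) n' (lead d')); try assumption; try (apply D2; assumption).
        - apply not_eq_sym, P4, F5.
        - lra. }
      split; [lra|]. split; [exact F4|].
      unfold rel_err. rewrite Ep.
      assert (HNp := pos_INR (length l)).
      eapply Rle_trans; [|exact N1]. apply Rmult_le_compat_r; [lra|]. apply Rmult_le_compat_l; lra.
    - assert (R1 : 0 <= rprod (map g D') <= loss (INR n) th ^ 3 * (loss (INR n) sg ^ 3) ^ length D').
      { apply (rprod_bound_one g D' _ _ (fun d' => Rabs (Om (lead d') - Om (lead d)) < sg)); try assumption.
        - eapply NoDup_map_inv, F1.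
        - intros d' Hd' Hc. apply Hg'; [exact Hd'|lra].
        - intros d' d'' Hd' Hd'' C1 C2. destruct (F3 d' Hd') as [F5 F6]. destruct (F3 d'' Hd'') as [F7 F8].
          destruct (excluded_middle_informative (lead d' = lead d'')) as [El|Nl].
          + apply (NoDup_map_inj lead D'); assumption.
          + specialize (H3 (lead d) (lead d') (lead d'') (D2 d Hd) (D2 d' F5) (D2 d'' F7) F6 F8 Nl C1). lra. }
      split; [lra|]. split; [exact F4|].
      unfold rel_err. rewrite Ep.
      assert (HNp := pos_INR (length l)).
      eapply Rle_trans; [|exact N2]. apply Rmult_le_compat_r; [lra|]. apply Rmult_le_compat_l; [lra|].
      apply Rmult_le_compat_l; [lra|]. eapply Rle_trans; [apply R1|]. apply Rmult_le_compat_l; lra. }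
  assert (HNl : 1 <= INR (length l)) by (apply (le_INR 1), Hlen).
  assert (EB : E <= B).
  { assert (S : E <= INR (length D) * ((B + E) / (2 * INR (length l)))).
    { apply rsum_le_const. intros d Hd. destruct (HD d Hd) as (W & W0 & W1 & W2).
      apply (Rmult_le_reg_r (2 * INR (length l))); [lra|].
      replace ((B + E) / (2 * INR (length l)) * (2 * INR (length l))) with (B + E) by (field; lra).
      apply Rle_trans with (rel_err th e d * (W * (B + E)) * (2 * INR (length l))).
      - apply Rmult_le_compat_r; [lra|]. apply Rmult_le_compat_l; [apply Hrel|exact W1].
      - replace (rel_err th e d * (W * (B + E)) * (2 * INR (length l))) with ((rel_err th e d * W * (2 * INR (length l))) * (B + E)) by ring.
        assert (0 <= B + E) by lra. nra. }
    assert (LD : INR (length D) <= INR (length l)) by (apply le_INR, D3).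
    assert (S2 : INR (length D) * ((B + E) / (2 * INR (length l))) <= INR (length l) * ((B + E) / (2 * INR (length l)))).
    { apply Rmult_le_compat_r; [|exact LD]. apply Rmult_le_pos; [lra|]. left. apply Rinv_0_lt_compat. lra. }
    replace (INR (length l) * ((B + E) / (2 * INR (length l)))) with ((B + E) / 2) in S2 by (field; lra). lra. }
  assert (EQ1 : 1 <= exp Q) by (rewrite <- exp_0; apply exp_le_mono, HQ0).
  split.
  (* Off the real line the error carries the weight exp(Q |Im z|), comparable to the growth of the
     terms themselves, so passing between the two sums costs only factors exp(Q) on the unit disc
     and exp(20 Q) on the large one. *)
  - assert (HP1 : forall z, Cmod z <= 1 -> Cmod (csum (term Om z) D) <= 2 * exp Q * B).
    { intros z Hz. specialize (D4 z ltac:(lra)). fold E in D4. specialize (HfB z ltac:(lra)).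
      assert (I1 : exp (Q * Rabs (Im z)) <= exp Q).
      { apply exp_le_mono. assert (I := im_le_Cmod z). assert (I0 := Rabs_pos (Im z)). nra. }
      assert (I2 := exp_pos (Q * Rabs (Im z))).
      replace (csum (term Om z) D) with (chirps Om Be T b l z - (chirps Om Be T b l z - csum (term Om z) D))%C by ring.
      eapply Rle_trans; [apply Cmod_triangle_minus|].
      assert (exp (Q * Rabs (Im z)) * E <= exp Q * B) by (apply Rmult_le_compat; lra).
      assert (1 * B <= exp Q * B) by (apply Rmult_le_compat_r; lra). lra. }
    intros z Hz.
    assert (K := Kill_doubling _ _ n Q (2 * exp Q * B) (Kill_csum Om D) Hn1).
    rewrite (flat_map_constant_length (c := 3)) in K by reflexivity.
    specialize (K ltac:(unfold n; lia) HQ0).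
    assert (K2 : Cmod (csum (term Om z) D) <= 2 ^ (21 * n) * exp (21 * Q) * (2 * exp Q * B)).
    { apply K; try assumption.
      - intros a Ha. apply in_flat_map in Ha. destruct Ha as [d [Hd Ha]].
        assert (Ea : a = Om (lead d)) by (simpl in Ha; intuition congruence). rewrite Ea. apply HQ, D2, Hd.
      - apply Rmult_le_pos; lra. }
    specialize (D4 z Hz). fold E in D4.
    replace (chirps Om Be T b l z) with (csum (term Om z) D + (chirps Om Be T b l z - csum (term Om z) D))%C by ring.
    eapply Rle_trans; [apply Cmod_triangle|].
    assert (I1 : exp (Q * Rabs (Im z)) <= exp (22 * Q)).
    { apply exp_le_mono. assert (I := im_le_Cmod z). assert (I0 := Rabs_pos (Im z)). nra. }
    assert (I2 := exp_pos (Q * Rabs (Im z))).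
    assert (J : exp (Q * Rabs (Im z)) * E <= exp (22 * Q) * B) by (apply Rmult_le_compat; lra).
    replace (22 * Q) with (21 * Q + Q) in * by ring. rewrite exp_plus in *.
    rewrite pow_add. change (2 ^ 2) with (2 * (2 * 1)).
    assert (P2 : 1 <= 2 ^ (21 * n)) by (apply pow_R1_Rle; lra).
    assert (Z : 0 <= exp (21 * Q) * exp Q * B) by (apply Rmult_le_pos; [|exact HB]; rewrite <- exp_plus; left; apply exp_pos).
    set (Y := exp (21 * Q) * exp Q * B) in *. set (p := 2 ^ (21 * n)) in *.
    replace (p * exp (21 * Q) * (2 * exp Q * B)) with (2 * p * Y) in K2 by (unfold Y; ring).
    replace (p * (2 * (2 * 1)) * (exp (21 * Q) * exp Q) * B) with (4 * p * Y) by (unfold Y; ring).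
    nra.
  - intros B0 m Hm. apply D7; [|exact Hm]. intros d Hd. destruct (HD d Hd) as (W & W0 & W1 & W2).
    assert (P := nrm_ge_0 d). assert (BE : B + E = 0) by lra. rewrite BE in W1. lra.
Qed.

(** A uniform bound on duplicate-free lists makes the set finite: a list that cannot be extended
    contains every element. *)
Lemma list_of_bounded {A : Type} (P : A -> Prop) (n : nat) :
  (forall l, NoDup l -> (forall x, In x l -> P x) -> (length l <= n)%nat) ->
  exists l, (length l <= n)%nat /\ forall x, P x -> In x l.
Proof.
  intros H.
  assert (G : forall k l, (n - length l <= k)%nat -> NoDup l -> (forall x, In x l -> P x) ->
     exists l', (length l' <= n)%nat /\ forall x, P x -> In x l').
  { induction k as [|k IH]; intros l Hk Hl HP.
    - destruct (excluded_middle_informative (exists x, P x /\ ~ In x l)) as [[x [Hx Hn]]|Hno].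
      + assert (B := H (x :: l) ltac:(constructor; assumption) ltac:(intros y [<-|Hy]; auto)).
        assert (B' := H l Hl HP). simpl in B. lia.
      + exists l. split; [apply H; assumption|]. intros x Hx.
        destruct (excluded_middle_informative (In x l)); [assumption|]. elim Hno. exists x. split; assumption.
    - destruct (excluded_middle_informative (exists x, P x /\ ~ In x l)) as [[x [Hx Hn]]|Hno].
      + apply (IH (x :: l)); [simpl; lia|constructor; assumption|intros y [<-|Hy]; auto].
      + exists l. split; [apply H; assumption|]. intros x Hx.
        destruct (excluded_middle_informative (In x l)); [assumption|]. elim Hno. exists x. split; assumption. }
  apply (G n nil); [simpl; lia|constructor|]. intros x [].
Qed.

(* If there were too many zeros, any bound on the disc of radius 2 could be halved, so the
   function would vanish there. *)
Lemma doubling_zeros (f : C -> C) (K M : R) (l : list C) : hol f 0 21 ->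
  (forall z, Cmod z <= 20 -> Cmod (f z) <= M) ->
  (forall B, 0 <= B -> (forall z, Cmod z <= 2 -> Cmod (f z) <= B) -> forall z, Cmod z <= 20 -> Cmod (f z) <= K * B) ->
  (exists z, Cmod z <= 2 /\ f z <> 0) ->
  NoDup l -> (forall a, In a l -> Cmod a < 1 /\ f a = 0) -> 3 ^ length l <= 12 * K.
Proof.
  intros Hf HM HK [z0 [Hz0 Hn]] Hl Hz. apply Rnot_lt_le. intros Hlt.
  assert (M0 : 0 <= M) by (eapply Rle_trans; [apply Cmod_ge_0|apply (HM z0); lra]).
  assert (P3 : 0 < 3 ^ length l) by (apply pow_lt; lra).
  assert (G : forall k z, Cmod z <= 2 -> Cmod (f z) <= M * (/ 2) ^ k).
  { induction k as [|k IH]; intros z Hz'; [simpl; rewrite Rmult_1_r; apply HM; lra|].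
    assert (p : 0 < (/ 2) ^ k) by (apply pow_lt; lra).
    assert (B0 : 0 <= M * (/ 2) ^ k) by (apply Rmult_le_pos; lra).
    assert (Z := zeros_bound f _ l Hf (HK _ B0 IH) Hl Hz z Hz').
    apply (Rmult_le_reg_r (3 ^ length l)); [exact P3|]. eapply Rle_trans; [exact Z|].
    simpl. nra. }
  apply Hn. apply Cmod_eq_0. apply Rle_antisym; [|apply Cmod_ge_0].
  apply Rnot_lt_le. intros Hpos. destruct (pow_half_small M (Cmod (f z0)) Hpos) as [k Hk].
  specialize (G k z0 Hz0). lra.
Qed.

(** * The curve *)

(** Derivative by choice, meaningful only at points of differentiability, where [cderiv_unique]
    identifies it. *)
Definition cder (f : C -> C) (z : C) : C := epsilon (inhabits (RtoC 0)) (cderiv f z).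

Lemma cder_spec (f : C -> C) (z : C) : (exists d, cderiv f z d) -> cderiv f z (cder f z).
Proof. apply epsilon_spec. Qed.

Lemma nbhd01_ball (eps : R) (z : C) : nbhd01 eps z ->
  exists r, 0 < r /\ forall w, Cmod (w - z) < r -> nbhd01 eps w.
Proof.
  intros [t [Ht H]]. exists (eps - Cmod (z - RtoC t)). split; [lra|].
  intros w Hw. exists t. split; [exact Ht|].
  assert (T := Cmod_triangle (w - z) (z - RtoC t)). replace (w - z + (z - RtoC t))%C with (w - RtoC t)%C in T by ring. lra.
Qed.

Lemma cderiv_cder (f : C -> C) (eps : R) : (forall z, nbhd01 eps z -> exists d, cderiv f z d) ->
  forall z, nbhd01 eps z -> exists d, cderiv (cder f) z d.
Proof.
  intros Hf z Hz. destruct (nbhd01_ball eps z Hz) as (r & Hr & Hball).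
  destruct (hol_locally_bounded f z r Hr (fun w Hw => Hf w (Hball w Hw))) as (s & M & Hs & HM).
  destruct (taylor3_deriv f (cder f) z (s / 3) s M) as (c2 & D & _); try lra; [|exact HM|].
  - intros w Hw. apply cder_spec, Hf, Hball. lra.
  - exists (2 * c2)%C. exact D.
Qed.

Lemma is_derive_rtrace (G : C -> C) (t : R) (d : C) : cderiv G (RtoC t) d -> is_derive (rtrace G) t (Re d).
Proof.
  intros H. split; [apply is_linear_scal_l|].
  intros x Hx. apply (is_filter_lim_locally_unique (V := AbsRing_NormedModule R_AbsRing) t x) in Hx. subst x.
  intros e. destruct (H e (cond_pos e)) as [del [Hd Hdel]].
  exists (mkposreal del Hd). intros s Hs. assert (Hs' : Rabs (s - t) < del) by exact Hs.
  assert (Es : (RtoC s - RtoC t)%C = RtoC (s - t)) by (rewrite RtoC_minus; reflexivity).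
  specialize (Hdel (RtoC s)). rewrite Es, Cmod_R in Hdel. specialize (Hdel Hs').
  assert (R1 := Rle_trans _ _ _ (re_le_Cmod _) Hdel).
  unfold norm, minus, plus, opp, scal, rtrace; simpl. unfold abs, mult; simpl.
  replace (Re (G (RtoC s)) + - Re (G (RtoC t)) + - ((s + - t) * Re d))
    with (Re (G (RtoC s) - G (RtoC t) - d * RtoC (s - t))); [exact R1|].
  unfold Re. simpl. ring.
Qed.

Lemma nbhd01_real (eps t : R) : 0 < eps -> 0 <= t <= 1 -> nbhd01 eps (RtoC t).
Proof.
  intros He Ht. exists t. split; [exact Ht|]. replace (RtoC t - RtoC t)%C with (RtoC 0) by ring.
  rewrite Cmod_0. exact He.
Qed.

(** At the endpoints the two-sided real derivative looks outside [0,1], where [G] need not be real;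
    the real part commutes with differentiation along the real axis all the same. *)
Lemma Derive_rtrace (G : C -> C) (eps : R) : 0 < eps -> (forall z, nbhd01 eps z -> exists d, cderiv G z d) ->
  forall t, 0 <= t <= 1 ->
  Derive (rtrace G) t = Re (cder G (RtoC t)) /\ Derive_n (rtrace G) 2 t = Re (cder (cder G) (RtoC t)).
Proof.
  intros He HG t Ht.
  assert (Hz := nbhd01_real eps t He Ht).
  assert (D1 : forall s, nbhd01 eps (RtoC s) -> Derive (rtrace G) s = Re (cder G (RtoC s))).
  { intros s Hs. apply is_derive_unique, is_derive_rtrace, cder_spec, HG, Hs. }
  split; [apply D1, Hz|].
  change (Derive_n (rtrace G) 2 t) with (Derive (Derive (rtrace G)) t).
  destruct (nbhd01_ball eps _ Hz) as (r & Hr & Hball).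
  rewrite (Derive_ext_loc _ (rtrace (cder G))).
  - apply is_derive_unique, is_derive_rtrace, cder_spec. apply (cderiv_cder G eps HG), Hz.
  - exists (mkposreal r Hr). intros s Hs. apply D1, Hball. rewrite <- RtoC_minus, Cmod_R. exact Hs.
Qed.

Lemma ccont_continuity_re (f : C -> C) (t : R) : ccont f (RtoC t) -> continuity_pt (fun s => Re (f (RtoC s))) t.
Proof.
  intros H. apply continuity_pt_filterlim. apply (ccont_continuous_line f RtoC t); [|exact H].
  intros s u. rewrite <- RtoC_minus, Cmod_R. lra.
Qed.

(** One positive number serves as radius and as inverse of the bound, so that a single gauge on
    [0,1] can be fed to the covering lemma. The radius is doubled locally to make room for passing
    from t to the tag u. *)
Lemma uniform_bound (G : C -> C) (eps : R) : 0 < eps -> (forall z, nbhd01 eps z -> exists d, cderiv G z d) ->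
  exists d, 0 < d /\ forall t w, 0 <= t <= 1 -> Cmod (w - RtoC t) < d -> Cmod (G w) <= / d.
Proof.
  intros He HG.
  assert (L : forall t, exists del : posreal, 0 <= t <= 1 -> forall w, Cmod (w - RtoC t) < 2 * del -> Cmod (G w) <= / del).
  { intros t. destruct (excluded_middle_informative (0 <= t <= 1)) as [Ht|Ht]; [|exists (mkposreal 1 Rlt_0_1); tauto].
    destruct (HG _ (nbhd01_real eps t He Ht)) as [d Hd].
    destruct (cderiv_ccont G _ d Hd 1 Rlt_0_1) as [del [Hdel Hc]].
    set (k := Cmod (G (RtoC t)) + 1).
    assert (Hk : 0 < k) by (unfold k; assert (H := Cmod_ge_0 (G (RtoC t))); lra).
    assert (Hp : 0 < Rmin (del / 2) (/ k)) by (apply Rmin_glb_lt; [lra|apply Rinv_0_lt_compat, Hk]).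
    exists (mkposreal _ Hp). intros _ w Hw. simpl in *.
    assert (M1 := Rmin_l (del / 2) (/ k)). assert (M2 := Rmin_r (del / 2) (/ k)).
    specialize (Hc w ltac:(lra)).
    apply Rle_trans with k.
    - unfold k. assert (T := Cmod_triangle_inv (G w) (G (RtoC t))). lra.
    - rewrite <- (Rinv_inv k) at 1. apply Rinv_le_contravar; assumption. }
  destruct (choice _ L) as [del Hdel].
  destruct (compactness_value_1d 0 1 del) as [d Hd].
  exists d. split; [apply cond_pos|]. intros t w Ht Hw.
  destruct (excluded_middle_informative (exists u : R, 0 <= u <= 1 /\ Rabs (t - u) < del u /\ d <= del u)) as [[u (Hu & H1 & H2)]|N];
    [|elim (Hd t Ht N)].
  eapply Rle_trans; [apply (Hdel u Hu w)|apply Rinv_le_contravar; [apply cond_pos|exact H2]].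
  assert (T := Cmod_triangle (w - RtoC t) (RtoC t - RtoC u)).
  replace (w - RtoC t + (RtoC t - RtoC u))%C with (w - RtoC u)%C in T by ring.
  rewrite <- RtoC_minus, Cmod_R in T. lra.
Qed.

Lemma small_poly_zero (p q K t0 : R) : 0 < t0 -> (forall t, 0 < t <= t0 -> Rabs (p * t + q * (t * t)) <= K * (t * t * t)) ->
  p = 0 /\ q = 0.
Proof.
  intros Ht0 H.
  assert (K0 : 0 <= K).
  { specialize (H t0 ltac:(lra)). assert (P := Rabs_pos (p * t0 + q * (t0 * t0))).
    assert (0 < t0 * t0 * t0) by (repeat apply Rmult_lt_0_compat; lra). nra. }
  assert (Hp : p = 0).
  { apply Rabs_eq_0. apply Rle_antisym; [|apply Rabs_pos]. apply Rnot_lt_le. intros Hpos.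
    set (c := Rabs q + K * t0 + 1).
    assert (Hc : 1 <= c) by (unfold c; assert (HQ := Rabs_pos q); assert (0 <= K * t0) by (apply Rmult_le_pos; lra); lra).
    set (t := Rmin t0 (Rabs p / (2 * c))).
    assert (Ht : 0 < t) by (apply Rmin_glb_lt; [lra|apply Rdiv_lt_0_compat; lra]).
    assert (T1 : t <= t0) by apply Rmin_l.
    assert (T2 : t * (2 * c) <= Rabs p).
    { apply Rle_trans with (Rabs p / (2 * c) * (2 * c)); [apply Rmult_le_compat_r; [lra|apply Rmin_r]|right; field; lra]. }
    specialize (H t ltac:(lra)).
    assert (A : Rabs p * t <= Rabs q * (t * t) + K * (t * t * t)).
    { replace (Rabs p * t) with (Rabs (p * t)) by (rewrite Rabs_mult, (Rabs_right t); lra).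
      replace (p * t) with ((p * t + q * (t * t)) + - (q * (t * t))) by ring.
      eapply Rle_trans; [apply Rabs_triang|]. rewrite Rabs_Ropp, (Rabs_mult q), (Rabs_right (t * t)) by nra. lra. }
    assert (B : Rabs p <= Rabs q * t + K * (t * t)) by (apply (Rmult_le_reg_r t); [exact Ht|nra]).
    assert (K * (t * t) <= K * t0 * t) by (replace (K * (t * t)) with (K * t * t) by ring; apply Rmult_le_compat_r; [lra|]; apply Rmult_le_compat_l; lra).
    unfold c in T2. nra. }
  split; [exact Hp|]. subst p.
  apply Rabs_eq_0. apply Rle_antisym; [|apply Rabs_pos]. apply Rnot_lt_le. intros Hpos.
  set (t := Rmin t0 (Rabs q / (2 * (K + 1)))).
  assert (Ht : 0 < t) by (apply Rmin_glb_lt; [lra|apply Rdiv_lt_0_compat; lra]).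
  assert (T1 : t <= t0) by apply Rmin_l.
  assert (T2 : t * (2 * (K + 1)) <= Rabs q).
  { apply Rle_trans with (Rabs q / (2 * (K + 1)) * (2 * (K + 1))); [apply Rmult_le_compat_r; [lra|apply Rmin_r]|right; field; lra]. }
  specialize (H t ltac:(lra)). rewrite Rmult_0_l, Rplus_0_l, Rabs_mult, (Rabs_right (t * t)) in H by nra.
  assert (B : Rabs q <= K * t) by (apply (Rmult_le_reg_r (t * t)); nra). nra.
Qed.

Lemma real_taylor_coeffs (G : C -> C) (a h K : R) (c1 c2 : C) : 0 <= a <= 1 -> 0 < h ->
  (forall t, 0 <= t <= 1 -> Im (G (RtoC t)) = 0) ->
  (forall u, Cmod u <= h -> Cmod (G (RtoC a + u)%C - (G (RtoC a) + c1 * u + c2 * (u * u))) <= K * Cmod u ^ 3) ->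
  Im c1 = 0 /\ Im c2 = 0.
Proof.
  intros Ha Hh Hr HT.
  (* Direction from [a] into [0,1]: realness is available only inside the interval, and for an
     endpoint only on one side. *)
  set (sg := if Rle_dec a (1 / 2) then 1 else -1).
  assert (Hs : Rabs sg = 1) by (unfold sg; destruct Rle_dec; [apply Rabs_R1|rewrite Rabs_left; lra]).
  assert (Hs2 : sg * sg = 1) by (unfold sg; destruct Rle_dec; lra).
  destruct (small_poly_zero (Im c1 * sg) (Im c2) K (Rmin h (1 / 2))) as [E1 E2].
  - apply Rmin_glb_lt; lra.
  - intros t Ht. assert (M1 := Rmin_l h (1 / 2)). assert (M2 := Rmin_r h (1 / 2)).
    assert (Mu : Cmod (RtoC (sg * t)) = t) by (rewrite Cmod_R, Rabs_mult, Hs, (Rabs_right t); lra).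
    specialize (HT (RtoC (sg * t)) ltac:(lra)). rewrite Mu in HT.
    rewrite <- RtoC_plus in HT.
    assert (R1 := Rle_trans _ _ _ (im_le_Cmod _) HT).
    assert (Z1 : Im (G (RtoC (a + sg * t))) = 0) by (apply Hr; unfold sg; destruct Rle_dec; lra).
    assert (Z0 := Hr a Ha).
    replace (Im (G (RtoC (a + sg * t)) - (G (RtoC a) + c1 * RtoC (sg * t) + c2 * (RtoC (sg * t) * RtoC (sg * t)))))
      with (- (Im c1 * sg * t + Im c2 * (t * t))) in R1.
    + rewrite Rabs_Ropp in R1. eapply Rle_trans; [exact R1|]. right. ring.
    + unfold Im in *. simpl. rewrite Z1, Z0.
      replace (snd c2 * (t * t)) with (snd c2 * (t * t) * (sg * sg)) by (rewrite Hs2; ring). ring.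
  - split; [|exact E2]. assert (S0 : sg <> 0) by (intros E; rewrite E in Hs2; lra).
    apply Rmult_integral in E1. tauto.
Qed.

(** Compactness of [0,1] makes the Taylor bounds and the lower bound for the curvature uniform in
    the point [a]; this is where the independence of the implied constants of m and of the
    eigenfunction originates. *)
Theorem curve_constants (G1 G2 : C -> C) (eps : R) :
  0 < eps ->
  (forall z, nbhd01 eps z -> exists d, cderiv G1 z d) ->
  (forall z, nbhd01 eps z -> exists d, cderiv G2 z d) ->
  (forall t, 0 <= t <= 1 -> Im (G1 (RtoC t)) = 0 /\ Im (G2 (RtoC t)) = 0) ->
  (forall t, 0 <= t <= 1 -> Derive (rtrace G1) t ^ 2 + Derive (rtrace G2) t ^ 2 = 1) ->
  (forall t, 0 <= t <= 1 ->
     Derive (rtrace G1) t * Derive_n (rtrace G2) 2 t - Derive (rtrace G2) t * Derive_n (rtrace G1) 2 t <> 0) ->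
  exists rho K c, 0 < rho <= 1 /\ rho <= eps /\ 1 <= K /\ 0 < c /\
  forall a, 0 <= a <= 1 -> exists p1 p2 q1 q2 : R,
    p1 ^ 2 + p2 ^ 2 = 1 /\ Rabs q1 <= K /\ Rabs q2 <= K /\ c <= Rabs (p1 * q2 - p2 * q1) /\
    (forall u, Cmod u <= rho ->
      Cmod (G1 (RtoC a + u)%C - (G1 (RtoC a) + RtoC p1 * u + RtoC q1 * (u * u))) <= K * Cmod u ^ 3) /\
    (forall u, Cmod u <= rho ->
      Cmod (G2 (RtoC a + u)%C - (G2 (RtoC a) + RtoC p2 * u + RtoC q2 * (u * u))) <= K * Cmod u ^ 3).
Proof.
  intros He H1 H2 Hr Harc Hcurv.
  destruct (uniform_bound G1 eps He H1) as (d1 & Hd1 & B1).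
  destruct (uniform_bound G2 eps He H2) as (d2 & Hd2 & B2).
  set (r := Rmin (Rmin d1 d2) (Rmin eps 1)).
  assert (Hr4 : 0 < r /\ r <= d1 /\ r <= d2 /\ r <= eps /\ r <= 1).
  { unfold r. assert (M1 := Rmin_l (Rmin d1 d2) (Rmin eps 1)). assert (M2 := Rmin_r (Rmin d1 d2) (Rmin eps 1)).
    assert (M3 := Rmin_l d1 d2). assert (M4 := Rmin_r d1 d2). assert (M5 := Rmin_l eps 1). assert (M6 := Rmin_r eps 1).
    repeat split; try lra. repeat apply Rmin_glb_lt; lra. }
  destruct Hr4 as (Hr0 & R1 & R2 & R3 & R4).
  set (M := / r).
  assert (HM : 1 <= M) by (unfold M; rewrite <- Rinv_1; apply Rinv_le_contravar; lra).
  set (h := r / 3).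
  set (K := Rmax (3 * M / h ^ 2) (6 * M / h ^ 3)).
  assert (Hh : 0 < h <= 1 / 3) by (unfold h; lra).
  set (det := fun t => Re (cder G1 (RtoC t)) * Re (cder (cder G2) (RtoC t)) - Re (cder G2 (RtoC t)) * Re (cder (cder G1) (RtoC t))).
  assert (Cn : forall f, (forall z, nbhd01 eps z -> exists d, cderiv f z d) ->
     forall t, 0 <= t <= 1 -> continuity_pt (fun s => Re (f (RtoC s))) t).
  { intros f Hf t Ht. apply ccont_continuity_re. destruct (Hf _ (nbhd01_real eps t He Ht)) as [d Hd]. eapply cderiv_ccont, Hd. }
  assert (Cdet : forall t, 0 <= t <= 1 -> continuity_pt (fun s => Rabs (det s)) t).
  { intros t Ht. apply (continuity_pt_comp det Rabs); [|apply Rcontinuity_abs].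
    assert (C1 := cderiv_cder G1 eps H1). assert (C2 := cderiv_cder G2 eps H2).
    unfold det.
    apply (continuity_pt_minus (fun t => Re (cder G1 (RtoC t)) * Re (cder (cder G2) (RtoC t))) (fun t => Re (cder G2 (RtoC t)) * Re (cder (cder G1) (RtoC t)))).
    - apply (continuity_pt_mult (fun t => Re (cder G1 (RtoC t))) (fun t => Re (cder (cder G2) (RtoC t)))).
      + apply (Cn _ C1 t Ht).
      + apply (Cn _ (cderiv_cder _ eps C2) t Ht).
    - apply (continuity_pt_mult (fun t => Re (cder G2 (RtoC t))) (fun t => Re (cder (cder G1) (RtoC t)))).
      + apply (Cn _ C2 t Ht).
      + apply (Cn _ (cderiv_cder _ eps C1) t Ht). }
  destruct (continuity_ab_min (fun s => Rabs (det s)) 0 1 Rle_0_1 Cdet) as (tm & Hmin & Htm).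
  assert (Hdet0 : 0 < Rabs (det tm)).
  { apply Rabs_pos_lt. unfold det.
    destruct (Derive_rtrace G1 eps He H1 tm Htm) as [<- <-]. destruct (Derive_rtrace G2 eps He H2 tm Htm) as [<- <-].
    apply Hcurv, Htm. }
  (* The Taylor coefficients q1, q2 are half the second derivatives, so half the minimum of |det| is
     the right bound. *)
  exists (h / 2), K, (Rabs (det tm) / 2).
  assert (KB : 3 * M / h ^ 2 <= K /\ 6 * M / h ^ 3 <= K) by (split; [apply Rmax_l|apply Rmax_r]).
  assert (HK1 : 1 <= K).
  { eapply Rle_trans; [|apply (proj1 KB)]. assert (h2 : 0 < h ^ 2) by (apply pow_lt; lra).
    assert (h2' : h ^ 2 <= 1) by (simpl; nra).
    clear -HM h2 h2'. revert h2 h2' HM. clearbody M. generalize (h ^ 2). intros y Hy Hy' Hx.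
    apply (Rmult_le_reg_r y); [exact Hy|]. replace (3 * M / y * y) with (3 * M) by (field; lra). lra. }
  split; [lra|]. split; [unfold h; lra|]. split; [exact HK1|]. split; [lra|].
  intros a Ha.
  assert (T : forall G, (forall z, nbhd01 eps z -> exists d, cderiv G z d) ->
    (forall t w, 0 <= t <= 1 -> Cmod (w - RtoC t) < r -> Cmod (G w) <= M) ->
    (forall t, 0 <= t <= 1 -> Im (G (RtoC t)) = 0) ->
    exists p q, p = Re (cder G (RtoC a)) /\ 2 * q = Re (cder (cder G) (RtoC a)) /\ Rabs q <= K /\
     forall u, Cmod u <= h / 2 -> Cmod (G (RtoC a + u)%C - (G (RtoC a) + RtoC p * u + RtoC q * (u * u))) <= K * Cmod u ^ 3).
  { intros G HG HB HR.
    destruct (taylor3_deriv G (cder G) (RtoC a) h r M) as (c2 & D2 & _ & Bc & HT); [lra|unfold h; lra| | |].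
    - intros w Hw. apply cder_spec, HG. exists a. split; [exact Ha|]. lra.
    - intros w Hw. apply (HB a w Ha Hw).
    - destruct (real_taylor_coeffs G a (h / 2) (6 * M / h ^ 3) (cder G (RtoC a)) c2 Ha ltac:(lra) HR HT) as [I1 I2].
      exists (Re (cder G (RtoC a))), (Re c2).
      assert (Ec : cder (cder G) (RtoC a) = (2 * c2)%C).
      { apply (cderiv_unique (cder G) (RtoC a)); [|exact D2]. apply cder_spec. eexists; exact D2. }
      split; [reflexivity|]. split; [rewrite Ec; unfold Re; simpl; ring|]. split.
      + eapply Rle_trans; [apply re_le_Cmod|]. lra.
      + intros u Hu. assert (E1 : RtoC (Re (cder G (RtoC a))) = cder G (RtoC a)) by (apply injective_projections; simpl; [reflexivity|symmetry; exact I1]).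
        assert (E2 : RtoC (Re c2) = c2) by (apply injective_projections; simpl; [reflexivity|symmetry; exact I2]).
        rewrite E1, E2. eapply Rle_trans; [apply HT, Hu|]. apply Rmult_le_compat_r; [apply pow_le, Cmod_ge_0|apply (proj2 KB)]. }
  destruct (T G1 H1) as (p1 & q1 & P1 & Q1 & A1 & T1).
  { intros t w Ht Hw. eapply Rle_trans; [apply (B1 t w Ht); lra|]. apply Rinv_le_contravar; lra. }
  { intros t Ht. apply (Hr t Ht). }
  destruct (T G2 H2) as (p2 & q2 & P2 & Q2 & A2 & T2).
  { intros t w Ht Hw. eapply Rle_trans; [apply (B2 t w Ht); lra|]. apply Rinv_le_contravar; lra. }
  { intros t Ht. apply (Hr t Ht). }
  exists p1, p2, q1, q2.
  destruct (Derive_rtrace G1 eps He H1 a Ha) as [E1 _]. destruct (Derive_rtrace G2 eps He H2 a Ha) as [E2 _].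
  split; [|split; [exact A1|split; [exact A2|split; [|split; assumption]]]].
  - rewrite P1, P2, <- E1, <- E2. apply Harc, Ha.
  - specialize (Hmin a Ha). simpl in Hmin. unfold det at 2 in Hmin. rewrite <- P1, <- P2, <- Q1, <- Q2 in Hmin.
    replace (p1 * (2 * q2) - p2 * (2 * q1)) with (2 * (p1 * q2 - p2 * q1)) in Hmin by ring.
    rewrite (Rabs_mult 2), (Rabs_right 2) in Hmin by lra. lra.
Qed.

(** * Choice of parameters *)

(** The rate 1/1000 fixes the unit in which all powers of m are later measured; it only has to be
    small compared with the exponent 1/2 of m in lambda. *)
Lemma exp_dominates (c : R) (k : nat) : exists u0, 1 <= u0 /\ forall u, u0 <= u -> c * u ^ k <= exp (u / 1000).
Proof.
  set (n := S k). set (q := 1000 * INR n).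
  assert (Hn : 1 <= INR n) by (apply (le_INR 1); unfold n; lia).
  assert (Hq : 0 < q) by (unfold q; lra).
  exists (Rmax 1 (c * q ^ n)). split; [apply Rmax_l|]. intros u Hu.
  assert (U1 : 1 <= u) by (eapply Rle_trans; [apply Rmax_l|exact Hu]).
  assert (U2 : c * q ^ n <= u) by (eapply Rle_trans; [apply Rmax_r|exact Hu]).
  assert (E : exp (u / 1000) = exp (u / q) ^ n) by (rewrite exp_pow; f_equal; unfold q; field; lra).
  rewrite E. apply Rle_trans with ((u / q) ^ n).
  - assert (P : 0 < q ^ n) by (apply pow_lt, Hq).
    unfold Rdiv. rewrite Rpow_mult_distr, pow_inv. apply (Rmult_le_reg_r (q ^ n)); [exact P|].
    replace (u ^ n * / q ^ n * q ^ n) with (u * u ^ k) by (change (u * u ^ k) with (u ^ n); field; lra).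
    replace (c * u ^ k * q ^ n) with (c * q ^ n * u ^ k) by ring.
    apply Rmult_le_compat_r; [apply pow_le; lra|exact U2].
  - apply pow_incr. split; [apply Rmult_le_pos; [lra|left; apply Rinv_0_lt_compat, Hq]|].
    assert (H := exp_ineq1_le (u / q)). lra.
Qed.

Lemma pow_le_reg (a b : R) (n : nat) : 0 <= a -> 0 <= b -> (0 < n)%nat -> a ^ n <= b ^ n -> a <= b.
Proof.
  intros Ha Hb Hn H. apply Rnot_lt_le. intros Hlt.
  assert (G : forall k, (0 < k)%nat -> b ^ k < a ^ k).
  { induction k as [|k IH]; [lia|]. intros _. destruct k as [|k]; [simpl; lra|].
    assert (IH' := IH ltac:(lia)). change (b * b ^ S k < a * a ^ S k).
    assert (0 <= b ^ S k) by (apply pow_le, Hb). nra. }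
  specialize (G n Hn). lra.
Qed.

Lemma two_le_exp1 : 2 <= exp 1.
Proof. assert (H := exp_ineq1_le 1). lra. Qed.

Lemma loss_power : exists L0, 1 <= L0 /\ forall L (N : nat), L0 <= L -> (1 <= N)%nat ->
  loss (INR (3 * N)) (INR N ^ 7 / (8 * L ^ 5)) ^ (3 * N) <= exp (L / 1000).
Proof.
  (* In the expensive case one [loss] is at most exp(8 + 5u)^3 with u = ln L. Raised to the power 3N
     this must not exceed exp(L/1000), that is 9000 N (8 + 5u) <= L. Comparing sixth powers, with
     N^6 < 144 L^5 and 8 + 5u <= 13u, leaves the stated power of u against L = e^u. *)
  destruct (exp_dominates (9000 ^ 6 * 144 * 13 ^ 6) 6) as (u0 & Hu0 & Hu).
  destruct (exp_dominates 9 0) as (w0 & Hw0 & Hw).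
  exists (Rmax w0 (exp u0)). split; [eapply Rle_trans; [exact Hw0|apply Rmax_l]|].
  intros L N HL HN.
  assert (L1 : w0 <= L) by (eapply Rle_trans; [apply Rmax_l|exact HL]).
  assert (L2 : exp u0 <= L) by (eapply Rle_trans; [apply Rmax_r|exact HL]).
  assert (Lp : 1 <= L) by lra.
  assert (L5 : 1 <= L ^ 5) by (apply pow_R1_Rle, Lp).
  assert (HN1 : 1 <= INR N) by (apply (le_INR 1), HN).
  assert (N6 : 1 <= INR N ^ 6) by (apply pow_R1_Rle, HN1).
  assert (N7 : 1 <= INR N ^ 7) by (apply pow_R1_Rle, HN1).
  assert (H3N : INR (3 * N) = 3 * INR N) by (rewrite mult_INR; simpl; ring).
  unfold loss. rewrite H3N.
  replace (6 * (3 * INR N) / (INR N ^ 7 / (8 * L ^ 5))) with (144 * L ^ 5 / INR N ^ 6) by (field; lra).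
  replace (6 / (INR N ^ 7 / (8 * L ^ 5))) with (48 * L ^ 5 / INR N ^ 7) by (field; lra).
  (* The threshold at which 6n/d <= 1 for n = 3N and d = [sg], since 144 = 6 * 3 * 8. Past it the
     remaining factor is at most (1 + 1/n)^2, whose n-th power is bounded. *)
  destruct (Rle_dec (144 * L ^ 5) (INR N ^ 6)) as [HA|HB].
  - assert (A1 : 144 * L ^ 5 / INR N ^ 6 <= 1).
    { apply (Rmult_le_reg_r (INR N ^ 6)); [lra|]. unfold Rdiv. rewrite Rmult_assoc, Rinv_l by lra. lra. }
    rewrite Rmax_left, Rmult_1_l by exact A1.
    assert (A2 : 0 <= 48 * L ^ 5 / INR N ^ 7 <= / (3 * INR N)).
    { split; [apply Rmult_le_pos; [lra|left; apply Rinv_0_lt_compat; lra]|].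
      apply (Rmult_le_reg_r (3 * INR N ^ 7)); [lra|].
      replace (48 * L ^ 5 / INR N ^ 7 * (3 * INR N ^ 7)) with (144 * L ^ 5) by (field; lra).
      replace (/ (3 * INR N) * (3 * INR N ^ 7)) with (INR N ^ 6) by (field; lra). exact HA. }
    rewrite <- pow_mult, Nat.mul_comm, pow_mult.
    assert (A3 : (1 + 48 * L ^ 5 / INR N ^ 7) ^ (3 * N) <= 3).
    { apply Rle_trans with (exp (/ (3 * INR N)) ^ (3 * N)).
      - apply pow_incr. split; [lra|]. assert (I := exp_ineq1_le (/ (3 * INR N))). lra.
      - rewrite exp_pow, H3N. replace (3 * INR N * / (3 * INR N)) with 1 by (field; lra). apply exp_le_3. }
    specialize (Hw L L1). simpl in Hw.
    assert (A4 : 0 <= (1 + 48 * L ^ 5 / INR N ^ 7) ^ (3 * N)) by (apply pow_le; lra).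
    apply Rle_trans with (3 ^ 2); [apply pow_incr; lra|]. lra.
  - apply Rnot_le_lt in HB.
    set (u := ln L).
    assert (EL : exp u = L) by (apply exp_ln; lra).
    assert (Uu : u0 <= u) by (unfold u; rewrite <- (ln_exp u0); destruct L2 as [L2|L2];
      [left; apply ln_increasing; [apply exp_pos|exact L2]|right; f_equal; exact L2]).
    specialize (Hu u Uu).
    assert (B1 : (Rmax 1 (144 * L ^ 5 / INR N ^ 6) * (1 + 48 * L ^ 5 / INR N ^ 7) ^ 2) <= exp (8 + 5 * u) ^ 3).
    { assert (C0 : 200 * L ^ 5 <= exp (8 + 5 * u)).
      { rewrite exp_plus. replace (exp (5 * u)) with (L ^ 5) by (rewrite <- EL, exp_pow; f_equal; simpl; ring).
        apply Rmult_le_compat_r; [lra|].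
        replace 8 with (INR 8 * 1) by (simpl; ring). rewrite <- exp_pow.
        apply Rle_trans with (2 ^ 8); [lra|]. apply pow_incr. split; [lra|apply two_le_exp1]. }
      assert (C1 : Rmax 1 (144 * L ^ 5 / INR N ^ 6) <= 200 * L ^ 5).
      { apply Rmax_lub; [lra|]. apply (Rmult_le_reg_r (INR N ^ 6)); [lra|].
        replace (144 * L ^ 5 / INR N ^ 6 * INR N ^ 6) with (144 * L ^ 5) by (field; lra). nra. }
      assert (C2 : 0 <= 48 * L ^ 5 / INR N ^ 7 <= 48 * L ^ 5).
      { split; [apply Rmult_le_pos; [lra|left; apply Rinv_0_lt_compat; lra]|].
        apply (Rmult_le_reg_r (INR N ^ 7)); [lra|].
        replace (48 * L ^ 5 / INR N ^ 7 * INR N ^ 7) with (48 * L ^ 5) by (field; lra). nra. }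
      apply Rle_trans with (200 * L ^ 5 * (200 * L ^ 5) ^ 2).
      - apply Rmult_le_compat; [|apply pow2_ge_0|exact C1|apply pow_incr; lra].
        eapply Rle_trans; [|apply Rmax_l]. lra.
      - change (exp (8 + 5 * u) ^ 3) with (exp (8 + 5 * u) * exp (8 + 5 * u) ^ 2).
        apply Rmult_le_compat; [lra|apply pow2_ge_0|exact C0|apply pow_incr; lra]. }
    assert (B0 : 0 <= Rmax 1 (144 * L ^ 5 / INR N ^ 6) * (1 + 48 * L ^ 5 / INR N ^ 7) ^ 2).
    { apply Rmult_le_pos; [eapply Rle_trans; [|apply Rmax_l]; lra|apply pow2_ge_0]. }
    eapply Rle_trans; [apply pow_incr; split; [exact B0|exact B1]|].
    rewrite <- pow_mult, exp_pow. apply exp_le_mono.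
    rewrite mult_INR, H3N. change (INR 3) with (1 + 1 + 1).
    assert (Up : 0 <= 8 + 5 * u <= 13 * u) by lra.
    assert (F : 9000 * INR N * (8 + 5 * u) <= L).
    { apply (pow_le_reg _ _ 6); [repeat apply Rmult_le_pos; lra|lra|lia|].
      rewrite !Rpow_mult_distr.
      assert (G1 : (8 + 5 * u) ^ 6 <= 13 ^ 6 * u ^ 6) by (rewrite <- Rpow_mult_distr; apply pow_incr; exact Up).
      assert (G2 : exp (u / 1000) <= L) by (rewrite <- EL; apply exp_le_mono; lra).
      assert (G0 : 0 <= (8 + 5 * u) ^ 6) by (apply pow_le; lra).
      apply Rle_trans with (9000 ^ 6 * (144 * L ^ 5) * (13 ^ 6 * u ^ 6)).
      - apply Rmult_le_compat; [apply Rmult_le_pos; lra|exact G0| |exact G1].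
        apply Rmult_le_compat_l; lra.
      - replace (9000 ^ 6 * (144 * L ^ 5) * (13 ^ 6 * u ^ 6)) with (L ^ 5 * (9000 ^ 6 * 144 * 13 ^ 6 * u ^ 6)) by ring.
        replace (L ^ 6) with (L ^ 5 * L) by ring. apply Rmult_le_compat_l; lra. }
    lra.
Qed.

(** Everything is measured in powers of [la] = exp(L/1000) and its inverse [y]: lambda is at least
    la^500, [L0] is at most la, and every power of L or N that occurs is also absorbed by la. The
    power L^30 suffices because N <= L^2 gives N^14 <= L^28. *)
Lemma numerics (CE rho : R) : 1 <= CE -> 0 < rho <= 1 -> exists L1, 1 <= L1 /\
  forall L (N : nat) lm, L1 <= L -> (1 <= N)%nat -> INR N <= L ^ 2 -> exp (L / 2) <= lm ->
  exists th e, let sg := INR N ^ 7 / (8 * L ^ 5) in let n := (3 * N)%nat in let L0 := loss (INR n) sg ^ n in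
    e = CE * INR N ^ 14 / lm /\ 0 < th <= sg /\ 0 <= e /\ 401 * (th + e) <= 1 /\ 21 * (INR N ^ 7 / lm) <= rho /\
    10000000 * (th + e) * (20 * L0) * (2 * INR N) <= 1 /\
    11 * e * (20 * (loss (INR n) th ^ 3 * L0)) * (2 * INR N) <= 1.
Proof.
  intros HCE Hrho.
  destruct loss_power as (L2 & HL2 & HLP).
  destruct (exp_dominates (1000000000000 * CE / rho) 30) as (L3 & HL3 & HED).
  exists (Rmax L2 L3). split; [eapply Rle_trans; [exact HL2|apply Rmax_l]|].
  intros L N lm HL HN HNL Hlm.
  assert (A2 : L2 <= L) by (eapply Rle_trans; [apply Rmax_l|exact HL]).
  assert (A3 : L3 <= L) by (eapply Rle_trans; [apply Rmax_r|exact HL]).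
  specialize (HLP L N A2 HN). specialize (HED L A3).
  set (la := exp (L / 1000)) in *.
  assert (L1 : 1 <= L) by lra.
  assert (HN1 : 1 <= INR N) by (apply (le_INR 1), HN).
  assert (Ir : 1 <= / rho) by (rewrite <- Rinv_1; apply Rinv_le_contravar; lra).
  assert (L30 : 1 <= L ^ 30) by (apply pow_R1_Rle, L1).
  assert (Base : 1000000000000 <= la /\ 1000000000000 * CE * L ^ 30 <= la /\ 1000000000000 * / rho * L ^ 30 <= la).
  { unfold Rdiv in HED.
    assert (P1 : CE <= CE * / rho) by nra. assert (P2 : / rho <= CE * / rho) by nra.
    assert (P3 : CE * L ^ 30 <= CE * / rho * L ^ 30) by (apply Rmult_le_compat_r; lra).
    assert (P4 : / rho * L ^ 30 <= CE * / rho * L ^ 30) by (apply Rmult_le_compat_r; lra).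
    assert (P5 : 1 <= CE * L ^ 30) by nra. lra. }
  destruct Base as (La & LaC & Lar).
  assert (Lk : forall k, (k <= 30)%nat -> L ^ k <= L ^ 30) by (intros; apply Rle_pow; assumption).
  assert (N14 : INR N ^ 14 <= L ^ 30).
  { apply Rle_trans with ((L ^ 2) ^ 14); [apply pow_incr; lra|]. rewrite <- pow_mult. apply Lk. simpl. lia. }
  assert (N7 : INR N ^ 7 <= L ^ 30).
  { apply Rle_trans with ((L ^ 2) ^ 7); [apply pow_incr; lra|]. rewrite <- pow_mult. apply Lk. simpl. lia. }
  assert (NLa : 1000000000000 * INR N <= la).
  { assert (INR N <= L ^ 30) by (eapply Rle_trans; [exact HNL|apply Lk; lia]). nra. }
  set (y := / la).
  assert (Hy : 0 < y) by (apply Rinv_0_lt_compat; lra).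
  assert (Yl : y * la = 1) by (unfold y; field; lra).
  assert (Y12 : 1000000000000 * y <= 1) by nra.
  assert (Y1 : y <= 1) by lra.
  assert (Ypow : forall j k, la ^ j * y ^ (j + k) = y ^ k).
  { intros j k. rewrite pow_add, <- Rmult_assoc, <- Rpow_mult_distr, (Rmult_comm la), Yl, pow1. ring. }
  assert (Yle : forall k, 0 < y ^ k <= 1).
  { intros k. split; [apply pow_lt, Hy|]. rewrite <- (pow1 k). apply pow_incr. lra. }
  assert (Lam : la ^ 500 <= lm).
  { eapply Rle_trans; [|exact Hlm]. unfold la. rewrite exp_pow. apply exp_le_mono. simpl INR. lra. }
  assert (La500 : 0 < la ^ 500) by (apply pow_lt; lra).
  assert (Ilm : / lm <= y ^ 500).
  { unfold y. rewrite pow_inv. apply Rinv_le_contravar; assumption. }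
  assert (Ilm0 : 0 < / lm) by (apply Rinv_0_lt_compat; lra).
  set (e := CE * INR N ^ 14 / lm).
  assert (N14p : 0 <= INR N ^ 14) by (apply pow_le; lra).
  assert (N7p : 1 <= INR N ^ 7) by (apply pow_R1_Rle, HN1).
  assert (He0 : 0 <= e) by (unfold e, Rdiv; repeat apply Rmult_le_pos; lra).
  assert (He : e <= y ^ 499).
  { unfold e, Rdiv. apply Rle_trans with (la * y ^ 500).
    - apply Rmult_le_compat; [apply Rmult_le_pos; lra|lra| |exact Ilm].
      assert (CE * INR N ^ 14 <= CE * L ^ 30) by (apply Rmult_le_compat_l; lra).
      assert (0 <= CE * L ^ 30) by (apply Rmult_le_pos; lra). lra.
    - right. rewrite <- (Ypow 1%nat 499%nat). rewrite pow_1. reflexivity. }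
  assert (He6 : e <= y ^ 6).
  { eapply Rle_trans; [exact He|]. change 499%nat with (6 + 493)%nat. rewrite pow_add.
    destruct (Yle 6%nat). destruct (Yle 493%nat). nra. }
  assert (Y6 : y ^ 6 <= y) by (change (y ^ 6) with (y * y ^ 5); destruct (Yle 5%nat); nra).
  (* With th = y^6 the first balance reads y^6 la^2, a negative power of la. The loss at distance th
     is at most la^21, cubed la^63, and the second balance reads y^499 la^65. The gap between these
     powers leaves ample room for the exponent 6. *)
  exists (y ^ 6), e. cbv zeta.
  set (sg := INR N ^ 7 / (8 * L ^ 5)) in *.
  set (L0 := loss (INR (3 * N)) sg ^ (3 * N)) in *.
  assert (L5 : 1 <= L ^ 5) by (apply pow_R1_Rle, L1).
  assert (Hsg : y <= sg).
  { unfold sg. apply (Rmult_le_reg_r (8 * L ^ 5)); [lra|].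
    replace (INR N ^ 7 / (8 * L ^ 5) * (8 * L ^ 5)) with (INR N ^ 7) by (field; lra).
    assert (L5' : L ^ 5 <= L ^ 30) by (apply Lk; lia).
    assert (8 * L ^ 5 <= la) by nra. nra. }
  assert (Hsg0 : 0 < sg) by lra.
  assert (HL01 : 1 <= L0) by (apply pow_R1_Rle, loss_ge_1, Hsg0).
  split; [reflexivity|]. split; [split; [apply (Yle 6%nat)|lra]|]. split; [exact He0|].
  split; [lra|]. split; [|split].
  - unfold Rdiv. apply Rle_trans with (21 * (L ^ 30 * y ^ 500)).
    + apply Rmult_le_compat_l; [lra|]. apply Rmult_le_compat; lra.
    + assert (Q : 21 * L ^ 30 * / rho <= la) by (assert (0 <= / rho * L ^ 30) by (apply Rmult_le_pos; lra); lra).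
      assert (Q2 : 21 * L ^ 30 <= la * rho).
      { apply (Rmult_le_reg_r (/ rho)); [lra|]. rewrite (Rmult_assoc la), Rinv_r by lra. lra. }
      assert (Q3 : y ^ 500 <= y) by (change (y ^ 500) with (y * y ^ 499); destruct (Yle 499%nat); nra).
      replace (21 * (L ^ 30 * y ^ 500)) with (21 * L ^ 30 * y ^ 500) by ring.
      destruct (Yle 500%nat).
      apply Rle_trans with (la * rho * y).
      * apply Rmult_le_compat; lra.
      * right. replace (la * rho * y) with (rho * (y * la)) by ring. rewrite Yl. ring.
  - apply Rle_trans with (10000000 * (2 * y ^ 6) * (20 * la) * (2 * la)).
    + apply Rmult_le_compat; [|lra| |lra].
      * apply Rmult_le_pos; [apply Rmult_le_pos; [lra|destruct (Yle 6%nat); lra]|lra].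
      * apply Rmult_le_compat; [|lra|lra|lra]. apply Rmult_le_pos; [lra|destruct (Yle 6%nat); lra].
    + replace (10000000 * (2 * y ^ 6) * (20 * la) * (2 * la)) with (800000000 * (la ^ 2 * y ^ (2 + 4))) by (simpl; ring).
      rewrite Ypow. change (y ^ 4) with (y * y ^ 3). destruct (Yle 3%nat). nra.
  - assert (Hl : loss (INR (3 * N)) (y ^ 6) <= la ^ 21).
    { unfold loss. rewrite mult_INR. change (INR 3) with (1 + 1 + 1).
      assert (Iy : forall c, c / y ^ 6 = c * la ^ 6).
      { intros c. unfold Rdiv, y. rewrite pow_inv, Rinv_inv. reflexivity. }
      rewrite !Iy. assert (l6 : 1 <= la ^ 6) by (apply pow_R1_Rle; lra).
      replace (la ^ 21) with ((la * la ^ 6) * (la * la ^ 6) ^ 2) by ring.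
      apply Rmult_le_compat.
      - eapply Rle_trans; [|apply Rmax_l]. lra.
      - apply pow2_ge_0.
      - apply Rmax_lub; [nra|]. apply Rmult_le_compat_r; lra.
      - apply pow_incr. split; nra. }
    assert (Hl0 : 0 <= loss (INR (3 * N)) (y ^ 6)) by (assert (Q := loss_ge_1 (INR (3 * N)) (y ^ 6) (proj1 (Yle 6%nat))); lra).
    assert (Hl3 : loss (INR (3 * N)) (y ^ 6) ^ 3 <= la ^ 63).
    { replace (la ^ 63) with ((la ^ 21) ^ 3) by (rewrite <- pow_mult; reflexivity). apply pow_incr. lra. }
    assert (Hl30 : 0 <= loss (INR (3 * N)) (y ^ 6) ^ 3) by (apply pow_le, Hl0).
    apply Rle_trans with (11 * y ^ 499 * (20 * (la ^ 63 * la)) * (2 * la)).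
    + apply Rmult_le_compat; [|lra| |lra].
      * apply Rmult_le_pos; [lra|]. apply Rmult_le_pos; [lra|]. apply Rmult_le_pos; [exact Hl30|lra].
      * apply Rmult_le_compat; [lra| |lra|].
        -- apply Rmult_le_pos; [lra|]. apply Rmult_le_pos; [exact Hl30|lra].
        -- apply Rmult_le_compat_l; [lra|]. apply Rmult_le_compat; lra.
    + replace (11 * y ^ 499 * (20 * (la ^ 63 * la)) * (2 * la)) with (440 * (la ^ 65 * y ^ (65 + 434))).
      * rewrite Ypow. change (y ^ 434) with (y * y ^ 433). destruct (Yle 433%nat). nra.
      * change (65 + 434)%nat with 499%nat. replace (la ^ 65) with (la ^ 63 * la * la) by ring. ring.
Qed.

(** * Pairs of lattice points on a circle *)

Open Scope nat_scope.

Lemma in_zrange (k : nat) (z : Z) : In z (zrange k) <-> (- Z.of_nat k <= z <= Z.of_nat k)%Z.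
Proof.
  unfold zrange. rewrite in_map_iff. split.
  - intros [j [<- Hj]]. apply in_seq in Hj. lia.
  - intros H. exists (Z.to_nat (z + Z.of_nat k)). split; [lia|]. apply in_seq. lia.
Qed.

Lemma length_zrange (k : nat) : length (zrange k) = 2 * k + 1.
Proof. unfold zrange. rewrite length_map, length_seq. reflexivity. Qed.

Lemma NoDup_zrange (k : nat) : NoDup (zrange k).
Proof. unfold zrange. apply FinFun.Injective_map_NoDup; [intros x y; lia|apply seq_NoDup]. Qed.

Lemma NoDup_flat_map {A B : Type} (f : A -> list B) (l : list A) : NoDup l ->
  (forall x, In x l -> NoDup (f x)) ->
  (forall x y b, In x l -> In y l -> In b (f x) -> In b (f y) -> x = y) ->
  NoDup (flat_map f l).
Proof.
  induction 1 as [|a l Ha Hl IH]; intros H1 H2; simpl; [constructor|].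
  apply NoDup_app.
  - apply H1; left; reflexivity.
  - apply IH; [intros; apply H1; right; assumption|].
    intros x y b Hx Hy. apply H2; right; assumption.
  - intros b Hb Hb'. apply in_flat_map in Hb'. destruct Hb' as [c [Hc Hbc]].
    assert (a = c) by (apply (H2 a c b); simpl; auto). subst. contradiction.
Qed.

Lemma NoDup_list_prod {A B : Type} (l : list A) (l' : list B) : NoDup l -> NoDup l' -> NoDup (list_prod l l').
Proof.
  intros Hl Hl'. rewrite list_prod_as_flat_map. apply NoDup_flat_map; [exact Hl| |].
  - intros x _. apply FinFun.Injective_map_NoDup; [intros u v E; congruence|exact Hl'].
  - intros x y b _ _ Hx Hy. apply in_map_iff in Hx, Hy.
    destruct Hx as [u [<- _]]. destruct Hy as [v [E _]]. congruence.
Qed.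

Lemma in_lattice_pts (m : nat) (p : Z * Z) :
  In p (lattice_pts m) <-> (fst p * fst p + snd p * snd p = Z.of_nat m)%Z.
Proof.
  unfold lattice_pts. rewrite filter_In, Z.eqb_eq. split; [tauto|].
  intros H. split; [|exact H]. destruct p as [a b]. simpl in *.
  apply in_prod_iff. rewrite !in_zrange. nia.
Qed.

Lemma NoDup_lattice_pts (m : nat) : NoDup (lattice_pts m).
Proof. apply NoDup_filter, NoDup_list_prod; apply NoDup_zrange. Qed.

Lemma sum2sq_lattice (m : nat) (p : Z * Z) : In p (lattice_pts m) -> sum2sq m = true.
Proof.
  intros H. apply in_lattice_pts in H. destruct p as [a b]. simpl in H.
  unfold sum2sq. apply existsb_exists. exists (Z.abs_nat a). split.
  - apply in_seq. nia.
  - apply existsb_exists. exists (Z.abs_nat b). split; [apply in_seq; nia|].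
    apply Nat.eqb_eq. nia.
Qed.

(* A pair of points on a common circle with difference g u (u primitive) has sum k u', where u' is
   u rotated by a right angle; (u, (g, k)) codes the pair. *)
Definition sphere (j : nat) : list (Z * Z) :=
  list_prod (zrange j) [Z.of_nat j; (- Z.of_nat j)%Z] ++ list_prod [Z.of_nat j; (- Z.of_nat j)%Z] (zrange j).

Definition codes (K H : nat) : list ((Z * Z) * (nat * Z)) :=
  flat_map (fun j => list_prod (sphere j) (list_prod (seq 1 (H / j)) (zrange (2 * K / j)))) (seq 1 H).

(** Half the difference and half the sum of the vectors k u' and g u. Only surjectivity onto the
    pairs is used, so codes with the wrong parity, or with u not primitive, may decode to
    anything. *)
Definition decode (c : (Z * Z) * (nat * Z)) : (Z * Z) * (Z * Z) :=
  let u := fst c in let g := Z.of_nat (fst (snd c)) in let k := snd (snd c) in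
  (((- k * snd u - g * fst u) / 2, (k * fst u - g * snd u) / 2)%Z,
   ((- k * snd u + g * fst u) / 2, (k * fst u + g * snd u) / 2)%Z).

Lemma in_sphere (j : nat) (u : Z * Z) : Z.max (Z.abs (fst u)) (Z.abs (snd u)) = Z.of_nat j -> In u (sphere j).
Proof.
  destruct u as [a b]. simpl. intros H. unfold sphere. apply in_or_app.
  destruct (Z.max_spec (Z.abs a) (Z.abs b)) as [[H1 H2]|[H1 H2]].
  - left. apply in_prod_iff. rewrite in_zrange. simpl. lia.
  - right. apply in_prod_iff. rewrite in_zrange. simpl. lia.
Qed.

(** Bezout's identity x u1 + y u2 = 1 produces the multiple as k = x s2 - y s1. *)
Lemma orthogonal_primitive (u1 u2 s1 s2 : Z) : Z.gcd u1 u2 = 1%Z -> (u1 * s1 + u2 * s2 = 0)%Z ->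
  exists k, (s1 = - k * u2 /\ s2 = k * u1)%Z.
Proof.
  intros G E. destruct (Z.gcd_bezout u1 u2 1 G) as [x [y B]].
  exists (x * s2 - y * s1)%Z.
  assert (E1 : (u1 * s1 = - (u2 * s2))%Z) by lia.
  split.
  - transitivity ((x * u1 + y * u2) * s1)%Z; [rewrite B; ring|].
    transitivity (x * (u1 * s1) + y * u2 * s1)%Z; [ring|]. rewrite E1. ring.
  - transitivity ((x * u1 + y * u2) * s2)%Z; [rewrite B; ring|].
    transitivity (x * u1 * s2 + y * (u2 * s2))%Z; [ring|].
    replace (u2 * s2)%Z with (- (u1 * s1))%Z by lia. ring.
Qed.

(** Equal norms make q - p orthogonal to p + q. The sup norm j of the primitive direction u then
    limits both multipliers: g j <= H from the difference, |k| j <= 2K from the sum. *)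
Lemma code_exists (K H : nat) (p q : Z * Z) : p <> q ->
  (fst p * fst p + snd p * snd p = fst q * fst q + snd q * snd q)%Z ->
  (Z.abs (fst p) <= Z.of_nat K)%Z -> (Z.abs (snd p) <= Z.of_nat K)%Z ->
  (Z.abs (fst q) <= Z.of_nat K)%Z -> (Z.abs (snd q) <= Z.of_nat K)%Z ->
  (Z.abs (fst q - fst p) <= Z.of_nat H)%Z -> (Z.abs (snd q - snd p) <= Z.of_nat H)%Z ->
  exists c, In c (codes K H) /\ decode c = (p, q).
Proof.
  destruct p as [p1 p2], q as [q1 q2]. simpl. intros Hne Hn P1 P2 Q1 Q2 D1 D2.
  set (g := Z.gcd (q1 - p1) (q2 - p2)).
  assert (Hg0 : (0 <= g)%Z) by apply Z.gcd_nonneg.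
  assert (Hg : (0 < g)%Z).
  { destruct (Z.eq_dec g 0) as [E|E]; [|lia]. apply Z.gcd_eq_0 in E. elim Hne. f_equal; lia. }
  destruct (Z.gcd_divide_l (q1 - p1) (q2 - p2)) as [u1 U1].
  destruct (Z.gcd_divide_r (q1 - p1) (q2 - p2)) as [u2 U2]. fold g in U1, U2.
  assert (Gu : Z.gcd u1 u2 = 1%Z).
  { assert (E : (Z.gcd (u1 * g) (u2 * g) = Z.gcd u1 u2 * g)%Z) by (rewrite Z.gcd_mul_mono_r_nonneg; lia).
    rewrite <- U1, <- U2 in E. fold g in E. nia. }
  destruct (orthogonal_primitive u1 u2 (p1 + q1) (p2 + q2) Gu) as [k [K1 K2]].
  { apply (Z.mul_reg_l _ _ g); [lia|].
    transitivity ((u1 * g) * (p1 + q1) + (u2 * g) * (p2 + q2))%Z; [ring|]. rewrite <- U1, <- U2. nia. }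
  set (j := Z.max (Z.abs u1) (Z.abs u2)).
  assert (Hj : (0 < j)%Z).
  { destruct (Z.eq_dec j 0) as [E|E]; [|unfold j in *; lia].
    assert (u1 = 0%Z /\ u2 = 0%Z) as [-> ->] by (unfold j in E; lia). simpl in Gu. lia. }
  assert (Hgj : (g * j <= Z.of_nat H)%Z).
  { unfold j. destruct (Z.max_spec (Z.abs u1) (Z.abs u2)) as [[_ ->]|[_ ->]].
    - rewrite U2, Z.abs_mul, (Z.abs_eq g) in D2 by lia. lia.
    - rewrite U1, Z.abs_mul, (Z.abs_eq g) in D1 by lia. lia. }
  assert (Hkj : (Z.abs k * j <= 2 * Z.of_nat K)%Z).
  { unfold j. destruct (Z.max_spec (Z.abs u1) (Z.abs u2)) as [[_ ->]|[_ ->]].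
    - assert (A : (Z.abs (p1 + q1) <= 2 * Z.of_nat K)%Z) by lia. rewrite K1, Z.abs_mul, Z.abs_opp in A. exact A.
    - assert (A : (Z.abs (p2 + q2) <= 2 * Z.of_nat K)%Z) by lia. rewrite K2, Z.abs_mul in A. exact A. }
  assert (Hjd : Z.max (Z.abs u1) (Z.abs u2) = j) by reflexivity.
  clearbody j g. clear P1 P2 Q1 Q2 D1 D2 Hne Hn Gu.
  exists ((u1, u2), (Z.to_nat g, k)). split.
  - clear U1 U2 K1 K2. unfold codes. apply in_flat_map. exists (Z.to_nat j). split.
    + apply in_seq. assert (Hj' : (1 * j <= g * j)%Z) by (apply Z.mul_le_mono_nonneg_r; lia). lia.
    + apply in_prod_iff. split; [apply in_sphere; simpl; rewrite Z2Nat.id; lia|].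
      apply in_prod_iff. split.
      * apply in_seq. split; [lia|].
        assert (Z.to_nat g <= H / Z.to_nat j); [|lia]. apply Nat.div_le_lower_bound; [lia|].
        apply Nat2Z.inj_le. rewrite Nat2Z.inj_mul, !Z2Nat.id by lia. rewrite Z.mul_comm. exact Hgj.
      * apply in_zrange.
        assert (Z.to_nat (Z.abs k) <= 2 * K / Z.to_nat j); [|lia]. apply Nat.div_le_lower_bound; [lia|].
        apply Nat2Z.inj_le. rewrite !Nat2Z.inj_mul, !Z2Nat.id by lia. rewrite Z.mul_comm. exact Hkj.
  - unfold decode. simpl. rewrite Z2Nat.id by lia.
    rewrite <- K1, <- K2, (Z.mul_comm g u1), (Z.mul_comm g u2), <- U1, <- U2.
    replace (p1 + q1 - (q1 - p1))%Z with (p1 * 2)%Z by ring.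
    replace (p2 + q2 - (q2 - p2))%Z with (p2 * 2)%Z by ring.
    replace (p1 + q1 + (q1 - p1))%Z with (q1 * 2)%Z by ring.
    replace (p2 + q2 + (q2 - p2))%Z with (q2 * 2)%Z by ring.
    rewrite !Z.div_mul by lia. reflexivity.
Qed.

Close Scope nat_scope.

Lemma INR_div_le (a b : nat) : (0 < b)%nat -> INR (a / b) <= INR a / INR b.
Proof.
  intros Hb. assert (0 < INR b) by (apply lt_0_INR; exact Hb).
  apply (Rmult_le_reg_r (INR b)); [assumption|]. unfold Rdiv. rewrite Rmult_assoc, Rinv_l, Rmult_1_r by lra.
  rewrite <- mult_INR. apply le_INR. rewrite Nat.mul_comm. apply Nat.Div0.mul_div_le.
Qed.

Lemma ln_le_sub1 (x : R) : 0 < x -> ln x <= x - 1.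
Proof. intros H. assert (E := exp_ineq1_le (ln x)). rewrite exp_ln in E by exact H. lra. Qed.

(** For each j there are at most 12 j directions, H/j values of g and 6K/j values of k, the last
    because j <= 2K absorbs the summand 1. The sum over j is harmonic, which is the source of the
    logarithm. *)
Lemma length_codes (K H : nat) : (1 <= H <= 2 * K)%nat ->
  INR (length (codes K H)) <= 72 * INR H * INR K * (1 + ln (INR H)).
Proof.
  intros HK.
  set (f := fun j => length (list_prod (sphere j) (list_prod (seq 1 (H / j)) (zrange (2 * K / j))))).
  assert (G : forall n, (n <= H)%nat -> (1 <= n)%nat ->
    INR (list_sum (map f (seq 1 n))) <= 72 * INR H * INR K * (1 + ln (INR n))).
  { assert (T : forall j, (1 <= j <= H)%nat -> INR (f j) <= 72 * INR H * INR K * / INR j).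
    { intros j Hj. unfold f. rewrite !length_prod, length_seq, length_zrange.
      assert (Ls : (length (sphere j) <= 12 * j)%nat).
      { unfold sphere. rewrite length_app, !length_prod, !length_zrange. simpl. lia. }
      assert (J1 : 1 <= INR j) by (apply (le_INR 1); lia).
      assert (A1 : INR (length (sphere j)) <= 12 * INR j).
      { eapply Rle_trans; [apply le_INR, Ls|]. rewrite mult_INR. simpl. lra. }
      assert (A2 := INR_div_le H j ltac:(lia)).
      assert (A3 : INR (2 * (2 * K / j) + 1) <= 6 * INR K / INR j).
      { rewrite plus_INR, mult_INR. simpl (INR 2). simpl (INR 1).
        assert (B := INR_div_le (2 * K) j ltac:(lia)). rewrite mult_INR in B. simpl (INR 2) in B.
        assert (C1 : 1 <= 2 * INR K / INR j).
        { apply (Rmult_le_reg_r (INR j)); [lra|]. unfold Rdiv. rewrite Rmult_assoc, Rinv_l by lra.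
          assert (D : INR j <= INR (2 * K)) by (apply le_INR; lia). rewrite mult_INR in D. simpl (INR 2) in D. lra. }
        unfold Rdiv in *. lra. }
      rewrite !mult_INR.
      apply Rle_trans with ((12 * INR j) * ((INR H / INR j) * (6 * INR K / INR j))).
      - apply Rmult_le_compat; [apply pos_INR|apply Rmult_le_pos; apply pos_INR|exact A1|].
        apply Rmult_le_compat; try apply pos_INR; assumption.
      - right. field. lra. }
    clearbody f. induction n as [|n IH]; [lia|]. intros Hn _.
    rewrite seq_S, map_app, list_sum_app. change (list_sum (map f [(1 + n)%nat])) with (f (1 + n) + 0)%nat.
    rewrite Nat.add_0_r, plus_INR.
    specialize (T (1 + n)%nat ltac:(lia)).
    assert (HH : 0 <= INR H) by apply pos_INR. assert (HKp : 0 <= INR K) by apply pos_INR.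
    assert (HHK : 0 <= 72 * INR H * INR K) by (apply Rmult_le_pos; lra).
    destruct n as [|n].
    - change (1 + 0)%nat with 1%nat in *. change (INR 1) with 1 in *. rewrite ln_1, Rinv_1 in *.
      change (INR (list_sum (map f (seq 1 0)))) with 0. lra.
    - specialize (IH ltac:(lia) ltac:(lia)).
      assert (N1 : 0 < INR (S n)) by (apply lt_0_INR; lia).
      assert (L : / INR (1 + S n) <= ln (INR (S (S n))) - ln (INR (S n))).
      { change (1 + S n)%nat with (S (S n)). rewrite (S_INR (S n)).
        set (x := INR (S n)) in *.
        assert (Q := ln_le_sub1 (x / (x + 1)) ltac:(apply Rdiv_lt_0_compat; lra)).
        rewrite ln_div in Q by lra. replace (x / (x + 1) - 1) with (- / (x + 1)) in Q by (field; lra). lra. }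
      assert (Q : 0 <= 72 * INR H * INR K * (ln (INR (S (S n))) - ln (INR (S n)) - / INR (1 + S n)))
        by (apply Rmult_le_pos; lra).
      lra. }
  unfold codes. rewrite length_flat_map. apply G; lia.
Qed.

(** * Almost all sums of two squares *)

Definition sqdist (p q : Z * Z) : Z :=
  ((fst q - fst p) * (fst q - fst p) + (snd q - snd p) * (snd q - snd p))%Z.

Definition ptsum (l : list nat) : list (Z * Z) := flat_map lattice_pts l.

Definition pairsum (l : list nat) : list ((Z * Z) * (Z * Z)) :=
  flat_map (fun m => list_prod (lattice_pts m) (lattice_pts m)) l.

Lemma NoDup_ptsum (l : list nat) : NoDup l -> NoDup (ptsum l).
Proof.
  intros Hl. apply NoDup_flat_map; [exact Hl|intros; apply NoDup_lattice_pts|].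
  intros x y b _ _ Hx Hy. apply in_lattice_pts in Hx, Hy. lia.
Qed.

Lemma NoDup_pairsum (l : list nat) : NoDup l -> NoDup (pairsum l).
Proof.
  intros Hl. apply NoDup_flat_map; [exact Hl|intros; apply NoDup_list_prod; apply NoDup_lattice_pts|].
  intros x y [b c] _ _ Hx Hy. apply in_prod_iff in Hx, Hy. destruct Hx as [Hx _]. destruct Hy as [Hy _].
  apply in_lattice_pts in Hx, Hy. lia.
Qed.

Lemma lattice_sqrt_bound (X m : nat) (p : Z * Z) : (m <= X)%nat -> In p (lattice_pts m) ->
  (Z.abs (fst p) <= Z.of_nat (Nat.sqrt X))%Z /\ (Z.abs (snd p) <= Z.of_nat (Nat.sqrt X))%Z.
Proof.
  intros Hm Hp. apply in_lattice_pts in Hp. destruct p as [a b]. simpl in *.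
  assert (A : forall c d : Z, (c * c + d * d = Z.of_nat m)%Z -> (Z.abs c <= Z.of_nat (Nat.sqrt X))%Z).
  { intros c d H. assert (Z.abs_nat c <= Nat.sqrt X)%nat; [|lia].
    apply Nat.sqrt_le_square. nia. }
  split; [apply (A a b Hp)|apply (A b a); lia].
Qed.

Lemma ptsum_upper (X : nat) (l : list nat) : NoDup l -> (forall m, In m l -> (m <= X)%nat) ->
  (length (ptsum l) <= (2 * Nat.sqrt X + 1) * (2 * Nat.sqrt X + 1))%nat.
Proof.
  intros Hl HX.
  assert (H : (length (ptsum l) <= length (list_prod (zrange (Nat.sqrt X)) (zrange (Nat.sqrt X))))%nat).
  { apply NoDup_incl_length; [apply NoDup_ptsum, Hl|].
    intros [a b] H. apply in_flat_map in H. destruct H as [m [Hm H]].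
    destruct (lattice_sqrt_bound X m (a, b) (HX m Hm) H) as [H1 H2]. simpl in H1, H2.
    apply in_prod_iff. rewrite !in_zrange. lia. }
  rewrite length_prod, !length_zrange in H. exact H.
Qed.

Lemma ptsum_lower (X : nat) :
  (Nat.sqrt (X / 2) * Nat.sqrt (X / 2) <= length (ptsum (seq 1 X)))%nat.
Proof.
  set (K := Nat.sqrt (X / 2)).
  assert (HK : (K * K <= X / 2)%nat) by (apply Nat.sqrt_spec; lia).
  assert (HX : (2 * (X / 2) <= X)%nat) by apply Nat.Div0.mul_div_le.
  set (l := map Z.of_nat (seq 1 K)).
  assert (Hl : NoDup l) by (apply FinFun.Injective_map_NoDup; [intros x y; lia|apply seq_NoDup]).
  assert (H : (length (list_prod l l) <= length (ptsum (seq 1 X)))%nat).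
  { apply NoDup_incl_length; [apply NoDup_list_prod; exact Hl|].
    intros [a b] H. apply in_prod_iff in H. destruct H as [Ha Hb].
    apply in_map_iff in Ha, Hb. destruct Ha as [x [<- Hx]]. destruct Hb as [y [<- Hy]].
    apply in_seq in Hx, Hy.
    assert (Hx2 : (x * x <= K * K)%nat) by (apply Nat.mul_le_mono; lia).
    assert (Hy2 : (y * y <= K * K)%nat) by (apply Nat.mul_le_mono; lia).
    assert (Hx3 : (1 * 1 <= x * x)%nat) by (apply Nat.mul_le_mono; lia).
    apply in_flat_map. exists (x * x + y * y)%nat. split.
    - apply in_seq. lia.
    - apply in_lattice_pts. simpl. lia. }
  rewrite length_prod in H. unfold l in H. rewrite length_map, length_seq in H. exact H.
Qed.

(** Second moment of N up to X: any two points of the disc differ by at most 2K in each coordinate,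
    so H = 2K captures all off-diagonal pairs. *)
Lemma pairsum_upper (X : nat) : let K := Nat.sqrt X in
  (length (pairsum (seq 1 X)) <= length (codes K (2 * K)) + (2 * K + 1) * (2 * K + 1))%nat.
Proof.
  intros K.
  assert (H : (length (pairsum (seq 1 X)) <= length (map decode (codes K (2 * K)) ++
     map (fun p => (p, p)) (list_prod (zrange K) (zrange K))))%nat).
  { apply NoDup_incl_length; [apply NoDup_pairsum, seq_NoDup|].
    intros [p q] H. apply in_flat_map in H. destruct H as [m [Hm H]].
    apply in_prod_iff in H. destruct H as [Hp Hq]. apply in_seq in Hm.
    destruct (lattice_sqrt_bound X m p ltac:(lia) Hp) as [P1 P2].
    destruct (lattice_sqrt_bound X m q ltac:(lia) Hq) as [Q1 Q2]. fold K in P1, P2, Q1, Q2.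
    apply in_or_app.
    destruct (excluded_middle_informative (p = q)) as [->|N].
    - right. apply in_map_iff. exists q. split; [reflexivity|]. destruct q as [a b].
      apply in_prod_iff. rewrite !in_zrange. simpl in *. lia.
    - left. apply in_lattice_pts in Hp, Hq.
      destruct (code_exists K (2 * K) p q N) as [c [C1 C2]]; try lia.
      apply in_map_iff. exists c. split; assumption. }
  rewrite length_app, !length_map, length_prod, !length_zrange in H. exact H.
Qed.

(** A linearized Cauchy-Schwarz inequality: N <= t + N^2/t for each m with N > 0, and both sides
    vanish appropriately when there is no lattice point. *)
Lemma count_weighted (t : R) (l : list nat) : 0 < t ->
  INR (length (ptsum l)) <= t * INR (length (filter sum2sq l)) + INR (length (pairsum l)) / t.
Proof.
  intros Ht. induction l as [|m l IH]; simpl.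
  - unfold Rdiv. lra.
  - rewrite !length_app, length_prod, !plus_INR, mult_INR.
    fold (ptsum l) (pairsum l). set (N := INR (length (lattice_pts m))).
    assert (HN : 0 <= N) by apply pos_INR.
    assert (A : N <= t * (if sum2sq m then 1 else 0) + N * N / t).
    { destruct (sum2sq m) eqn:E.
      - apply (Rmult_le_reg_r t); [exact Ht|]. replace ((t * 1 + N * N / t) * t) with (t * t + N * N) by (field; lra). nra.
      - assert (Z : N = 0).
        { unfold N. destruct (lattice_pts m) as [|p l'] eqn:El; [reflexivity|].
          rewrite (sum2sq_lattice m p) in E; [discriminate|]. rewrite El. left; reflexivity. }
        rewrite Z. unfold Rdiv. lra. }
    replace ((N * N + INR (length (pairsum l))) / t) with (N * N / t + INR (length (pairsum l)) / t) by (field; lra).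
    destruct (sum2sq m); simpl length; [rewrite S_INR|]; nra.
Qed.

Lemma sqrt_nat_bounds (X : nat) : let K := INR (Nat.sqrt X) in
  K * K <= INR X /\ INR X < (K + 1) * (K + 1).
Proof.
  simpl. destruct (Nat.sqrt_spec X) as [H1 H2]; [lia|].
  rewrite <- S_INR, <- !mult_INR. split; [apply le_INR, H1|apply lt_INR, H2].
Qed.

Lemma ln_le_mono (x y : R) : 0 < x -> x <= y -> ln x <= ln y.
Proof. intros Hx [H| ->]; [left; apply ln_increasing; assumption|right; reflexivity]. Qed.

(** First moment at least X/8 against second moment O(X log X). The order X/log X is below the true
    one, but it suffices because the exceptional sets are smaller still. *)
Lemma count_sum2sq_lower (X : nat) : (2 <= X)%nat ->
  INR X / (40000 * (2 + ln (INR X))) <= INR (count_upto sum2sq X).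
Proof.
  intros HX.
  assert (X2 : 2 <= INR X) by (apply (le_INR 2), HX).
  assert (Lp : 0 <= ln (INR X)) by (rewrite <- ln_1; apply ln_le_mono; lra).
  set (q := ln (INR X)) in *.
  set (K := Nat.sqrt X).
  assert (HK1 : (1 <= K)%nat) by (apply Nat.sqrt_le_square; lia).
  assert (K1 : 1 <= INR K) by (apply (le_INR 1), HK1).
  destruct (sqrt_nat_bounds X) as [KX _]. fold K in KX.
  assert (P : INR (length (pairsum (seq 1 X))) <= 153 * INR X * (2 + q)).
  { eapply Rle_trans; [apply le_INR, pairsum_upper|]. fold K.
    rewrite plus_INR, mult_INR, plus_INR, mult_INR. change (INR 1) with 1. change (INR 2) with 2.
    assert (B := length_codes K (2 * K) ltac:(lia)). rewrite mult_INR in B. change (INR 2) with 2 in B.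
    assert (L : ln (2 * INR K) <= 1 + q).
    { rewrite ln_mult by lra. assert (L2 := ln_le_sub1 2 ltac:(lra)).
      assert (ln (INR K) <= q) by (apply ln_le_mono; nra). lra. }
    assert (72 * (2 * INR K) * INR K * (1 + ln (2 * INR K)) <= 144 * INR X * (2 + q)).
    { replace (72 * (2 * INR K) * INR K * (1 + ln (2 * INR K))) with (144 * (INR K * INR K) * (1 + ln (2 * INR K))) by ring.
      assert (0 <= ln (2 * INR K)) by (rewrite <- ln_1; apply ln_le_mono; lra).
      apply Rmult_le_compat; nra. }
    nra. }
  assert (S : INR X / 8 <= INR (length (ptsum (seq 1 X)))).
  { eapply Rle_trans; [|apply le_INR, ptsum_lower]. rewrite mult_INR.
    destruct (sqrt_nat_bounds (X / 2)) as [_ B]. set (k := INR (Nat.sqrt (X / 2))) in *.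
    assert (k1 : 1 <= k).
    { apply (le_INR 1). apply Nat.sqrt_le_square. assert (H := Nat.Div0.div_le_mono 2 X 2 HX).
      change (2 / 2)%nat with 1%nat in H. lia. }
    assert (D : INR X <= 2 * INR (X / 2) + 1).
    { assert (E := Nat.div_mod_eq X 2). assert (M := Nat.mod_upper_bound X 2 ltac:(lia)).
      rewrite E at 1. rewrite plus_INR, mult_INR. change (INR 2) with 2.
      assert (INR (X mod 2) <= 1) by (apply (le_INR _ 1); lia). lra. }
    assert (D' : INR (X / 2) + 1 <= (k + 1) * (k + 1)).
    { unfold k. rewrite <- !S_INR, <- mult_INR. apply le_INR.
      assert (Q := proj2 (Nat.sqrt_spec (X / 2) ltac:(lia))). lia. }
    nra. }
  (* Balances the inequality so that the second moment costs X/16, half of the first one. *)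
  set (t := 16 * 153 * (2 + q)).
  assert (Ht : 0 < t) by (unfold t; lra).
  assert (C := count_weighted t (seq 1 X) Ht).
  assert (Q : INR (length (pairsum (seq 1 X))) / t <= INR X / 16).
  { apply (Rmult_le_reg_r t); [exact Ht|]. unfold Rdiv at 1. rewrite Rmult_assoc, Rinv_l, Rmult_1_r by lra.
    unfold t. lra. }
  unfold count_upto. set (B := INR (length (filter sum2sq (seq 1 X)))) in *.
  assert (tB : INR X / 16 <= t * B) by lra.
  apply (Rmult_le_reg_r (40000 * (2 + q))); [lra|].
  unfold Rdiv at 1. rewrite Rmult_assoc, Rinv_l, Rmult_1_r by lra.
  assert (0 <= B) by apply pos_INR. unfold t in tB.
  replace (B * (40000 * (2 + q))) with (40000 * (2 + q) * B) by ring.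
  replace (16 * 153 * (2 + q) * B) with (2448 * (2 + q) * B) in tB by ring.
  assert (0 <= (2 + q) * B) by (apply Rmult_le_pos; lra). nra.
Qed.

(** Each such m is the squared norm of the first point decoded from some code, so the codes map onto
    the list. *)
Lemma count_close_pairs (X H : nat) (l : list nat) : NoDup l ->
  (forall m, In m l -> (m <= X)%nat /\ exists p q, In p (lattice_pts m) /\ In q (lattice_pts m) /\ p <> q /\
     (Z.abs (fst q - fst p) <= Z.of_nat H)%Z /\ (Z.abs (snd q - snd p) <= Z.of_nat H)%Z) ->
  (length l <= length (codes (Nat.sqrt X) H))%nat.
Proof.
  intros Hl Hm.
  set (nrm := fun c => Z.to_nat (fst (fst (decode c)) * fst (fst (decode c)) + snd (fst (decode c)) * snd (fst (decode c)))).
  rewrite <- (length_map nrm (codes (Nat.sqrt X) H)).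
  apply NoDup_incl_length; [exact Hl|]. intros m Hin.
  destruct (Hm m Hin) as (HX & p & q & Hp & Hq & N & D1 & D2).
  destruct (lattice_sqrt_bound X m p HX Hp) as [P1 P2].
  destruct (lattice_sqrt_bound X m q HX Hq) as [Q1 Q2].
  apply in_lattice_pts in Hp, Hq.
  destruct (code_exists (Nat.sqrt X) H p q N) as [c [C1 C2]]; try assumption; try lia.
  apply in_map_iff. exists c. split; [|exact C1]. unfold nrm. rewrite C2. simpl. lia.
Qed.

(** Markov's inequality for N, whose sum up to X is bounded by the lattice points of a square, at
    most (2 sqrt X + 1)^2 <= 9X. *)
Lemma count_large_mult (X : nat) (c : R) (l : list nat) : (1 <= X)%nat -> NoDup l ->
  (forall m, In m l -> (m <= X)%nat /\ c <= INR (Npts m)) ->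
  c * INR (length l) <= 9 * INR X.
Proof.
  intros HX1 Hl Hm.
  assert (A : c * INR (length l) <= INR (length (ptsum l))).
  { clear Hl. induction l as [|m l IH]; simpl length; [simpl; lra|].
    rewrite S_INR. unfold ptsum. simpl flat_map. rewrite length_app, plus_INR. fold (ptsum l).
    destruct (Hm m (or_introl eq_refl)) as [_ H]. unfold Npts in H.
    assert (IH' := IH (fun k Hk => Hm k (or_intror Hk))). lra. }
  assert (B := ptsum_upper X l Hl (fun m Hin => proj1 (Hm m Hin))).
  apply le_INR in B. rewrite mult_INR, plus_INR, mult_INR in B. change (INR 1) with 1 in B. change (INR 2) with 2 in B.
  destruct (sqrt_nat_bounds X) as [KX _].
  assert (K1 : 1 <= INR (Nat.sqrt X)) by (apply (le_INR 1), Nat.sqrt_le_square; lia). nra.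
Qed.

(** * Exceptional integers have relative density zero *)

Definition asb (P : Prop) : bool := if excluded_middle_informative P then true else false.

Lemma asb_true (P : Prop) : asb P = true <-> P.
Proof. unfold asb. destruct excluded_middle_informative; split; intros; easy. Qed.

Lemma asb_false (P : Prop) : asb P = false <-> ~ P.
Proof. unfold asb. destruct excluded_middle_informative; split; intros; easy. Qed.

Definition close_pair (m : nat) : Prop := exists p q, In p (lattice_pts m) /\ In q (lattice_pts m) /\ p <> q /\
  IZR (sqdist p q) * ln (INR m) ^ 5 < INR m.

Definition many_pts (m : nat) : Prop := ln (INR m) ^ 2 < INR (Npts m).

Lemma sqdist_ge (p q : Z * Z) : (0 <= sqdist p q)%Z /\
  ((fst q - fst p) * (fst q - fst p) <= sqdist p q)%Z /\
  ((snd q - snd p) * (snd q - snd p) <= sqdist p q)%Z.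
Proof.
  unfold sqdist. assert (H1 := Z.square_nonneg (fst q - fst p)). assert (H2 := Z.square_nonneg (snd q - snd p)). lia.
Qed.

Lemma sqrt_exp_half (x y : R) : 0 < x -> ln x = y -> sqrt x = exp (y / 2).
Proof.
  intros Hx <-. rewrite <- (exp_ln x) at 1 by exact Hx.
  replace (exp (ln x)) with (exp (ln x / 2) * exp (ln x / 2)) by (rewrite <- exp_plus; f_equal; field).
  apply sqrt_square. left; apply exp_pos.
Qed.

Lemma exp_ge_pow5 (v : R) : 10 <= v -> v ^ 5 <= exp (v ^ 2 / 2).
Proof.
  intros Hv.
  assert (E : exp (v ^ 2 / 2) = exp (v ^ 2 / 10) ^ 5).
  { set (a := v ^ 2 / 10). replace (v ^ 2 / 2) with (a + (a + (a + (a + a)))) by (unfold a; field).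
    rewrite !exp_plus. ring. }
  rewrite E. apply pow_incr. split; [lra|].
  eapply Rle_trans; [|apply exp_ineq1_le]. simpl. nra.
Qed.

(** Integers up to sqrt X are discarded: for the others log m and log X are comparable, and
    thresholds in m become thresholds in X. *)
Lemma ln_half (X m : nat) : (1 <= X)%nat -> (Nat.sqrt X < m)%nat -> ln (INR X) / 2 <= ln (INR m).
Proof.
  intros HX Hm. destruct (sqrt_nat_bounds X) as [_ B].
  assert (M : INR (Nat.sqrt X) + 1 <= INR m) by (rewrite <- S_INR; apply le_INR; lia).
  assert (K0 := pos_INR (Nat.sqrt X)). assert (X1 : 1 <= INR X) by (apply (le_INR 1), HX).
  assert (L : ln (INR X) <= ln (INR m * INR m)) by (apply ln_le_mono; nra).
  rewrite ln_mult in L by lra. lra.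
Qed.

(** Writing v for the square root of log X turns (log X)^{5/2} into the integer power v^5. Counting
    codes with H of order sqrt X / v^5 yields X v^{-5} log X = X v^{-3}. *)
Lemma close_pair_count (X : nat) (v : R) : (1 <= X)%nat -> 10 <= v -> ln (INR X) = v ^ 2 ->
  INR (length (filter (fun m => asb (close_pair m /\ (Nat.sqrt X < m)%nat)) (seq 1 X))) <= 1728 * INR X / v ^ 3.
Proof.
  intros HX Hv Hq.
  assert (X1 : 1 <= INR X) by (apply (le_INR 1), HX).
  set (s := sqrt (INR X)).
  assert (Hs2 : s * s = INR X) by (apply sqrt_sqrt; lra).
  assert (Hs : s = exp (v ^ 2 / 2)) by (apply sqrt_exp_half; lra).
  assert (S5 : v ^ 5 <= s) by (rewrite Hs; apply exp_ge_pow5, Hv).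
  assert (V5 : 1000 <= v ^ 5).
  { apply Rle_trans with (10 ^ 5); [lra|]. apply pow_incr. lra. }
  assert (V50 : 0 < v ^ 5) by lra.
  set (K := Nat.sqrt X).
  destruct (sqrt_nat_bounds X) as [K1 K2]. fold K in K1, K2.
  assert (K0 := pos_INR K).
  assert (KS : INR K <= s /\ s < INR K + 1) by (split; nra).
  (* From log m >= v^2/2 the squared distance is below 32 X / v^10; the constant 6 is an integer
     above the square root of 32. *)
  set (y := 6 * s / v ^ 5).
  assert (Hy : y * v ^ 5 = 6 * s) by (unfold y; field; lra).
  assert (Y6 : 6 <= y) by nra.
  assert (Yp : (up y > 0)%Z).
  { destruct (archimed y) as [A _]. apply Z.lt_gt. apply lt_IZR. lra. }
  set (H := Z.to_nat (up y)).
  assert (HI : INR H = IZR (up y)) by (unfold H; rewrite INR_IZR_INZ, Z2Nat.id by lia; reflexivity).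
  destruct (archimed y) as [U1 U2].
  assert (HY : y < INR H <= y + 1) by (rewrite HI; lra).
  assert (YS : y <= s / 100).
  { unfold y. apply (Rmult_le_reg_r (v ^ 5)); [exact V50|]. replace (6 * s / v ^ 5 * v ^ 5) with (6 * s) by (field; lra). nra. }
  assert (HH : (1 <= H <= 2 * K)%nat).
  { split; [apply INR_le; change (INR 1) with 1; lra|]. apply INR_le. rewrite mult_INR. change (INR 2) with 2. lra. }
  eapply Rle_trans; [apply le_INR, (count_close_pairs X H)|].
  - apply NoDup_filter, seq_NoDup.
  - intros m Hm. apply filter_In in Hm. destruct Hm as [Hm1 Hm2]. apply in_seq in Hm1.
    apply (proj1 (asb_true _)) in Hm2. destruct Hm2 as [(p & q & Hp & Hq' & N & D) Hk]. split; [lia|].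
    exists p, q. split; [exact Hp|]. split; [exact Hq'|]. split; [exact N|].
    assert (L := ln_half X m HX Hk). rewrite Hq in L.
    assert (MX : INR m <= INR X) by (apply le_INR; lia).
    destruct (sqdist_ge p q) as (Dn & Dn1 & Dn2).
    assert (D0 : 0 <= IZR (sqdist p q)) by (apply IZR_le, Dn).
    assert (L5 : (v ^ 2 / 2) ^ 5 <= ln (INR m) ^ 5).
    { apply pow_incr. split; [|exact L]. assert (0 <= v ^ 2) by apply pow2_ge_0. lra. }
    assert (D1 : IZR (sqdist p q) * (v ^ 2 / 2) ^ 5 < INR X).
    { eapply Rle_lt_trans; [|eapply Rlt_le_trans; [exact D|exact MX]]. apply Rmult_le_compat_l; assumption. }
    assert (D2 : IZR (sqdist p q) <= y * y).
    { apply (Rmult_le_reg_r (v ^ 5 * v ^ 5)); [nra|].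
      replace (y * y * (v ^ 5 * v ^ 5)) with ((y * v ^ 5) * (y * v ^ 5)) by ring. rewrite Hy.
      replace (v ^ 5 * v ^ 5) with (32 * (v ^ 2 / 2) ^ 5) by field.
      replace (6 * s * (6 * s)) with (36 * (s * s)) by ring. rewrite Hs2. lra. }
    assert (Gen : forall z : Z, (z * z <= sqdist p q)%Z -> (Z.abs z <= Z.of_nat H)%Z).
    { intros z Hz. apply le_IZR. rewrite <- INR_IZR_INZ. rewrite abs_IZR.
      apply IZR_le in Hz. rewrite mult_IZR in Hz.
      assert (Z1 : Rabs (IZR z) * Rabs (IZR z) <= y * y).
      { rewrite <- Rabs_mult, Rabs_right by nra. lra. }
      assert (Z2 := Rabs_pos (IZR z)). nra. }
    split; apply Gen; assumption.
  - fold K. eapply Rle_trans; [apply length_codes, HH|].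
    assert (H1 : 1 <= INR H) by lra.
    assert (LH : 0 <= ln (INR H) <= v ^ 2).
    { split; [rewrite <- ln_1; apply ln_le_mono; lra|]. rewrite <- Hq. apply ln_le_mono; nra. }
    assert (V2 : 100 <= v ^ 2) by (simpl; nra).
    apply Rle_trans with (72 * (2 * y) * s * (2 * v ^ 2)).
    + assert (0 <= INR H) by lra.
      apply Rmult_le_compat; [apply Rmult_le_pos; lra|lra| |lra].
      apply Rmult_le_compat; lra.
    + right. unfold y. rewrite <- Hs2. field. lra.
Qed.

Lemma many_pts_count (X : nat) (v : R) : (1 <= X)%nat -> 10 <= v -> ln (INR X) = v ^ 2 ->
  INR (length (filter (fun m => asb (many_pts m /\ (Nat.sqrt X < m)%nat)) (seq 1 X))) <= 36 * INR X / v ^ 4.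
Proof.
  intros HX Hv Hq.
  set (l := filter _ _).
  assert (V4 : 0 < v ^ 4) by (apply pow_lt; lra).
  assert (B : (v ^ 2 / 2) ^ 2 * INR (length l) <= 9 * INR X).
  { apply count_large_mult; [exact HX|apply NoDup_filter, seq_NoDup|].
    intros m Hm. apply filter_In in Hm. destruct Hm as [Hm1 Hm2]. apply in_seq in Hm1.
    apply (proj1 (asb_true _)) in Hm2. destruct Hm2 as [Hm2 Hk]. split; [lia|]. unfold many_pts in Hm2.
    assert (L := ln_half X m HX Hk). rewrite Hq in L.
    assert (0 <= v ^ 2) by apply pow2_ge_0.
    assert ((v ^ 2 / 2) ^ 2 <= ln (INR m) ^ 2) by (apply pow_incr; lra). lra. }
  apply (Rmult_le_reg_r (v ^ 4)); [exact V4|].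
  replace (36 * INR X / v ^ 4 * v ^ 4) with (36 * INR X) by (field; lra).
  replace ((v ^ 2 / 2) ^ 2) with (v ^ 4 / 4) in B by field. lra.
Qed.

Theorem almost_all_separated (m0 : nat) : exists E : nat -> bool, rel_density_zero E /\
  forall m, E m = false -> (m0 <= m)%nat /\ ~ close_pair m /\ ~ many_pts m.
Proof.
  exists (fun m => asb ((m < m0)%nat \/ close_pair m \/ many_pts m)).
  split.
  2:{ intros m Hm. apply (proj1 (asb_false _)) in Hm. repeat split; [|tauto|tauto]. apply Nat.nlt_ge. tauto. }
  intros delta Hdelta.
  (* Four contributions, each at most eta X/log X, face the lower bound X/(80000 log X), and 320000
     is 4 * 80000. *)
  set (eta := Rmin delta 1 / 320000).
  assert (He : 0 < eta /\ eta <= 1 /\ 320000 * eta <= delta).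
  { assert (0 < Rmin delta 1) by (apply Rmin_glb_lt; lra).
    assert (M1 := Rmin_l delta 1). assert (M2 := Rmin_r delta 1). unfold eta. lra. }
  destruct He as (He & He1 & Hed).
  (* Since v >= V, the product v eta exceeds 2000 + m0. This one inequality handles the close pairs
     (1728/v), the large multiplicities (36/v^2), the integers up to sqrt X and those below m0. *)
  set (V := (2000 + INR m0) / eta + 10).
  assert (M0 := pos_INR m0).
  assert (HV : 2000 + INR m0 <= (V - 10) * eta) by (unfold V; right; field; lra).
  assert (V10 : 10 <= V) by nra.
  exists (Z.to_nat (up (exp (V ^ 2)))).
  intros X HX.
  assert (XE : exp (V ^ 2) <= INR X).
  { destruct (archimed (exp (V ^ 2))) as [A _]. apply le_INR in HX.
    rewrite (INR_IZR_INZ (Z.to_nat _)), Z2Nat.id in HX; [lra|].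
    apply le_IZR. assert (P := exp_pos (V ^ 2)). lra. }
  assert (E5 := exp_ge_pow5 V V10).
  assert (V5 : 10 ^ 5 <= V ^ 5) by (apply pow_incr; lra).
  assert (EE : exp (V ^ 2 / 2) <= exp (V ^ 2)).
  { assert (0 <= V ^ 2) by apply pow2_ge_0.
    destruct (Req_dec (V ^ 2) 0) as [Z|Z]; [rewrite Z; right; f_equal; lra|left; apply exp_increasing; lra]. }
  assert (X5 : 100000 <= INR X) by lra.
  assert (HX2 : (2 <= X)%nat) by (apply INR_le; change (INR 2) with 2; lra).
  set (q := ln (INR X)).
  assert (Hq : V ^ 2 <= q).
  { unfold q. rewrite <- (ln_exp (V ^ 2)). apply ln_le_mono; [apply exp_pos|exact XE]. }
  set (v := sqrt q).
  assert (V20 : 0 <= V ^ 2) by apply pow2_ge_0.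
  assert (Hv2 : v ^ 2 = q) by (unfold v; apply pow2_sqrt; lra).
  assert (Hv0 : 0 <= v) by apply sqrt_pos.
  assert (Hv : V <= v).
  { apply Rsqr_incr_0_var; [|exact Hv0]. rewrite !Rsqr_pow2. lra. }
  assert (v10 : 10 <= v) by lra.
  assert (vE : 2000 + INR m0 <= v * eta) by nra.
  set (K := Nat.sqrt X).
  set (lc := filter (fun m => asb (close_pair m /\ (K < m)%nat)) (seq 1 X)).
  set (lm := filter (fun m => asb (many_pts m /\ (K < m)%nat)) (seq 1 X)).
  assert (Bc : INR (length lc) <= 1728 * INR X / v ^ 3) by (apply close_pair_count; [lia|exact v10|symmetry; exact Hv2]).
  assert (Bm : INR (length lm) <= 36 * INR X / v ^ 4) by (apply many_pts_count; [lia|exact v10|symmetry; exact Hv2]).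
  assert (Len : (count_upto (fun m => andb (asb ((m < m0)%nat \/ close_pair m \/ many_pts m)) (sum2sq m)) X
     <= length (seq 0 m0 ++ seq 0 (K + 1) ++ lc ++ lm))%nat).
  { unfold count_upto. apply NoDup_incl_length; [apply NoDup_filter, seq_NoDup|].
    intros m Hm. apply filter_In in Hm. destruct Hm as [Hm1 Hm2].
    apply andb_prop in Hm2. destruct Hm2 as [Hm2 _]. apply (proj1 (asb_true _)) in Hm2.
    destruct (le_lt_dec m K) as [Hk|Hk].
    { apply in_or_app; right. apply in_or_app; left. apply in_seq. lia. }
    destruct Hm2 as [Hm2|[Hm2|Hm2]].
    - apply in_or_app; left. apply in_seq. lia.
    - do 2 (apply in_or_app; right). apply in_or_app; left. apply filter_In. split; [exact Hm1|].
      apply (proj2 (asb_true _)). split; assumption.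
    - do 3 (apply in_or_app; right). apply filter_In. split; [exact Hm1|].
      apply (proj2 (asb_true _)). split; assumption. }
  apply le_INR in Len. rewrite !length_app, !length_seq, !plus_INR in Len. change (INR 1) with 1 in Len.
  set (x := INR X) in *.
  destruct (sqrt_nat_bounds X) as [K1 _]. fold K x in K1.
  set (s := sqrt x).
  assert (Hs2 : s * s = x) by (apply sqrt_sqrt; lra).
  assert (Hs0 : 0 <= s) by apply sqrt_pos.
  assert (Hs : s = exp (v ^ 2 / 2)) by (apply sqrt_exp_half; [lra|fold q; lra]).
  assert (S5 : v ^ 5 <= s) by (rewrite Hs; apply exp_ge_pow5, v10).
  assert (KS : INR K <= s) by (assert (K0 := pos_INR K); nra).
  assert (vp : 0 < v) by lra.
  assert (v2p : 0 < v ^ 2) by (apply pow_lt; lra).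
  assert (xp : 0 < x / v ^ 2) by (apply Rdiv_lt_0_compat; lra).
  assert (T1 : 1728 * x / v ^ 3 <= eta * (x / v ^ 2)).
  { replace (1728 * x / v ^ 3) with ((1728 / v) * (x / v ^ 2)) by (field; lra).
    apply Rmult_le_compat_r; [lra|]. apply (Rmult_le_reg_r v); [exact vp|].
    unfold Rdiv. rewrite Rmult_assoc, Rinv_l by lra. lra. }
  assert (T2 : 36 * x / v ^ 4 <= eta * (x / v ^ 2)).
  { replace (36 * x / v ^ 4) with ((36 / v ^ 2) * (x / v ^ 2)) by (field; lra).
    apply Rmult_le_compat_r; [lra|]. apply (Rmult_le_reg_r (v ^ 2)); [exact v2p|].
    unfold Rdiv. rewrite Rmult_assoc, Rinv_l by lra. simpl. nra. }
  assert (v3 : v <= v ^ 3) by (simpl; assert (1 <= v * v) by nra; nra).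
  assert (vs : v ^ 3 * v ^ 2 <= s) by (replace (v ^ 3 * v ^ 2) with (v ^ 5) by ring; exact S5).
  assert (vs3 : v ^ 3 <= s / v ^ 2).
  { apply (Rmult_le_reg_r (v ^ 2)); [exact v2p|]. unfold Rdiv. rewrite Rmult_assoc, Rinv_l by lra. lra. }
  assert (s1 : 1 <= s) by nra.
  assert (XS : x / v ^ 2 = s * (s / v ^ 2)) by (rewrite <- Hs2; field; lra).
  assert (T3 : INR K + 1 <= eta * (x / v ^ 2)).
  { rewrite XS. apply Rle_trans with (s * (v * eta)); [nra|].
    replace (eta * (s * (s / v ^ 2))) with (s * ((s / v ^ 2) * eta)) by ring.
    apply Rmult_le_compat_l; [lra|]. apply Rmult_le_compat_r; lra. }
  assert (T4 : INR m0 <= eta * (x / v ^ 2)).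
  { rewrite XS. apply Rle_trans with (1 * (v * eta)); [lra|].
    replace (eta * (s * (s / v ^ 2))) with (s * ((s / v ^ 2) * eta)) by ring.
    apply Rmult_le_compat; [lra|nra|lra|]. apply Rmult_le_compat_r; lra. }
  assert (LB := count_sum2sq_lower X HX2). fold x q in LB. rewrite <- Hv2 in LB.
  assert (V2' : 100 <= v ^ 2) by (simpl; nra).
  assert (LB2 : x / v ^ 2 / 80000 <= x / (40000 * (2 + v ^ 2))).
  { replace (x / v ^ 2 / 80000) with (x * / (v ^ 2 * 80000)) by (field; lra).
    apply Rmult_le_compat_l; [lra|]. apply Rinv_le_contravar; lra. }
  apply Rle_trans with (4 * eta * (x / v ^ 2)); [lra|].
  apply Rle_trans with (delta * (x / v ^ 2 / 80000)).
  - nra.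
  - apply Rmult_le_compat_l; lra.
Qed.

(** * Zeros near a point of the curve *)

Lemma dot_bound (x1 x2 p1 p2 M : R) : 0 <= M -> p1 ^ 2 + p2 ^ 2 = 1 -> x1 ^ 2 + x2 ^ 2 = M ^ 2 ->
  Rabs (x1 * p1 + x2 * p2) <= M.
Proof.
  intros HM Hp Hx.
  assert (E : (x1 * p1 + x2 * p2) ^ 2 + (x2 * p1 - x1 * p2) ^ 2 = M ^ 2).
  { replace ((x1 * p1 + x2 * p2) ^ 2 + (x2 * p1 - x1 * p2) ^ 2) with ((x1 ^ 2 + x2 ^ 2) * (p1 ^ 2 + p2 ^ 2)) by ring.
    rewrite Hp, Hx. ring. }
  assert (Q := pow2_ge_0 (x2 * p1 - x1 * p2)).
  apply (pow_le_reg _ _ 2); [apply Rabs_pos|exact HM|lia|]. rewrite pow2_abs. lra.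
Qed.

(* The sign hypothesis says that the two points lie on the same side of the axis (p1,p2). *)
Lemma proj_separation (x1 x2 y1 y2 p1 p2 M : R) : 0 <= M -> p1 ^ 2 + p2 ^ 2 = 1 ->
  x1 ^ 2 + x2 ^ 2 = M ^ 2 -> y1 ^ 2 + y2 ^ 2 = M ^ 2 ->
  0 <= (x2 * p1 - x1 * p2) * (y2 * p1 - y1 * p2) ->
  (y1 - x1) ^ 2 + (y2 - x2) ^ 2 <= 4 * M * Rabs ((y1 * p1 + y2 * p2) - (x1 * p1 + x2 * p2)).
Proof.
  intros HM Hp Hx Hy Hs.
  assert (Bx := dot_bound x1 x2 p1 p2 M HM Hp Hx). assert (By := dot_bound y1 y2 p1 p2 M HM Hp Hy).
  assert (Ex : (x1 * p1 + x2 * p2) ^ 2 + (x2 * p1 - x1 * p2) ^ 2 = M ^ 2).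
  { replace ((x1 * p1 + x2 * p2) ^ 2 + (x2 * p1 - x1 * p2) ^ 2) with ((x1 ^ 2 + x2 ^ 2) * (p1 ^ 2 + p2 ^ 2)) by ring.
    rewrite Hp, Hx. ring. }
  assert (Ey : (y1 * p1 + y2 * p2) ^ 2 + (y2 * p1 - y1 * p2) ^ 2 = M ^ 2).
  { replace ((y1 * p1 + y2 * p2) ^ 2 + (y2 * p1 - y1 * p2) ^ 2) with ((y1 ^ 2 + y2 ^ 2) * (p1 ^ 2 + p2 ^ 2)) by ring.
    rewrite Hp, Hy. ring. }
  assert (Ed : (y1 - x1) ^ 2 + (y2 - x2) ^ 2
     = ((y1 * p1 + y2 * p2) - (x1 * p1 + x2 * p2)) ^ 2 + ((y2 * p1 - y1 * p2) - (x2 * p1 - x1 * p2)) ^ 2).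
  { transitivity (((y1 - x1) ^ 2 + (y2 - x2) ^ 2) * (p1 ^ 2 + p2 ^ 2)); [rewrite Hp; ring|ring]. }
  rewrite Ed. clear Ed Hx Hy Hp.
  set (P := x1 * p1 + x2 * p2) in *. set (P' := y1 * p1 + y2 * p2) in *.
  set (S := x2 * p1 - x1 * p2) in *. set (S' := y2 * p1 - y1 * p2) in *. clearbody P P' S S'.
  apply Rabs_le_between in Bx, By.
  assert (D : (P' - P) ^ 2 <= 2 * M * Rabs (P' - P)).
  { rewrite <- pow2_abs. assert (A := Rabs_pos (P' - P)). assert (A2 : Rabs (P' - P) <= 2 * M) by (apply Rabs_le; lra).
    simpl. nra. }
  assert (D2 : (S' - S) ^ 2 <= 2 * M * Rabs (P' - P)).
  { apply Rle_trans with (Rabs (S' - S) * Rabs (S' + S)).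
    - rewrite <- pow2_abs. simpl. rewrite Rmult_1_r. apply Rmult_le_compat_l; [apply Rabs_pos|].
      apply Rsqr_le_abs_0. unfold Rsqr. nra.
    - rewrite <- Rabs_mult. replace ((S' - S) * (S' + S)) with ((P - P') * (P + P')) by (simpl in *; nra).
      rewrite Rabs_mult, (Rabs_minus_sym P P'), Rmult_comm. apply Rmult_le_compat_r; [apply Rabs_pos|].
      apply Rabs_le. lra. }
  lra.
Qed.

(** Non-vanishing curvature makes the tangent p and the second-order vector q a basis, so a vector
    small against both is small. For a difference of lattice points this makes the terms of order
    one and two dominate the Taylor remainder. *)
Lemma cramer_bound (p1 p2 q1 q2 v1 v2 K c : R) : p1 ^ 2 + p2 ^ 2 = 1 -> 1 <= K -> Rabs q1 <= K -> Rabs q2 <= K ->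
  0 < c <= Rabs (p1 * q2 - p2 * q1) ->
  c * (Rabs v1 + Rabs v2) <= 2 * K * (Rabs (v1 * p1 + v2 * p2) + Rabs (v1 * q1 + v2 * q2)).
Proof.
  intros Hp HK H1 H2 Hc.
  set (al := v1 * p1 + v2 * p2). set (be := v1 * q1 + v2 * q2). set (d := p1 * q2 - p2 * q1) in *.
  assert (B1 : Rabs p1 <= 1) by (apply Rabs_le; assert (Q := pow2_ge_0 p2); nra).
  assert (B2 : Rabs p2 <= 1) by (apply Rabs_le; assert (Q := pow2_ge_0 p1); nra).
  assert (A0 := Rabs_pos al). assert (A1 := Rabs_pos be).
  assert (E1 : Rabs d * Rabs v1 <= K * (Rabs al + Rabs be)).
  { rewrite <- Rabs_mult. replace (d * v1) with (al * q2 + - (be * p2)) by (unfold d, al, be; ring).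
    eapply Rle_trans; [apply Rabs_triang|]. rewrite Rabs_Ropp, !Rabs_mult.
    assert (Q1 := Rabs_pos q2). assert (Q2 := Rabs_pos p2). nra. }
  assert (E2 : Rabs d * Rabs v2 <= K * (Rabs al + Rabs be)).
  { rewrite <- Rabs_mult. replace (d * v2) with (be * p1 + - (al * q1)) by (unfold d, al, be; ring).
    eapply Rle_trans; [apply Rabs_triang|]. rewrite Rabs_Ropp, !Rabs_mult.
    assert (Q1 := Rabs_pos q1). assert (Q2 := Rabs_pos p1). nra. }
  assert (V1 := Rabs_pos v1). assert (V2 := Rabs_pos v2).
  assert (c * Rabs v1 <= Rabs d * Rabs v1) by (apply Rmult_le_compat_r; lra).
  assert (c * Rabs v2 <= Rabs d * Rabs v2) by (apply Rmult_le_compat_r; lra). lra.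
Qed.

Lemma csum_ext {A : Type} (f g : A -> C) (l : list A) : (forall x, In x l -> f x = g x) -> csum f l = csum g l.
Proof.
  unfold csum. induction l as [|a l IH]; intros H; [reflexivity|]. simpl.
  rewrite (H a (or_introl eq_refl)), IH; [reflexivity|]. intros; apply H; right; assumption.
Qed.

Lemma cderiv_csum {A : Type} (F : A -> C -> C) (l : list A) (z : C) :
  (forall m, exists d, cderiv (F m) z d) -> exists d, cderiv (fun w => csum (fun m => F m w) l) z d.
Proof.
  intros H. induction l as [|m l [d IH]].
  - exists 0. exact (cderiv_const 0 z).
  - destruct (H m) as [d' Hd']. eexists. apply (cderiv_plus (F m) (fun w => csum (fun m => F m w) l)); eassumption.
Qed.

(** Logarithms with 2 <= e <= 3 and 12 <= 2^4 give len <= 63 N + 6 + 22 N^7, and 91 = 63 + 6 +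
    22. *)
Lemma zero_count_bound (N len : nat) : (1 <= N)%nat ->
  3 ^ len <= 12 * (2 ^ (21 * (3 * N) + 2) * exp (22 * INR N ^ 7)) -> (len <= 91 * N ^ 7)%nat.
Proof.
  intros HN H.
  assert (H1 : exp (INR len) <= exp (INR (21 * (3 * N) + 6) + 22 * INR N ^ 7)).
  { rewrite exp_plus. apply Rle_trans with (3 ^ len).
    - replace (INR len) with (INR len * 1) by ring. rewrite <- exp_pow. apply pow_incr.
      split; [left; apply exp_pos|apply exp_le_3].
    - eapply Rle_trans; [exact H|]. rewrite <- Rmult_assoc. apply Rmult_le_compat_r; [left; apply exp_pos|].
      apply Rle_trans with (2 ^ (21 * (3 * N) + 6)).
      + rewrite !pow_add. assert (P : 0 < 2 ^ (21 * (3 * N))) by (apply pow_lt; lra). simpl (2 ^ 2). simpl (2 ^ 6). lra.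
      + replace (INR (21 * (3 * N) + 6)) with (INR (21 * (3 * N) + 6) * 1) by ring. rewrite <- exp_pow.
        apply pow_incr. split; [lra|apply two_le_exp1]. }
  assert (H2 : INR len <= INR (21 * (3 * N) + 6) + 22 * INR N ^ 7).
  { destruct H1 as [H1|H1]; [left; apply exp_lt_inv, H1|right; apply exp_inv, H1]. }
  replace (22 * INR N ^ 7) with (INR (22 * N ^ 7)) in H2 by (rewrite mult_INR, pow_INR; simpl INR; ring).
  rewrite <- plus_INR in H2. apply INR_le in H2.
  assert (N7 : (N <= N ^ 7)%nat).
  { change (N ^ 7)%nat with (N * N ^ 6)%nat. assert (1 <= N ^ 6)%nat by (apply (Nat.pow_le_mono_l 1 N 6); exact HN). nia. }
  lia.
Qed.

Definition remainder (G : C -> C) (a p q : R) (u : C) : C :=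
  (G (RtoC a + u) - (G (RtoC a) + RtoC p * u + RtoC q * (u * u)))%C.

Theorem zeros_near_point (G1 G2 : C -> C) (eps rho K c CE : R) (a0 p1 p2 q1 q2 : R) (m : nat) (th e L : R) (a : Z * Z -> C) :
  (forall z, nbhd01 eps z -> exists d, cderiv G1 z d) ->
  (forall z, nbhd01 eps z -> exists d, cderiv G2 z d) ->
  0 < rho <= 1 -> rho <= eps -> 1 <= K -> 0 < c -> 0 <= a0 <= 1 ->
  Im (G1 (RtoC a0)) = 0 -> Im (G2 (RtoC a0)) = 0 ->
  p1 ^ 2 + p2 ^ 2 = 1 -> Rabs q1 <= K -> Rabs q2 <= K -> c <= Rabs (p1 * q2 - p2 * q1) ->
  (forall u, Cmod u <= rho -> Cmod (remainder G1 a0 p1 q1 u) <= K * Cmod u ^ 3) ->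
  (forall u, Cmod u <= rho -> Cmod (remainder G2 a0 p2 q2 u) <= K * Cmod u ^ 3) ->
  17000 * K <= CE -> 16000 * K * K <= CE * c ->
  1 <= L -> (1 <= m)%nat -> (1 <= Npts m)%nat ->
  (forall p q, In p (lattice_pts m) -> In q (lattice_pts m) -> p <> q -> INR m <= IZR (sqdist p q) * L ^ 5) ->
  let N := Npts m in let sg := INR N ^ 7 / (8 * L ^ 5) in let n := (3 * N)%nat in let L0 := loss (INR n) sg ^ n in
  e = CE * INR N ^ 14 / lam m -> 0 < th <= sg -> 0 <= e -> 401 * (th + e) <= 1 -> 21 * (INR N ^ 7 / lam m) <= rho ->
  10000000 * (th + e) * (20 * L0) * (2 * INR N) <= 1 ->
  11 * e * (20 * (loss (INR n) th ^ 3 * L0)) * (2 * INR N) <= 1 ->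
  coef_norm2 m a = 1 ->
  exists l : list C, (length l <= 91 * N ^ 7)%nat /\
    forall s, Cmod s < 1 ->
      Phi m a (G1 (RtoC a0 + RtoC (INR N ^ 7 / lam m) * s)%C) (G2 (RtoC a0 + RtoC (INR N ^ 7 / lam m) * s)%C) = RtoC 0 -> In s l.
Proof.
  intros H1 H2 Hrho Hre HK Hc Ha0 Hi1 Hi2 Hp HQ1 HQ2 Hdet HR1 HR2 HCE1 HCE2 HL Hm HN Hsep N sg n L0 Ee Hth He Hsm Hr N1 N2 Hnorm.
  assert (HN1 : 1 <= INR N) by (apply (le_INR 1), HN).
  set (x := sqrt (INR m)).
  assert (Hm1 : 1 <= INR m) by (apply (le_INR 1), Hm).
  assert (Hx2 : x ^ 2 = INR m) by (apply pow2_sqrt; lra).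
  assert (Hx : 0 < x) by (apply sqrt_lt_R0; lra).
  assert (HPI := PI_RGT_0).
  assert (El : lam m = 2 * PI * x) by reflexivity.
  set (lm := lam m) in *.
  assert (Hlm : 0 < lm) by (rewrite El; apply Rmult_lt_0_compat; lra).
  assert (N7 : 1 <= INR N ^ 7) by (apply pow_R1_Rle, HN1).
  set (Q := INR N ^ 7) in *.
  set (r := Q / lm) in *.
  assert (Hr0 : 0 < r) by (apply Rdiv_lt_0_compat; lra).
  assert (Hr1 : r <= 1) by lra.
  assert (Erl : r * lm = Q) by (unfold r; field; lra).
  assert (Ee' : e = CE * (Q * r)).
  { rewrite Ee. unfold r, Q. field. lra. }
  set (X := fun mu : Z * Z => IZR (fst mu)). set (Y := fun mu : Z * Z => IZR (snd mu)).
  (* [P] and [W] pair the lattice point with the first and second Taylor coefficients of the curve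
     at [a0]. Under z = a0 + r s they give the phase terms [Om] and [Be], with [T] for order three
     and above; the constant phase [ph] is real and goes into the amplitude [b]. *)
  set (P := fun mu => X mu * p1 + Y mu * p2). set (W := fun mu => X mu * q1 + Y mu * q2).
  set (Om := fun mu => 2 * PI * r * P mu). set (Be := fun mu => 2 * PI * r ^ 2 * W mu).
  set (R1 := remainder G1 a0 p1 q1) in *. set (R2 := remainder G2 a0 p2 q2) in *.
  set (T := fun mu s => (RtoC (2 * PI) * (RtoC (X mu) * R1 (RtoC r * s)%C + RtoC (Y mu) * R2 (RtoC r * s)%C))%C).
  set (ph := fun mu => (RtoC (2 * PI) * Ci * (RtoC (X mu) * G1 (RtoC a0) + RtoC (Y mu) * G2 (RtoC a0)))%C).
  set (b := fun mu => (a mu * cexp (ph mu))%C).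
  set (l := lattice_pts m).
  set (f := fun s => Phi m a (G1 (RtoC a0 + RtoC r * s)%C) (G2 (RtoC a0 + RtoC r * s)%C)).
  assert (Ef : forall s, f s = chirps Om Be T b l s).
  { intros s. unfold f, Phi, chirps. apply csum_ext. intros mu _.
    unfold b, chirp, ei. rewrite <- (Cmult_assoc (a mu) (cexp (ph mu))), <- !cexp_add. f_equal. f_equal.
    unfold T, ph, Om, Be, P, W, R1, R2, remainder, X, Y.
    rewrite !RtoC_mult, !RtoC_plus, !RtoC_mult, RtoC_pow. simpl Cpow. ring. }
  assert (Circ : forall mu, In mu l -> X mu ^ 2 + Y mu ^ 2 = x ^ 2).
  { intros mu Hmu. apply in_lattice_pts in Hmu. rewrite Hx2, INR_IZR_INZ, <- Hmu, plus_IZR, !mult_IZR. unfold X, Y. ring. }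
  assert (Bd : forall mu, In mu l -> Rabs (X mu) <= x /\ Rabs (Y mu) <= x).
  { intros mu Hmu. assert (E := Circ mu Hmu). assert (S1 := pow2_ge_0 (X mu)). assert (S2 := pow2_ge_0 (Y mu)).
    split; apply (pow_le_reg _ _ 2); try apply Rabs_pos; try lra; try lia; rewrite pow2_abs; lra. }
  assert (M20 : forall s, Cmod s <= 20 -> Cmod (RtoC r * s) <= 20 * r /\ Cmod (RtoC r * s) <= rho).
  { intros s Hs. rewrite Cmod_mult, Cmod_R, Rabs_right by lra. assert (S0 := Cmod_ge_0 s). split; nra. }
  assert (BR : forall s, Cmod s <= 20 -> Cmod (R1 (RtoC r * s)%C) <= K * (8000 * r ^ 3) /\ Cmod (R2 (RtoC r * s)%C) <= K * (8000 * r ^ 3)).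
  { intros s Hs. destruct (M20 s Hs) as [A1 A2].
    assert (A3 : Cmod (RtoC r * s) ^ 3 <= 8000 * r ^ 3).
    { apply Rle_trans with ((20 * r) ^ 3); [apply pow_incr; split; [apply Cmod_ge_0|exact A1]|]. right. ring. }
    split; [eapply Rle_trans; [apply HR1, A2|]|eapply Rle_trans; [apply HR2, A2|]]; apply Rmult_le_compat_l; lra. }
  assert (BT : forall v1 v2 s, Cmod s <= 20 ->
     Cmod (RtoC (2 * PI) * (RtoC v1 * R1 (RtoC r * s)%C + RtoC v2 * R2 (RtoC r * s)%C))
       <= 2 * PI * ((Rabs v1 + Rabs v2) * (K * (8000 * r ^ 3)))).
  { intros v1 v2 s Hs. destruct (BR s Hs) as [A1 A2].
    rewrite Cmod_mult, Cmod_R, (Rabs_right (2 * PI)) by lra. apply Rmult_le_compat_l; [lra|].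
    eapply Rle_trans; [apply Cmod_triangle|]. rewrite !Cmod_mult, !Cmod_R.
    assert (V1 := Rabs_pos v1). assert (V2 := Rabs_pos v2).
    assert (Rabs v1 * Cmod (R1 (RtoC r * s)%C) <= Rabs v1 * (K * (8000 * r ^ 3))) by (apply Rmult_le_compat_l; assumption).
    assert (Rabs v2 * Cmod (R2 (RtoC r * s)%C) <= Rabs v2 * (K * (8000 * r ^ 3))) by (apply Rmult_le_compat_l; assumption). lra. }
  (* The natural size r^2 lambda of the second-order phase. The parameter [e] is [CE] times this
     quantity. *)
  assert (Er2 : 2 * PI * r ^ 2 * x = Q * r).
  { rewrite <- Erl, El. ring. }
  assert (HOm : forall mu, In mu l -> Rabs (Om mu) <= Q).
  { intros mu Hmu. unfold Om. rewrite Rabs_mult, (Rabs_right (2 * PI * r)) by nra.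
    assert (D := dot_bound (X mu) (Y mu) p1 p2 x ltac:(lra) Hp (Circ mu Hmu)).
    rewrite <- Erl, El. replace (r * (2 * PI * x)) with (2 * PI * r * x) by ring.
    apply Rmult_le_compat_l; [nra|exact D]. }
  assert (HT1 : forall mu s, In mu l -> Cmod s <= 20 -> 400 * Rabs (Be mu) + Cmod (T mu s) <= e).
  { intros mu s Hmu Hs. destruct (Bd mu Hmu) as [B1 B2].
    assert (pr2 : 0 <= 2 * PI * r ^ 2) by (apply Rmult_le_pos; [lra|apply pow2_ge_0]).
    assert (A1 : Rabs (Be mu) <= 2 * K * (Q * r)).
    { unfold Be. rewrite Rabs_mult, (Rabs_right (2 * PI * r ^ 2)) by lra. rewrite <- Er2.
      replace (2 * K * (2 * PI * r ^ 2 * x)) with (2 * PI * r ^ 2 * (x * K + x * K)) by ring.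
      apply Rmult_le_compat_l; [exact pr2|]. unfold W. eapply Rle_trans; [apply Rabs_triang|]. rewrite !Rabs_mult.
      apply Rplus_le_compat; apply Rmult_le_compat; try apply Rabs_pos; assumption. }
    assert (A2 : Cmod (T mu s) <= 16000 * K * (Q * r)).
    { eapply Rle_trans; [apply (BT (X mu) (Y mu) s Hs)|].
      apply Rle_trans with (2 * PI * ((x + x) * (K * (8000 * r ^ 2)))).
      - apply Rmult_le_compat_l; [lra|]. apply Rmult_le_compat.
        + assert (V1 := Rabs_pos (X mu)). assert (V2 := Rabs_pos (Y mu)). lra.
        + apply Rmult_le_pos; [lra|]. apply Rmult_le_pos; [lra|apply pow_le; lra].
        + lra.
        + apply Rmult_le_compat_l; [lra|]. apply Rmult_le_compat_l; [lra|].
          change (r ^ 3) with (r * r ^ 2). assert (0 <= r ^ 2) by apply pow2_ge_0. nra.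
      - right. rewrite <- Er2. ring. }
    rewrite Ee'. assert (Qr : 0 <= Q * r) by (apply Rmult_le_pos; lra).
    apply Rle_trans with (17000 * K * (Q * r)); [|apply Rmult_le_compat_r; assumption].
    assert (0 <= K * (Q * r)) by (apply Rmult_le_pos; lra). lra. }
  assert (HT2 : forall mu nu, In mu l -> In nu l -> mu <> nu -> Rabs (Om nu - Om mu) < th ->
     0 < Rabs (Om nu - Om mu) + Rabs (Be nu - Be mu) /\
     forall s, Cmod s <= 20 -> Cmod (T nu s - T mu s) <= e * (Rabs (Om nu - Om mu) + Rabs (Be nu - Be mu))).
  { intros mu nu Hmu Hnu Hne _.
    set (v1 := X nu - X mu). set (v2 := Y nu - Y mu).
    assert (Cr := cramer_bound p1 p2 q1 q2 v1 v2 K c Hp HK HQ1 HQ2 (conj Hc Hdet)).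
    set (al := v1 * p1 + v2 * p2) in *. set (be := v1 * q1 + v2 * q2) in *.
    assert (EO : Om nu - Om mu = 2 * PI * r * al) by (unfold Om, P, al, v1, v2; ring).
    assert (EB : Be nu - Be mu = 2 * PI * r ^ 2 * be) by (unfold Be, W, be, v1, v2; ring).
    assert (pr2 : 0 < 2 * PI * r ^ 2) by (apply Rmult_lt_0_compat; [lra|apply pow_lt, Hr0]).
    assert (A0 := Rabs_pos al). assert (A1 := Rabs_pos be).
    assert (Eta : 2 * PI * r ^ 2 * (Rabs al + Rabs be) <= Rabs (Om nu - Om mu) + Rabs (Be nu - Be mu)).
    { rewrite EO, EB, (Rabs_mult (2 * PI * r)), (Rabs_mult (2 * PI * r ^ 2)), (Rabs_right (2 * PI * r)), (Rabs_right (2 * PI * r ^ 2)) by nra.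
      assert (r ^ 2 <= r) by (simpl; nra).
      assert (2 * PI * r ^ 2 * Rabs al <= 2 * PI * r * Rabs al) by (apply Rmult_le_compat_r; [lra|]; apply Rmult_le_compat_l; lra). lra. }
    assert (Vp : 0 < Rabs v1 + Rabs v2).
    { assert (V1 := Rabs_pos v1). assert (V2 := Rabs_pos v2).
      destruct (Req_dec v1 0) as [Z1|Z1].
      - destruct (Req_dec v2 0) as [Z2|Z2].
        + elim Hne. destruct mu as [m1 m2], nu as [n1 n2]. unfold v1, v2, X, Y in Z1, Z2. simpl in Z1, Z2.
          f_equal; apply eq_IZR; lra.
        + assert (V := Rabs_pos_lt v2 Z2). lra.
      - assert (V := Rabs_pos_lt v1 Z1). lra. }
    split.
    - eapply Rlt_le_trans; [|exact Eta]. apply Rmult_lt_0_compat; [exact pr2|]. nra.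
    - intros s Hs.
      replace (T nu s - T mu s)%C with (RtoC (2 * PI) * (RtoC v1 * R1 (RtoC r * s)%C + RtoC v2 * R2 (RtoC r * s)%C))%C
        by (unfold T, v1, v2; rewrite !RtoC_minus; ring).
      eapply Rle_trans; [apply BT, Hs|].
      apply Rle_trans with (e * (2 * PI * r ^ 2 * (Rabs al + Rabs be))); [|apply Rmult_le_compat_l; assumption].
      rewrite Ee'.
      set (V := Rabs v1 + Rabs v2) in *. set (S := Rabs al + Rabs be) in *.
      assert (S0 : 0 <= S) by (unfold S; lra).
      (* The difference of remainders is of order r^3 V, while the lower terms are at least of order
         r^2 S, and S is at least a constant times V by [cramer_bound]. The ratio O(r) is below [e]
         because Q >= 1. *)
      assert (F1 : 8000 * K * V <= CE * S).
      { apply (Rmult_le_reg_r c); [exact Hc|].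
        apply Rle_trans with (8000 * K * (2 * K * S)).
        - replace (8000 * K * V * c) with (8000 * K * (c * V)) by ring. apply Rmult_le_compat_l; lra.
        - replace (8000 * K * (2 * K * S)) with (16000 * K * K * S) by ring.
          replace (CE * S * c) with (CE * c * S) by ring. apply Rmult_le_compat_r; assumption. }
      replace (2 * PI * (V * (K * (8000 * r ^ 3)))) with (2 * PI * r ^ 2 * r * (8000 * K * V)) by ring.
      replace (CE * (Q * r) * (2 * PI * r ^ 2 * S)) with (2 * PI * r ^ 2 * r * (Q * (CE * S))) by ring.
      apply Rmult_le_compat_l; [apply Rmult_le_pos; lra|].
      assert (0 <= CE * S) by (apply Rmult_le_pos; lra).
      apply Rle_trans with (1 * (CE * S)); [lra|]. apply Rmult_le_compat_r; assumption. }
  assert (L5 : 1 <= L ^ 5) by (apply pow_R1_Rle, HL).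
  set (side := fun mu => Y mu * p1 - X mu * p2).
  (* Points on the same side of the tangent axis are separated by their projections: the distance
     hypothesis gives a gap of at least x/(4 L^5), hence Q/(4 L^5) in frequency. This is twice [sg],
     in reserve for the triangle inequality below. *)
  assert (Far : forall mu nu, In mu l -> In nu l -> mu <> nu -> 0 <= side mu * side nu -> 2 * sg <= Rabs (Om nu - Om mu)).
  { intros mu nu Hmu Hnu Hne Hs.
    assert (S := proj_separation (X mu) (Y mu) (X nu) (Y nu) p1 p2 x ltac:(lra) Hp (Circ mu Hmu) (Circ nu Hnu) Hs).
    assert (D := Hsep mu nu Hmu Hnu Hne).
    replace (IZR (sqdist mu nu)) with ((X nu - X mu) ^ 2 + (Y nu - Y mu) ^ 2) in D
      by (unfold sqdist, X, Y; rewrite plus_IZR, !mult_IZR, !minus_IZR; ring).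
    fold (P nu) (P mu) in S. set (dP := Rabs (P nu - P mu)) in *.
    replace (Om nu - Om mu) with (2 * PI * r * (P nu - P mu)) by (unfold Om; ring).
    rewrite Rabs_mult, (Rabs_right (2 * PI * r)) by nra. fold dP.
    assert (D2 : x * x <= 4 * x * dP * L ^ 5).
    { replace (x * x) with (x ^ 2) by ring. rewrite Hx2. eapply Rle_trans; [exact D|]. apply Rmult_le_compat_r; lra. }
    assert (D3 : x <= 4 * dP * L ^ 5) by (apply (Rmult_le_reg_r x); [exact Hx|]; lra).
    unfold sg. apply (Rmult_le_reg_r (4 * L ^ 5)); [lra|].
    replace (2 * (Q / (8 * L ^ 5)) * (4 * L ^ 5)) with Q by (field; lra).
    rewrite <- Erl, El. replace (r * (2 * PI * x)) with (2 * PI * r * x) by ring.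
    replace (2 * PI * r * dP * (4 * L ^ 5)) with (2 * PI * r * (4 * dP * L ^ 5)) by ring.
    apply Rmult_le_compat_l; [nra|exact D3]. }
  (* Of three points two lie on the same side of the axis. If both candidates are opposite to [mu],
     they are on a common side and at frequency distance at least 2 [sg] from each other, so they
     cannot both be within [sg] of [mu]. *)
  assert (HT3 : forall mu nu nu', In mu l -> In nu l -> In nu' l -> nu <> mu -> nu' <> mu -> nu <> nu' ->
     Rabs (Om nu - Om mu) < sg -> sg <= Rabs (Om nu' - Om mu)).
  { intros mu nu nu' I1 I2 I3 D1 D2 D3 Hcl.
    destruct (Rle_dec 0 (side mu * side nu)) as [S1|S1].
    { assert (F := Far mu nu I1 I2 (not_eq_sym D1) S1). lra. }
    destruct (Rle_dec 0 (side mu * side nu')) as [S2|S2].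
    { assert (F := Far mu nu' I1 I3 (not_eq_sym D2) S2). lra. }
    assert (S3 : 0 <= side nu * side nu').
    { apply Rnot_le_lt in S1, S2. apply Rnot_lt_le. intros S3.
      assert (E : (side mu * side nu) * (side mu * side nu') = side mu ^ 2 * (side nu * side nu')) by ring.
      assert (Z := pow2_ge_0 (side mu)). nra. }
    assert (F := Far nu nu' I2 I3 D3 S3).
    assert (Tr : Rabs (Om nu' - Om nu) <= Rabs (Om nu' - Om mu) + Rabs (Om nu - Om mu)).
    { rewrite (Rabs_minus_sym (Om nu) (Om mu)).
      replace (Om nu' - Om nu) with ((Om nu' - Om mu) + (Om mu - Om nu)) by ring. apply Rabs_triang. }
    lra. }
  assert (HQ0 : 0 <= Q) by lra.
  assert (Dbl := chirps_doubling Om Be T b l th sg e Q Hth He Hsm HOm HT1 HT2 HT3 (NoDup_lattice_pts m) HN HQ0 N1 N2).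
  fold N in Dbl. fold n in Dbl.
  change (length l) with N in Dbl. fold n in Dbl.
  (* If [f] vanished on the disc of radius 2, the case B = 0 of the doubling theorem would
     annihilate all coefficients, against the normalization. *)
  assert (Hnz : exists z, Cmod z <= 2 /\ f z <> 0).
  { destruct (excluded_middle_informative (exists z, Cmod z <= 2 /\ f z <> 0)) as [E|E]; [exact E|].
    destruct (Dbl 0 (Rle_refl 0)) as [_ Z].
    { intros z Hz. rewrite <- Ef. destruct (Ceq_dec (f z) 0) as [E0|E0]; [rewrite E0, Cmod_0; lra|].
      elim E. exists z. split; assumption. }
    exfalso. assert (Za : forall mu, In mu l -> a mu = 0).
    { intros mu Hmu. specialize (Z eq_refl mu Hmu). unfold b in Z.
      assert (Nz := cexp_neq_0 (ph mu)).
      replace (a mu) with (a mu * cexp (ph mu) * / cexp (ph mu))%C by (field; exact Nz). rewrite Z. ring. }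
    assert (Z0 : forall l', (forall mu, In mu l' -> a mu = 0) -> fold_right Rplus 0 (map (fun mu => Cmod (a mu) ^ 2) l') = 0).
    { induction l' as [|mu l' IH]; intros Hl'; [reflexivity|].
      change (Cmod (a mu) ^ 2 + fold_right Rplus 0 (map (fun nu => Cmod (a nu) ^ 2) l') = 0).
      rewrite IH, (Hl' mu (or_introl eq_refl)), Cmod_0; [ring|]. intros; apply Hl'; right; assumption. }
    unfold coef_norm2 in Hnorm. rewrite (Z0 (lattice_pts m) Za) in Hnorm. lra. }
  assert (Hhol : hol f 0 21).
  { intros w Hw. replace (w - 0)%C with w in Hw by ring.
    assert (Hz : nbhd01 eps (RtoC a0 + RtoC r * w)%C).
    { exists a0. split; [exact Ha0|]. replace (RtoC a0 + RtoC r * w - RtoC a0)%C with (RtoC r * w)%C by ring.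
      rewrite Cmod_mult, Cmod_R, Rabs_right by lra. assert (W0 := Cmod_ge_0 w). nra. }
    destruct (H1 _ Hz) as [d1 Hd1]. destruct (H2 _ Hz) as [d2 Hd2].
    assert (Da : cderiv (fun v => (RtoC a0 + RtoC r * v)%C) w (0 + (0 * w + RtoC r * 1))).
    { apply cderiv_plus; [apply cderiv_const|]. apply cderiv_mult; [apply cderiv_const|apply cderiv_id]. }
    assert (Dg1 := cderiv_comp G1 _ w d1 _ Da Hd1). assert (Dg2 := cderiv_comp G2 _ w d2 _ Da Hd2).
    apply (cderiv_csum (fun mu v => (a mu * cexp (RtoC (2 * PI) * Ci * (RtoC (IZR (fst mu)) * G1 (RtoC a0 + RtoC r * v)%C
        + RtoC (IZR (snd mu)) * G2 (RtoC a0 + RtoC r * v)%C)))%C) l w).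
    intros mu. eexists. apply cderiv_mult; [apply cderiv_const|].
    apply (cderiv_comp cexp); [|apply cderiv_cexp].
    apply cderiv_mult; [apply cderiv_const|].
    apply cderiv_plus; (apply cderiv_mult; [apply cderiv_const|]); [exact Dg1|exact Dg2]. }
  (* Only finiteness of this bound matters: the iteration in [doubling_zeros] halves it
     indefinitely, and it does not enter the number of zeros. *)
  set (M := rsum (fun mu => Cmod (b mu) * (exp (20 * Q) * 3)) l).
  assert (HM : forall z, Cmod z <= 20 -> Cmod (f z) <= M).
  { intros z Hz. rewrite Ef. apply csum_bound. intros mu Hmu. rewrite Cmod_mult.
    apply Rmult_le_compat_l; [apply Cmod_ge_0|]. unfold chirp. rewrite Cmod_mult.
    apply Rmult_le_compat; try apply Cmod_ge_0.
    - apply Cmod_ei_le. assert (B := HOm mu Hmu). assert (Z0 := Cmod_ge_0 z). assert (O0 := Rabs_pos (Om mu)). nra.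
    - apply cexp_bd. eapply Rle_trans; [apply (chirp_phase_bound (Be mu) e (T mu z) z Hz (HT1 mu z Hmu Hz))|]. lra. }
  assert (Cnt : forall zs, NoDup zs -> (forall z, In z zs -> Cmod z < 1 /\ f z = 0) -> (length zs <= 91 * N ^ 7)%nat).
  { intros zs Hzs Hz. apply (zero_count_bound N (length zs) HN).
    apply (doubling_zeros f (2 ^ (21 * n + 2) * exp (22 * Q)) M zs Hhol HM); try assumption.
    intros B HB HfB z Hz'. rewrite Ef. apply Dbl; [exact HB| |exact Hz'].
    intros w Hw. rewrite <- Ef. apply HfB, Hw. }
  destruct (list_of_bounded (fun z => Cmod z < 1 /\ f z = 0) _ Cnt) as (zs & Hlen & Hzs).
  exists zs. split; [exact Hlen|]. intros s Hs Hf. apply Hzs. split; [exact Hs|exact Hf].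
Qed.

Theorem theorem5p1
  (G1 G2 : C -> C) (eps : R)
  (Heps : 0 < eps)
  (Hhol1 : forall z, nbhd01 eps z -> @ex_derive C_AbsRing C_NormedModule G1 z)
  (Hhol2 : forall z, nbhd01 eps z -> @ex_derive C_AbsRing C_NormedModule G2 z)
  (Hreal : forall t, 0 <= t <= 1 -> Im (G1 (RtoC t)) = 0 /\ Im (G2 (RtoC t)) = 0)
  (Harc : forall t, 0 <= t <= 1 ->
     Derive (rtrace G1) t ^ 2 + Derive (rtrace G2) t ^ 2 = 1)
  (Hcurv : forall t, 0 <= t <= 1 ->
     Derive (rtrace G1) t * Derive_n (rtrace G2) 2 t
       - Derive (rtrace G2) t * Derive_n (rtrace G1) 2 t <> 0) :
  exists C0 : R, 0 < C0 /\
  exists Eexc : nat -> bool, rel_density_zero Eexc /\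
  forall m : nat, (1 <= m)%nat -> sum2sq m = true -> Eexc m = false ->
  exists S : list (R * R),
    (length S <= Npts m ^ 2)%nat /\
    (forall I, In I S -> 0 <= fst I <= snd I /\ snd I <= 1 /\
                         snd I - fst I <= C0 * kappa m) /\
    forall a : Z * Z -> C, coef_norm2 m a = 1 ->
      (* (1) |N_Phi \cap U_alpha gamma(S_alpha)| << lambda / N  (points of T^2) *)
      (exists L : list (R * R),
         INR (length L) <= C0 * lam m / INR (Npts m) /\
         forall t, (exists I, In I S /\ fst I <= t <= snd I) ->
           let x := (frac_part (rtrace G1 t), frac_part (rtrace G2 t)) in
           Phi m a (RtoC (fst x)) (RtoC (snd x)) = RtoC 0 -> In x L) /\
      (* (2) zeros of Phi(gamma(z)) in B(a0, N^7/lambda) *)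
      (forall a0 : R, 0 <= a0 <= 1 ->
         (forall I, In I S -> ~ (fst I <= a0 <= snd I)) ->
         exists L : list C,
           INR (length L) <= C0 * INR (Npts m) ^ 7 /\
           forall z : C, Cmod (Cminus z (RtoC a0)) < INR (Npts m) ^ 7 / lam m ->
             nbhd01 eps z ->
             Phi m a (G1 z) (G2 z) = RtoC 0 -> In z L).
Proof.
  assert (H1 : forall z, nbhd01 eps z -> exists d, cderiv G1 z d) by (intros; apply ex_derive_cderiv; auto).
  assert (H2 : forall z, nbhd01 eps z -> exists d, cderiv G2 z d) by (intros; apply ex_derive_cderiv; auto).
  destruct (curve_constants G1 G2 eps Heps H1 H2 Hreal Harc Hcurv) as (rho & K & c & Hrho & Hre & HK & Hc & Hloc).
  set (CE := Rmax (17000 * K) (16000 * K * K / c)).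
  assert (C1 : 17000 * K <= CE) by apply Rmax_l.
  assert (C2 : 16000 * K * K <= CE * c).
  { apply Rle_trans with (16000 * K * K / c * c); [right; field; lra|]. apply Rmult_le_compat_r; [lra|apply Rmax_r]. }
  destruct (numerics CE rho ltac:(lra) Hrho) as (L1 & HL1 & Hnum).
  (* Forces log m >= L1, so that the numerical inequalities hold for every m that is kept. *)
  set (m0 := S (Z.to_nat (up (exp L1)))).
  destruct (almost_all_separated m0) as (E & HE & Hm0).
  exists 91. split; [lra|]. exists E. split; [exact HE|].
  intros m Hm _ HEm. destruct (Hm0 m HEm) as (M0 & Mc & Mp).
  exists nil. split; [simpl; lia|]. split; [intros I []|].
  intros a Hnorm.
  assert (Hlam : 0 <= lam m) by (unfold lam; assert (HP := PI_RGT_0); assert (HS := sqrt_pos (INR m)); apply Rmult_le_pos; lra).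
  split.
  (* With no interval there is no point to list, and only non-negativity of the bound remains; the
     division convention covers N = 0. *)
  { exists nil. split; [|intros t [I [[] _]]]. simpl. unfold Rdiv. apply Rmult_le_pos; [lra|].
    destruct (Req_dec (INR (Npts m)) 0) as [Z|Z]; [rewrite Z, Rinv_0; lra|].
    left. apply Rinv_0_lt_compat. assert (P := pos_INR (Npts m)). lra. }
  intros a0 Ha0 _.
  assert (HN : (1 <= Npts m)%nat).
  { unfold Npts, coef_norm2 in *. destruct (lattice_pts m); [simpl in Hnorm; lra|simpl; lia]. }
  set (L := ln (INR m)).
  assert (Em : exp L1 <= INR m).
  { destruct (archimed (exp L1)) as [U _]. assert (P := exp_pos L1).
    apply le_INR in M0. unfold m0 in M0. rewrite S_INR, INR_IZR_INZ, Z2Nat.id in M0; [lra|]. apply le_IZR. lra. }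
  assert (Hm1 : 1 <= INR m) by (apply (le_INR 1), Hm).
  assert (HL : L1 <= L) by (unfold L; rewrite <- (ln_exp L1); apply ln_le_mono; [apply exp_pos|exact Em]).
  assert (HNL : INR (Npts m) <= L ^ 2) by (apply Rnot_lt_le, Mp).
  assert (Hlm : exp (L / 2) <= lam m).
  { rewrite <- (sqrt_exp_half (INR m) L) by (reflexivity || lra). unfold lam. assert (HP := PI_ge_3). assert (HS := sqrt_pos (INR m)). nra. }
  destruct (Hnum L (Npts m) (lam m) HL HN HNL Hlm) as (th & e & Ee & Hth & He & Hsm & Hr & N1 & N2).
  destruct (Hloc a0 Ha0) as (p1 & p2 & q1 & q2 & Hp & HQ1 & HQ2 & Hdet & HR1 & HR2).
  destruct (Hreal a0 Ha0) as [I1 I2].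
  destruct (zeros_near_point G1 G2 eps rho K c CE a0 p1 p2 q1 q2 m th e L a) as (l & Hl & Hz); try assumption; try lra.
  { intros p q Hp' Hq' Hne. apply Rnot_lt_le. intros Hlt. apply Mc. exists p, q. repeat split; assumption. }
  set (r := INR (Npts m) ^ 7 / lam m) in *.
  assert (Hlp : 0 < lam m) by (assert (X := exp_pos (L / 2)); lra).
  assert (HrP : 0 < r).
  { apply Rdiv_lt_0_compat; [|exact Hlp]. apply pow_lt. apply lt_0_INR. lia. }
  (* Zeros were located in the coordinate s with |s| < 1; the affine change z = a0 + r s takes the
     unit disc to the disc of radius N^7/lambda. *)
  exists (map (fun s => (RtoC a0 + RtoC r * s)%C) l). split.
  - rewrite length_map. apply le_INR in Hl. rewrite mult_INR, pow_INR in Hl.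
    replace (INR 91) with 91 in Hl by (simpl; lra). exact Hl.
  - intros z Hzr _ Hz0. apply in_map_iff.
    assert (Rn : RtoC r <> 0) by (intros E0; apply (f_equal fst) in E0; simpl in E0; lra).
    exists ((z - RtoC a0) / RtoC r)%C.
    assert (Ez : (RtoC a0 + RtoC r * ((z - RtoC a0) / RtoC r))%C = z) by (field; exact Rn).
    split; [exact Ez|]. apply Hz.
    + rewrite Cmod_div, Cmod_R, Rabs_right by (try exact Rn; lra).
      apply (Rmult_lt_reg_r r); [exact HrP|]. unfold Rdiv. rewrite Rmult_assoc, Rinv_l by lra. lra.
    + rewrite Ez. exact Hz0.
Qed.
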